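(* Let $(q_s,\varphi_s)$, $t\le s\le T$, be the (unique classical) solution of the MFG-2 system $$\partial_{s}q_{s}+\nabla\cdot\left[(\mathcal{T}q_{s}+\nabla\varphi_{s})q_{s}\right]=D\Delta q_{s},\qquad q_t=q,$$ $$\partial_{s}\varphi_{s}+\tfrac12|\nabla\varphi_{s}|^{2}+\nabla\varphi_{s}\cdot\mathcal{T}q_{s}+\mathcal{T}^{*}\cdot(q_{s}\nabla\varphi_{s})+D\Delta\varphi_{s}=F(x,q_s),\qquad \varphi_{T}(x)=-G(x,q_T).$$ Given this solution, let $\tilde{\mathcal U}(\tilde q,t)$ be the optimal value function of the modified MFG-1 problem $$\tilde{\mathcal U}(\tilde q,t)=\inf_{\tilde q(\cdot),\tilde\alpha(\cdot)}\left(\int G(x,q_T)\tilde q_T(x)\,dx+\int_t^T\int\left[\tfrac12|\tilde\alpha_s(x)|^2+\tilde F(x,q_s,\varphi_s)\right]\tilde q_s(x)\,dx\,ds\right),$$ where the infimum is over pairs satisfying $\partial_s\tilde q_s+\nabla\cdot[(\mathcal T q_s+\tilde\alpha_s)\tilde q_s]=D\Delta\tilde q_s$ for $t\le s\le T$ and $\tilde q_t=\tilde q$, and where $\tilde F(x,q,\varphi)=F(x,q)-\mathcal T^*\cdot(q\nabla\varphi)$. Then $\tilde{\mathcal U}$ satisfies the functional Hamilton-Jacobi equation, for $t\le T$, $$\begin{aligned}\partial_{t}\tilde{\mathcal U}(\tilde q,t)&-\frac12\int\left|\nabla\frac{\delta\tilde{\mathcal U}}{\delta\tilde q}(\tilde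 q,x,t)\right|^{2}\tilde q(x)\,dx+\int F(x,q_t)\tilde q(x)\,dx+D\int\tilde q(x)\,\Delta\frac{\delta\tilde{\mathcal U}}{\delta\tilde q}(\tilde q,x,t)\,dx\\&+\int\left[\tilde q(x)\,\mathcal T q_t(x)\cdot\nabla\frac{\delta\tilde{\mathcal U}}{\delta\tilde q}(\tilde q,x,t)+q_t(x)\,\mathcal T\tilde q(x)\cdot\nabla\frac{\delta\tilde{\mathcal U}}{\delta\tilde q}(\tilde q,x,t)\right]dx=0,\end{aligned}$$ $$\tilde{\mathcal U}(\tilde q,T)=\int G(x,q_T)\tilde q(x)\,dx.$$ In particular, with the same initial condition $\tilde q_t=q_t=q$, the modified MFG-1 problem gives the same optimal solution as the MFG-2 model: if $(\tilde q_s,\tilde\phi_s)$ denotes its optimal solution (with optimal control $\tilde\alpha_s=\nabla\tilde\phi_s$), then $$\tilde q_s(x)=q_s(x),\qquad \tilde\phi_s(x)=\varphi_s(x),\qquad t\le s\le T.$$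
   Context: The spatial domain is the torus $\mathbb T^d$ (with $d\le 2$), all spatial integrals are over it, $D$ is the diffusion coefficient and $T$ is the terminal time. $\mathcal T$ is an (invertible) linear operator sending a scalar vorticity field $q$ to the velocity field $u=\mathcal T q$, which is incompressible: $\nabla\cdot\mathcal T q=0$. $\mathcal T^*\cdot$ denotes its adjoint, mapping vector fields to scalar fields: $\int v\cdot\mathcal T q\,dx=\int(\mathcal T^*\cdot v)\,q\,dx$. $\mathcal F,\mathcal G$ are functionals of a scalar field with $F(x,q)=\frac{\delta\mathcal F}{\delta q}(q,x)$ and $G(x,q)=\frac{\delta\mathcal G}{\delta q}(q,x)$, where $\frac{\delta}{\delta q}$ is the first variation (functional derivative, a function of $x$). MFG-2 model: minimize $\mathcal G(q_T)+\int_t^T\left[\int\frac12|\alpha_s|^2q_s\,dx+\mathcal F(q_s)\right]ds$ over $(q(\cdot),\alpha(\cdot))$ subject to $\partial_sq_s+\nabla\cdot[(\mathcal Tq_s+\alpha_s)q_s]=D\Delta q_s$, $q_t=q$. The MFG-2 system is its Euler-Lagrange system, with optimal control $\alpha_s=\nabla\varphi_s$. The optimal solution $(\tilde q_s,\tilde\phi_s)$ of the modified MFG-1 problem means the solution of its Euler-Lagrange system $$\partial_s\tilde q_s=-\nabla\cdot[(\mathcal Tq_s+\nabla\tilde\phi_s)\tilde q_s]+D\Delta\tilde q_s,\quad \tilde q_t=\tilde q,$$ $$\partial_s\tilde\phi_s=-\tfrac12|\nabla\tilde\phi_s|^2-\mathcal Tq_s\cdot\nabla\tilde\phi_s-D\Delta\tilde\phi_s+\tilde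 F(x,q_s,\varphi_s),\quad\tilde\phi_T(x)=-G(x,q_T).$$ In $\tilde{\mathcal U}(\tilde q,t)$ the dependence on the whole given curve $\{q_s\}_{t\le s\le T}$ is suppressed from the notation; $\partial_t$ and $\frac{\delta}{\delta\tilde q}$ are taken with that curve fixed. No function spaces are specified; equations, integrations by parts and functional derivatives are understood in the classical sense.
   Formalization: The Hamilton-Jacobi equation and terminal condition are stated only for strictly positive C^2 densities q̃; for sign-changing q̃ the infimum is -∞, and at densities with zeros the two-sided functional derivative does not exist. *)

(* Defs.v *)
From HB Require Import structures.
From mathcomp Require Import all_boot all_order all_algebra.
From mathcomp Require Import all_classical all_reals all_analysis.

Set Implicit Arguments.
Unset Strict Implicit.
Unset Printing Implicit Defensive.

Import Order.TTheory GRing.Theory Num.Theory.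
Import numFieldNormedType.Exports.

Local Open Scope classical_set_scope.
Local Open Scope ring_scope.

(* Functions on the torus T^d = R^d / Z^d are Z^d-periodic functions on R^d;
   points and vectors are row vectors. *)

Section Torus.
Context {R : realType} {d : nat}.
Local Notation E := 'rV[R]_d.
Implicit Types (f g : E -> R) (u v : E -> E).

Definition basis (i : 'I_d) : E := delta_mx 0 i.

Definition periodic (Y : Type) (f : E -> Y) : Prop :=
  forall x i, f (x + basis i) = f x.

Definition partial (i : 'I_d) f : E -> R := fun x => 'D_(basis i) f x.

Definition grad f : E -> E := fun x => \row_i partial i f x.

Definition comp (i : 'I_d) v : E -> R := fun x => v x 0 i.

Definition div v : E -> R := fun x => \sum_i partial i (comp i v) x.

Definition lap f : E -> R := fun x => \sum_i partial i (partial i f) x.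

Definition dot (a b : E) : R := \sum_i a 0 i * b 0 i.

Fixpoint Ck (k : nat) f : Prop :=
  continuous f /\
  if k is k'.+1 then
    forall i, (forall x, derivable f x (basis i)) /\ Ck k' (partial i f)
  else True.

Definition scalar_field (k : nat) f : Prop := periodic f /\ Ck k f.

Definition vector_field (k : nat) v : Prop :=
  periodic v /\ forall i, Ck k (comp i v).

(* Time-dependent fields on [a, b]: continuity is joint in time and space, and
   nothing is required of their values at times outside [a, b]. *)
Fixpoint CtCk (a b : R) (k : nat) (f : R -> E -> R) : Prop :=
  {within `[a, b] `*` [set: E], continuous (fun p : R * E => f p.1 p.2)} /\
  if k is k'.+1 then
    forall i, (forall s, s \in `[a, b] -> forall x, derivable (f s) x (basis i))
      /\ CtCk a b k' (fun s => partial i (f s))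
  else True.

(* f has derivative l at s relative to [a, b]: two-sided inside the interval,
   one-sided at the end points (and a void condition when a = b). *)
Definition deriv_on (a b : R) (f : R -> R) (s l : R) : Prop :=
  (f r - f s) / (r - s) @[r --> within `[a, b] s^'] --> l.

Definition scalar_curve (a b : R) (f : R -> E -> R) : Prop :=
  [/\ forall s, s \in `[a, b] -> periodic (f s),
      CtCk a b 2 f &
      exists2 g : R -> E -> R, CtCk a b 0 g &
        forall s, s \in `[a, b] -> forall x, deriv_on a b (f ^~ x) s (g s x)].

Definition vector_curve (a b : R) (k : nat) (v : R -> E -> E) : Prop :=
  (forall s, s \in `[a, b] -> periodic (v s)) /\
  forall i, CtCk a b k (fun s => comp i (v s)).

End Torus.

(* Integral over the torus, as an iterated integral over the unit cube. *)
Fixpoint tint {R : realType} {d : nat} : ('rV[R]_d -> R) -> R :=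
  match d with
  | 0%N => fun f => f 0
  | d'.+1 => fun f =>
      \int[@lebesgue_measure R]_(x in `[0, 1])
        tint (fun y : 'rV[R]_d' => f (row_mx (x%:M : 'rV[R]_1) y))
  end.

Section Model.
Context {R : realType} {d : nat}.
Local Notation E := 'rV[R]_d.
Local Notation scalar := (E -> R).
Local Notation vector := (E -> E).

(* V is the first variation of the functional Phi at q. *)
Definition first_variation (Phi : scalar -> R) (q V : scalar) : Prop :=
  scalar_field 0 V /\
  forall eta, scalar_field 2 eta ->
    is_derive (0 : R) (1 : R) (fun e : R => Phi (fun x => q x + e * eta x))
      (tint (fun x => V x * eta x)).

(* K sends a scalar q to the velocity K q, and Ks is its adjoint, sending vector
   fields to scalar fields.  Both are total functions, constrained only on C^2
   scalar fields and C^1 vector fields respectively. *)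
Record velocity_operator (K : scalar -> vector) (Ks : vector -> scalar) : Prop :=
  VelocityOperator {
    vel_linear : forall (a : R) f g, scalar_field 2 f -> scalar_field 2 g ->
      K (fun x => a * f x + g x) = (fun x => a *: K f x + K g x);
    vel_field : forall f, scalar_field 2 f -> vector_field 1 (K f);
    vel_div : forall f, scalar_field 2 f -> forall x, div (K f) x = 0;
    vel_adj_field : forall v, vector_field 1 v -> scalar_field 0 (Ks v);
    vel_adjoint : forall v f, vector_field 1 v -> scalar_field 2 f ->
      tint (fun x => dot (v x) (K f x)) = tint (fun x => Ks v x * f x)
  }.

Variables (D : R) (K : scalar -> vector) (Ks : vector -> scalar).
Variables (F G : scalar -> scalar).

(* Classical solutions are C^1 in time and C^2 in space on [t, T]; mfg2_vel and
   mfg2_adj ask the same kind of regularity of the nonlocal terms. *)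
Record mfg2_solution (t T : R) (q0 : scalar) (q phi : R -> scalar) : Prop :=
  Mfg2Solution {
    mfg2_q : scalar_curve t T q;
    mfg2_phi : scalar_curve t T phi;
    mfg2_vel : vector_curve t T 1 (fun s => K (q s));
    mfg2_adj : CtCk t T 0 (fun s => Ks (fun y => q s y *: grad (phi s) y));
    mfg2_fp : forall s, s \in `[t, T] -> forall x,
      deriv_on t T (q ^~ x) s
        (- div (fun y => q s y *: (K (q s) y + grad (phi s) y)) x
         + D * lap (q s) x);
    mfg2_init : forall x, q t x = q0 x;
    mfg2_hjb : forall s, s \in `[t, T] -> forall x,
      deriv_on t T (phi ^~ x) s
        (F (q s) x - 2^-1 * dot (grad (phi s) x) (grad (phi s) x)
         - dot (grad (phi s) x) (K (q s) x)
         - Ks (fun y => q s y *: grad (phi s) y) x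
         - D * lap (phi s) x);
    mfg2_final : forall x, phi T x = - G (q T) x
  }.

Definition Ftilde (q phi : scalar) : scalar :=
  fun x => F q x - Ks (fun y => q y *: grad phi y) x.

(* Modified MFG-1 problem for a given curve (q, phi) and terminal time T. *)
Variables (T : R) (q phi : R -> scalar).

Record mfg1_admissible (t : R) (p0 : scalar) (p : R -> scalar)
    (alpha : R -> vector) : Prop :=
  Mfg1Admissible {
    mfg1_p : scalar_curve t T p;
    mfg1_alpha : vector_curve t T 1 alpha;
    mfg1_fp : forall s, s \in `[t, T] -> forall x,
      deriv_on t T (p ^~ x) s
        (- div (fun y => p s y *: (K (q s) y + alpha s y)) x
         + D * lap (p s) x);
    mfg1_init : forall x, p t x = p0 x
  }.

Definition mfg1_cost (t : R) (p : R -> scalar) (alpha : R -> vector) : R :=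
  tint (fun x => G (q T) x * p T x)
  + \int[@lebesgue_measure R]_(s in `[t, T])
      tint (fun x =>
        (2^-1 * dot (alpha s x) (alpha s x) + Ftilde (q s) (phi s) x) * p s x).

Definition mfg1_costs (p0 : scalar) (t : R) : set R :=
  [set c | exists p alpha,
     mfg1_admissible t p0 p alpha /\ c = mfg1_cost t p alpha].

Definition mfg1_value (p0 : scalar) (t : R) : R := inf (mfg1_costs p0 t).

(* Euler-Lagrange system of the modified MFG-1 problem. *)
Record mfg1_solution (t : R) (p0 : scalar) (p psi : R -> scalar) : Prop :=
  Mfg1Solution {
    el_p : scalar_curve t T p;
    el_psi : scalar_curve t T psi;
    el_fp : forall s, s \in `[t, T] -> forall x,
      deriv_on t T (p ^~ x) s
        (- div (fun y => p s y *: (K (q s) y + grad (psi s) y)) x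
         + D * lap (p s) x);
    el_init : forall x, p t x = p0 x;
    el_hjb : forall s, s \in `[t, T] -> forall x,
      deriv_on t T (psi ^~ x) s
        (- (2^-1 * dot (grad (psi s) x) (grad (psi s) x))
         - dot (K (q s) x) (grad (psi s) x)
         - D * lap (psi s) x + Ftilde (q s) (phi s) x);
    el_final : forall x, psi T x = - G (q T) x
  }.

End Model.

(* Main.v *)
(* Let [phi] be the given adjoint state.  Completing the square in the
   Hamilton-Jacobi equation of [phi] shows that every admissible pair [(p, al)]
   started from [p0] at time [s] costs
     - int phi_s p0 + 1/2 int int |al - grad phi|^2 p,
   and the maximum principle gives [p >= 0]; hence the value is at least
   [- int phi_s p0].  Equality asks for controls close to [grad phi].  The drift
   [K q + grad phi] is only C^1 in space, so that a classical solution of its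
   Fokker-Planck equation is not available; instead one takes a monotone explicit
   finite difference scheme for a mollified drift, applied to functions on the
   whole torus and interpolated in time by C^1 splines.  Its flux is uniformly
   close to that of the Fokker-Planck equation and its density is bounded below,
   so dividing the flux by the density yields an exactly admissible control with
   arbitrarily small excess cost.  The value is therefore the linear functional
   [p0 |-> - int phi_s p0], with first variation [- phi_s], and the functional
   Hamilton-Jacobi equation is the equation of [phi] tested against [p], the
   nonlocal term being moved by the adjointness of [K] and [Ks].  The system of
   the modified problem decouples, and uniqueness is two maximum principles. *)

(* Since [D = 0] is allowed, no smoothing by diffusion can be invoked. Mollifying the drift supplies
   the derivatives that keep the scheme bounded in C^2, but the C^3 bound [C] of the mollified drift
   explodes as the tolerance [e] shrinks. The excess cost is of order [e ^+ 2] divided by the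
   minimum of the density, so this minimum must not depend on [C]. Hence two bounds are carried
   along: the lower and the sup bounds of the scheme use only the C^1 bound [C1], which averaging
   preserves, whereas [C] enters only quantities that are beaten afterwards by the space step [h]
   and then by the time step [tau]. The choices are made in the order mollification width, [h],
   [tau]. The scheme acts on functions of a continuous variable rather than on a grid: shifts
   commute with derivatives, the iterates stay C^2, and one step is exactly a divergence, so that no
   interpolation in space occurs. Strict positivity of the initial density permits the division by
   the density; being an open condition along C^2 directions, it also makes the first variation of
   the value meaningful. *)
Require Import Defs.
From mathcomp Require Import all_boot all_order all_algebra.
From mathcomp Require Import all_classical all_reals all_analysis.
From mathcomp Require Import ring lra.

Set Implicit Arguments.
Unset Strict Implicit.
Unset Printing Implicit Defensive.

Import Order.TTheory GRing.Theory Num.Theory.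
Import numFieldNormedType.Exports.
Import Defs.
Local Open Scope classical_set_scope.
Local Open Scope ring_scope.

(** * Partial derivatives *)

Section Calculus.
Context {R : realType} {d : nat}.
Local Notation E := 'rV[R]_d.
Implicit Types (f g w : E -> R).

(** Bridge between partial derivatives and real analysis: both derivatives are limits of one and the
    same quotient, so results on functions of one variable transfer in either direction. *)
Lemma dquot_line f (x : E) (i : 'I_d) (r : R) (g := fun r : R => f (x + r *: basis i)) :
  (fun h : R => h^-1 *: ((g \o shift r) (h *: (1 : R)) - g r)) =
  (fun h : R => h^-1 *: ((f \o shift (x + r *: basis i)) (h *: basis i)
                         - f (x + r *: basis i))).
Proof.
apply/funext => h /=; congr (_ *: (f _ - f _)).
by rewrite [h *: 1]mulr1 scalerDl addrCA.
Qed.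

Lemma is_derive_line f (x : E) (i : 'I_d) (r : R) :
  derivable f (x + r *: basis i) (basis i) ->
  is_derive r (1 : R) (fun r : R => f (x + r *: basis i)) (partial i f (x + r *: basis i)).
Proof.
move=> df; split; first by rewrite /derivable dquot_line.
by rewrite /partial /derive dquot_line.
Qed.

Lemma is_derive_partial f (x : E) (i : 'I_d) (l : R) :
  is_derive (0 : R) (1 : R) (fun r : R => f (x + r *: basis i)) l ->
  derivable f x (basis i) /\ partial i f x = l.
Proof.
case; rewrite /derivable /partial /derive dquot_line.
by rewrite (_ : x + 0 *: basis i = x) // scale0r addr0.
Qed.

Lemma is_derive_continuous (g : R -> R) (dg : R -> R) :
  (forall r : R, is_derive r (1 : R) g (dg r)) -> continuous g.
Proof.
move=> h r; have /derivable1_diffP/differentiable_continuous hd : derivable g r 1.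
  by case: (h r).
exact: hd.
Qed.

(** The sign of [h] is left free because the scheme shifts both forwards and backwards. *)
Lemma partial_MVT f (x : E) (i : 'I_d) (h : R) : (forall y, derivable f y (basis i)) ->
  exists2 r : R, `|r| <= `|h| & f (x + h *: basis i) - f x = h * partial i f (x + r *: basis i).
Proof.
move=> df; pose g r := f (x + r *: basis i).
have dg (r : R) : is_derive r (1 : R) g (partial i f (x + r *: basis i)) by exact: is_derive_line.
have cg := is_derive_continuous dg.
have [h0|h0] := leP 0 h.
  have [r rI e] := @MVT_segment _ g _ 0 h h0 (fun r _ => dg r) (continuous_subspaceT cg).
  exists r; last by rewrite mulrC; move: e; rewrite /g scale0r addr0 subr0.
  by move: rI; rewrite in_itv /= => /andP[r0 rh]; rewrite !ger0_norm.
have [r rI e] := @MVT_segment _ g _ h 0 (ltW h0) (fun r _ => dg r) (continuous_subspaceT cg).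
exists r.
  move: rI; rewrite in_itv /= => /andP[r0 rh]; rewrite !ler0_norm ?lerN2 //.
  exact: ltW.
move: e; rewrite /g scale0r addr0 sub0r mulrN mulrC => /eqP.
by rewrite -eqr_oppLR opprB => /eqP ->; rewrite mulrC.
Qed.

Lemma partial_lipschitz f i C : (forall y, derivable f y (basis i)) ->
  (forall y, `|partial i f y| <= C) ->
  forall x h, `|f (x + h *: basis i) - f x| <= `|h| * C.
Proof.
move=> df hC x h; have [r _ ->] := partial_MVT x h df.
by rewrite normrM ler_wpM2l.
Qed.

Lemma continuous_mx (X : topologicalType) m n (f : X -> 'M[R]_(m, n)) :
  (forall i j, continuous (fun x => f x i j)) -> continuous f.
Proof.
move=> cf x A [P hP PA].
apply: (@filterS _ (nbhs x) _ [set y | forall i j, P i j (f y i j)]).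
  by move=> y hy; apply: PA.
apply: filter_forall => i; apply: filter_forall => j; exact: (cf i j x _ (hP i j)).
Qed.

Lemma derivable_add f g (x : E) (i : 'I_d) : derivable f x (basis i) -> derivable g x (basis i) ->
  derivable (fun y => f y + g y) x (basis i).
Proof. exact: derivableD. Qed.

Lemma partial_add f g (x : E) (i : 'I_d) : derivable f x (basis i) -> derivable g x (basis i) ->
  partial i (fun y => f y + g y) x = partial i f x + partial i g x.
Proof. exact: deriveD. Qed.

Lemma derivable_mul f g (x : E) (i : 'I_d) : derivable f x (basis i) -> derivable g x (basis i) ->
  derivable (fun y => f y * g y) x (basis i).
Proof. exact: derivableM. Qed.

Lemma partial_mul f g (x : E) (i : 'I_d) : derivable f x (basis i) -> derivable g x (basis i) ->
  partial i (fun y => f y * g y) x = partial i f x * g x + f x * partial i g x.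
Proof.
move=> df dg; rewrite [LHS](deriveM df dg) addrC; congr (_ + _).
exact: mulrC.
Qed.

Lemma derivable_inv f (x : E) (i : 'I_d) : f x != 0 -> derivable f x (basis i) ->
  derivable (fun y => (f y)^-1) x (basis i).
Proof. by move=> f0 df; apply: derivableV. Qed.

Lemma partial_inv f (x : E) (i : 'I_d) : f x != 0 -> derivable f x (basis i) ->
  partial i (fun y => (f y)^-1) x = - partial i f x * (f x)^-1 * (f x)^-1.
Proof.
by move=> f0 df; rewrite /partial deriveV // /GRing.scale /= -exprVn; ring.
Qed.

Lemma partial_cst (c : R) (i : 'I_d) (x : E) : partial i (fun _ : E => c) x = 0.
Proof. exact: derive_cst. Qed.

Lemma derivable_cstE (c : R) i (x : E) : derivable (fun _ : E => c) x (basis i).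
Proof. exact: derivable_cst. Qed.

Lemma derivable_scale (c : R) f (x : E) (i : 'I_d) : derivable f x (basis i) ->
  derivable (fun y => c * f y) x (basis i).
Proof. exact: derivable_mul. Qed.

Lemma partial_scale (c : R) f (x : E) (i : 'I_d) : derivable f x (basis i) ->
  partial i (fun y => c * f y) x = c * partial i f x.
Proof. by move=> df; rewrite (partial_mul (@derivable_cstE c i x) df) partial_cst mul0r add0r. Qed.

Lemma partial_opp f (x : E) (i : 'I_d) : derivable f x (basis i) ->
  partial i (fun y => - f y) x = - partial i f x.
Proof. exact: deriveN. Qed.

Lemma derivable_sub f g (x : E) (i : 'I_d) : derivable f x (basis i) -> derivable g x (basis i) ->
  derivable (fun y => f y - g y) x (basis i).
Proof. exact: derivableB. Qed.

Lemma partial_sub f g (x : E) (i : 'I_d) : derivable f x (basis i) -> derivable g x (basis i) ->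
  partial i (fun y => f y - g y) x = partial i f x - partial i g x.
Proof. exact: deriveB. Qed.

Lemma derivable_bigsum (I : Type) (r : seq I) (F : I -> E -> R) (x : E) (i : 'I_d) :
  (forall k, derivable (F k) x (basis i)) ->
  derivable (fun y => \sum_(k <- r) F k y) x (basis i).
Proof.
move=> dF; elim: r => [|k r IH].
  by under eq_fun do rewrite big_nil; exact: derivable_cstE.
by under eq_fun do rewrite big_cons; exact: (derivable_add (dF k) IH).
Qed.

Lemma partial_bigsum (I : Type) (r : seq I) (F : I -> E -> R) (x : E) (i : 'I_d) :
  (forall k, derivable (F k) x (basis i)) ->
  partial i (fun y => \sum_(k <- r) F k y) x = \sum_(k <- r) partial i (F k) x.
Proof.
move=> dF; elim: r => [|k r IH].
  by under eq_fun do rewrite big_nil; rewrite big_nil partial_cst.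
under eq_fun do rewrite big_cons.
by rewrite (partial_add (dF k) (@derivable_bigsum _ r F x i dF)) IH big_cons.
Qed.

Lemma derivable_shift f (x c : E) (i : 'I_d) : derivable f (x + c) (basis i) ->
  derivable (fun y => f (y + c)) x (basis i).
Proof.
rewrite /derivable => h; suff -> : (fun h : R => h^-1 *: (((fun y => f (y + c)) \o shift x)
  (h *: basis i) - f (x + c))) = (fun h => h^-1 *: ((f \o shift (x + c)) (h *: basis i) - f (x + c))) by [].
by apply/funext => t /=; rewrite addrA.
Qed.

Lemma partial_shift f (c : E) (i : 'I_d) (x : E) : partial i (fun y => f (y + c)) x = partial i f (x + c).
Proof.
rewrite /partial /derive.
rewrite (_ : (fun h : R => _) = (fun h => h^-1 *: ((f \o shift (x + c)) (h *: basis i) - f (x + c)))) //.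
by apply/funext => t /=; rewrite addrA.
Qed.

Lemma partial_periodic i f : periodic f -> periodic (partial i f).
Proof.
by move=> pf x j; rewrite -partial_shift; congr (partial i _ x); apply/funext => y.
Qed.

End Calculus.

(** * Time-dependent fields *)

Section TimeFields.
Context {R : realType} {d : nat}.
Local Notation E := 'rV[R]_d.
Implicit Types (f g : R -> E -> R) (w : E -> R).

(** Retraction of the line onto [[a, b]]. Composing with it extends a curve to all times, so that
    continuity within the interval becomes plain continuity and the compactness arguments need no
    subspace topology. *)
Definition clamp (a b s : R) : R := Num.max a (Num.min b s).

Lemma clampE a b s : s \in `[a, b] -> clamp a b s = s.
Proof.
by rewrite in_itv /= => /andP[as_ sb]; rewrite /clamp min_r // max_r.
Qed.

Lemma clamp_in a b s : a <= b -> clamp a b s \in `[a, b].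
Proof.
by move=> ab; rewrite in_itv /= /clamp le_max lexx ge_max ab ge_min lexx.
Qed.

Lemma continuous_clamp a b : continuous (clamp a b).
Proof.
move=> s; apply: (@continuous_max _ R (fun=> a) (fun s => Num.min b s)); first exact: cvg_cst.
by apply: (@continuous_min _ R (fun=> b) id); [exact: cvg_cst | exact: cvg_id].
Qed.

Lemma continuous_pair (X Y Z : topologicalType) (f : X -> Y) (g : X -> Z) :
  continuous f -> continuous g -> continuous (fun x => (f x, g x)).
Proof. by move=> cf cg x; apply: cvg_pair; [exact: cf | exact: cg]. Qed.

Lemma continuous_fst (X Y : topologicalType) : continuous (@fst X Y).
Proof. by move=> p; exact: cvg_fst. Qed.

Lemma continuous_snd (X Y : topologicalType) : continuous (@snd X Y).
Proof. by move=> p; exact: cvg_snd. Qed.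

Lemma continuous_add (X : topologicalType) (F G : X -> R) :
  continuous F -> continuous G -> continuous (fun x => F x + G x).
Proof. by move=> cF cG x; apply: cvgD; [exact: cF | exact: cG]. Qed.

Lemma continuous_mul (X : topologicalType) (F G : X -> R) :
  continuous F -> continuous G -> continuous (fun x => F x * G x).
Proof. by move=> cF cG x; apply: cvgM; [exact: cF | exact: cG]. Qed.

Lemma continuous_opp (X : topologicalType) (F : X -> R) :
  continuous F -> continuous (fun x => - F x).
Proof. by move=> cF x; apply: cvgN; exact: cF. Qed.

Lemma continuous_sub (X : topologicalType) (F G : X -> R) :
  continuous F -> continuous G -> continuous (fun x => F x - G x).
Proof. by move=> cF /continuous_opp; exact: continuous_add. Qed.

Lemma continuous_const (X Y : topologicalType) (c : Y) : continuous (fun _ : X => c).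
Proof. by move=> x; exact: cvg_cst. Qed.

Lemma continuous_pair_clamp (X : topologicalType) a b :
  continuous (fun q : R * X => (clamp a b q.1, q.2)).
Proof.
apply: continuous_pair; last exact: continuous_snd.
move=> p; apply: (@continuous_comp _ _ _ fst (clamp a b)); first exact: continuous_fst.
exact: continuous_clamp.
Qed.

Lemma within_clamp (X : topologicalType) a b (F : R * E -> X) : a <= b ->
  {within `[a, b] `*` [set: E], continuous F} <->
  continuous (fun p : R * E => F (clamp a b p.1, p.2)).
Proof.
move=> ab; split=> [cF p|cF].
  have Ap : (`[a, b] `*` [set: E]) (clamp a b p.1, p.2).
    by split => //=; exact: clamp_in.
  have := cF (clamp a b p.1, p.2); rewrite /continuous_at /from_subspace => cFp.
  apply: (@cvg_trans _ (F y @[y --> within (`[a, b] `*` [set: E]) (nbhs (clamp a b p.1, p.2))])).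
    move=> U /= hU.
    have cc : (fun q : R * E => (clamp a b q.1, q.2)) q @[q --> p] --> (clamp a b p.1, p.2).
      exact: continuous_pair_clamp.
    apply: (@filterS _ (nbhs p) _ _ _ _ (cc _ hU)) => q /= hq; apply: hq.
    by split => //=; exact: clamp_in.
  by move: cFp; case: (nbhs_subspaceP (`[a, b] `*` [set: E]) (clamp a b p.1, p.2)).
apply: (@subspace_eq_continuous _ _ _ (fun p : R * E => F (clamp a b p.1, p.2))).
  by move=> [s x]; rewrite inE => -[/= sab _]; rewrite clampE.
exact: continuous_subspaceT.
Qed.

Lemma CtCk_cont a b k f : CtCk a b k f ->
  {within `[a, b] `*` [set: E], continuous (fun p : R * E => f p.1 p.2)}.
Proof. by case: k => [|k] []. Qed.

Lemma CtCk_clamp a b k f : a <= b -> CtCk a b k f ->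
  continuous (fun p : R * E => f (clamp a b p.1) p.2).
Proof.
by move=> ab /CtCk_cont cf; move: (cf); rewrite (within_clamp _ ab).
Qed.

Lemma CtCk_pred a b k f : CtCk a b k.+1 f -> CtCk a b k f.
Proof.
elim: k f => [|k IH] f [cf hf]; first by [].
by split => // i; split; [exact: (hf i).1 | exact: (IH _ (hf i).2)].
Qed.

Lemma CtCk_le a b k l f : (l <= k)%N -> CtCk a b k f -> CtCk a b l f.
Proof.
elim: k l f => [|k IH] l f; first by rewrite leqn0 => /eqP ->.
rewrite leq_eqVlt => /orP[/eqP -> //|lk] /CtCk_pred; exact: IH.
Qed.

Lemma CtCk_ext a b k f g : (forall s, s \in `[a, b] -> f s = g s) ->
  CtCk a b k f -> CtCk a b k g.
Proof.
elim: k f g => [|k IH] f g fg [cf hf].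
  split => //; apply: subspace_eq_continuous cf => -[s x].
  by rewrite inE => -[/= sab _]; rewrite /from_subspace fg.
split.
  apply: subspace_eq_continuous cf => -[s x].
  by rewrite inE => -[/= sab _]; rewrite /from_subspace fg.
move=> i; have [h1 h2] := hf i; split.
  by move=> s sab x; rewrite -fg //; exact: h1.
by apply: IH h2 => s sab; rewrite fg.
Qed.

Lemma CtCk_sub a b a' b' k f : a <= a' -> b' <= b -> CtCk a b k f -> CtCk a' b' k f.
Proof.
move=> aa bb.
have S : `[a', b'] `*` [set: E] `<=` `[a, b] `*` [set: E].
  move=> [s x] [/= + _]; rewrite in_itv /= => /andP[h1 h2]; split => //=.
  by rewrite in_itv /= (le_trans aa) //= (le_trans h2).
elim: k f => [|k IH] f [cf hf].
  by split => //; exact: continuous_subspaceW cf.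
split; first exact: continuous_subspaceW cf.
move=> i; have [h1 h2] := hf i; split; last exact: IH.
move=> s; rewrite in_itv /= => /andP[s1 s2]; apply: h1.
by rewrite in_itv /= (le_trans aa) //= (le_trans s2).
Qed.

Lemma CtCk_derivable a b k f i s x : CtCk a b k.+1 f -> s \in `[a, b] ->
  derivable (f s) x (basis i).
Proof. by case=> _ h sab; exact: (h i).1. Qed.

Lemma CtCk_partial a b k f i : CtCk a b k.+1 f -> CtCk a b k (fun s => partial i (f s)).
Proof. by case=> _ h; exact: (h i).2. Qed.

Lemma CtCkD a b k f g : CtCk a b k f -> CtCk a b k g ->
  CtCk a b k (fun s x => f s x + g s x).
Proof.
elim: k f g => [|k IH] f g Hf Hg.
  split=> //; exact: (continuous_add (CtCk_cont Hf) (CtCk_cont Hg)).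
split=> [|i]; first exact: (continuous_add (CtCk_cont Hf) (CtCk_cont Hg)).
split=> [s sab x|].
  by apply: derivable_add; [exact: CtCk_derivable Hf sab | exact: CtCk_derivable Hg sab].
apply: CtCk_ext (IH _ _ (CtCk_partial i Hf) (CtCk_partial i Hg)) => s sab.
apply/funext => x; rewrite partial_add //.
  exact: CtCk_derivable Hf sab.
exact: CtCk_derivable Hg sab.
Qed.

Lemma CtCkM a b k f g : CtCk a b k f -> CtCk a b k g ->
  CtCk a b k (fun s x => f s x * g s x).
Proof.
elim: k f g => [|k IH] f g Hf Hg.
  split=> //; exact: (continuous_mul (CtCk_cont Hf) (CtCk_cont Hg)).
split=> [|i]; first exact: (continuous_mul (CtCk_cont Hf) (CtCk_cont Hg)).
split=> [s sab x|].
  by apply: derivable_mul; [exact: CtCk_derivable Hf sab | exact: CtCk_derivable Hg sab].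
apply: CtCk_ext (CtCkD (IH _ _ (CtCk_partial i Hf) (CtCk_pred Hg))
  (IH _ _ (CtCk_pred Hf) (CtCk_partial i Hg))) => s sab.
apply/funext => x; rewrite partial_mul //.
  exact: CtCk_derivable Hf sab.
exact: CtCk_derivable Hg sab.
Qed.

(** Every space derivative of a function of time alone is zero, so mere continuity of [c] gives all
    orders; the zero field is handled first because it, unlike [c], reproduces itself under
    differentiation. *)
Lemma CtCk_time a b k (c : R -> R) : {within `[a, b], continuous c} ->
  CtCk a b k (fun s (_ : E) => c s).
Proof.
move=> cc; have cw : {within `[a, b] `*` [set: E], continuous (fun p : R * E => c p.1)}.
  rewrite continuous_subspace_in => p; rewrite inE => Ap.
  rewrite /from_subspace /prop_for /continuous_at.
  have [_ | //] := nbhs_subspaceP (`[a, b] `*` [set: E]) p; have {Ap}[/= Ap _] := Ap.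
  move=> U /= hU; have := cc p.1 U hU.
  have [_ | //] := nbhs_subspaceP (`[a, b]) p.1.
  rewrite !nbhs_simpl /= /within /= => h.
  have h' := @cvg_fst R E (nbhs (p.1 : R)) (nbhs (p.2 : E)) _ _ h.
  by apply: (@filterS _ (nbhs (p : R * E)) _ _ _ _ (h' _)) => q /= hq [hq1 _]; exact: hq.
have z0 : forall l, CtCk a b l (fun (s : R) (_ : E) => 0 : R).
  elim=> [|l IH]; first by split => //; apply: continuous_subspaceT; exact: cst_continuous.
  split; first by apply: continuous_subspaceT; exact: cst_continuous.
  move=> i; split=> [s _ x|]; first exact: derivable_cstE.
  by apply: CtCk_ext IH => s _; apply/funext => x; rewrite partial_cst.
case: k => [|k]; first by [].
split => // i; split=> [s _ x|]; first exact: derivable_cstE.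
by apply: CtCk_ext (z0 k) => s _; apply/funext => x; rewrite partial_cst.
Qed.

Lemma CtCk_cst a b k (c : R) : CtCk a b k (fun (_ : R) (_ : E) => c).
Proof. by apply: CtCk_time; apply: continuous_subspaceT; exact: cst_continuous. Qed.

Lemma CtCkN a b k f : CtCk a b k f -> CtCk a b k (fun s x => - f s x).
Proof.
move=> Hf; apply: CtCk_ext (CtCkM (CtCk_cst a b k (-1)) Hf) => s _.
by apply/funext => x; rewrite mulN1r.
Qed.

Lemma CtCkB a b k f g : CtCk a b k f -> CtCk a b k g ->
  CtCk a b k (fun s x => f s x - g s x).
Proof. by move=> Hf Hg; exact: (CtCkD Hf (CtCkN Hg)). Qed.

Lemma CtCk_sum (I : Type) (r : seq I) a b k (F : I -> R -> E -> R) :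
  (forall j, CtCk a b k (F j)) -> CtCk a b k (fun s x => \sum_(j <- r) F j s x).
Proof.
move=> HF; elim: r => [|j r IH].
  apply: CtCk_ext (CtCk_cst a b k 0) => s _; apply/funext => x.
  by rewrite big_nil.
by apply: CtCk_ext (CtCkD (HF j) IH) => s _; apply/funext => x; rewrite big_cons.
Qed.

(** The derivative of the inverse is a product involving the inverse itself at one order less, which
    closes the induction. *)
Lemma CtCkV a b k f : (forall s, s \in `[a, b] -> forall x, f s x != 0) ->
  CtCk a b k f -> CtCk a b k (fun s x => (f s x)^-1).
Proof.
move=> f0; elim: k f f0 => [|k IH] f f0 Hf.
  split=> //; rewrite continuous_subspace_in => p; rewrite inE => -[/= pab _].
  by apply: cvgV; [exact: f0 | exact: CtCk_cont Hf p].
split=> [|i].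
  rewrite continuous_subspace_in => p; rewrite inE => -[/= pab _].
  by apply: cvgV; [exact: f0 | exact: CtCk_cont Hf p].
split=> [s sab x|].
  by apply: derivable_inv; [exact: f0 | exact: CtCk_derivable Hf sab].
have Hi := IH f f0 (CtCk_pred Hf).
apply: CtCk_ext (CtCkM (CtCkM (CtCkN (CtCk_partial i Hf)) Hi) Hi) => s sab.
apply/funext => x; rewrite partial_inv //; first exact: f0.
exact: CtCk_derivable Hf sab.
Qed.

Lemma Ck_cont k w : Ck k w -> continuous w.
Proof. by case: k => [|k] []. Qed.

Lemma Ck_CtCk a b k w : Ck k w -> CtCk a b k (fun _ => w).
Proof.
have cS (v : E -> R) : continuous v -> continuous (fun p : R * E => v p.2).
  by move=> cv p; apply: continuous_comp; [exact: cvg_snd | exact: cv].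
elim: k w => [|k IH] w Hw.
  by split => //; apply: continuous_subspaceT; apply: cS; exact: Ck_cont Hw.
split; first by apply: continuous_subspaceT; apply: cS; exact: Ck_cont Hw.
by move=> i; case: Hw => _ /(_ i)[h1 h2]; split => //; exact: IH.
Qed.

Lemma CtCk_slice_cont a b k f s : CtCk a b k f -> s \in `[a, b] -> continuous (f s).
Proof.
move=> Hf sab; have ab : a <= b.
  by move: sab; rewrite in_itv /= => /andP[]; exact: le_trans.
have := CtCk_clamp ab Hf => cf x.
have -> : f s = (fun p : R * E => f (clamp a b p.1) p.2) \o (fun y => (s, y)).
  by apply/funext => y /=; rewrite clampE.
apply: continuous_comp; last exact: cf.
by apply: (@continuous_pair E R E (fun=> s) id) => y; [exact: cst_continuous | exact: cvg_id].
Qed.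

Lemma CtCk_slice a b k f s : CtCk a b k f -> s \in `[a, b] -> Ck k (f s).
Proof.
move=> + sab; elim: k f => [|k IH] f Hf.
  by split => //; exact: CtCk_slice_cont Hf sab.
split; first exact: CtCk_slice_cont Hf sab.
by move=> i; split; [move=> x; exact: CtCk_derivable Hf sab | exact: IH (CtCk_partial i Hf)].
Qed.

Lemma itv00 : (0 : R) \in `[(0 : R), 0]. Proof. by rewrite in_itv /= lexx. Qed.

(** Static fields are treated as constant curves over the one-point interval [[0, 0]]; the closure
    properties of [Ck] are thereby read off from those of [CtCk]. *)
Lemma Ck_via k w : CtCk 0 0 k (fun _ => w) -> Ck k w.
Proof. by move=> /CtCk_slice/(_ itv00). Qed.

Lemma CkD k (v w : E -> R) : Ck k v -> Ck k w -> Ck k (fun x => v x + w x).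
Proof.
by move=> /(Ck_CtCk 0 0) h /(Ck_CtCk 0 0) h'; apply: Ck_via; exact: CtCkD h h'.
Qed.

Lemma CkM k (v w : E -> R) : Ck k v -> Ck k w -> Ck k (fun x => v x * w x).
Proof.
by move=> /(Ck_CtCk 0 0) h /(Ck_CtCk 0 0) h'; apply: Ck_via; exact: CtCkM h h'.
Qed.

Lemma CkN k w : Ck k w -> Ck k (fun x => - w x).
Proof. by move=> /(Ck_CtCk 0 0) h; apply: Ck_via; exact: CtCkN h. Qed.

Lemma CkB k (v w : E -> R) : Ck k v -> Ck k w -> Ck k (fun x => v x - w x).
Proof. by move=> hv /CkN; exact: CkD. Qed.

Lemma Ck_cst k (c : R) : Ck k (fun _ : E => c).
Proof. by apply: Ck_via; exact: CtCk_cst. Qed.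

Lemma Ck_scale k (c : R) w : Ck k w -> Ck k (fun x => c * w x).
Proof. by apply: CkM; exact: Ck_cst. Qed.

Lemma Ck_sum (I : Type) (r : seq I) k (F : I -> E -> R) :
  (forall j, Ck k (F j)) -> Ck k (fun x => \sum_(j <- r) F j x).
Proof.
move=> HF; apply: Ck_via; apply: (@CtCk_sum _ r 0 0 k (fun j _ => F j)) => j.
exact: Ck_CtCk.
Qed.

Lemma Ck_derivable k w i x : Ck k.+1 w -> derivable w x (basis i).
Proof. by case=> _ h; exact: (h i).1. Qed.

Lemma Ck_partial k w i : Ck k.+1 w -> Ck k (partial i w).
Proof. by case=> _ h; exact: (h i).2. Qed.

Lemma Ck_pred k w : Ck k.+1 w -> Ck k w.
Proof. by move=> /(Ck_CtCk 0 0)/CtCk_pred h; apply: Ck_via. Qed.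

Lemma Ck_le k l w : (l <= k)%N -> Ck k w -> Ck l w.
Proof. by move=> lk /(Ck_CtCk 0 0)/(CtCk_le lk) h; apply: Ck_via. Qed.

Lemma Ck_shift k w (c : E) : Ck k w -> Ck k (fun x => w (x + c)).
Proof.
have cS (v : E -> R) : continuous v -> continuous (fun x : E => v (x + c)).
  move=> cv x; apply: (@continuous_comp _ _ _ (fun x : E => x + c) v); last exact: cv.
  by apply: (@continuousD _ _ _ (@id E) (fun=> c)); [exact: cvg_id | exact: cst_continuous].
elim: k w => [|k IH] w [cw hw]; first by split => //; exact: cS.
split; first exact: cS.
move=> i; have [h1 h2] := hw i; split; first by move=> x; exact: derivable_shift.
rewrite (_ : partial i _ = fun x => partial i w (x + c)); first exact: IH.
by apply/funext => x; rewrite partial_shift.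
Qed.

End TimeFields.

(** * Derivatives relative to an interval *)

Section OneVariable.
Context {R : realType}.
Local Notation mu := (@lebesgue_measure R).
Implicit Types (f g : R -> R).

Lemma deriv_onP (a b : R) f (s l : R) : deriv_on a b f s l <->
  forall e : R, 0 < e -> exists2 dl : R, 0 < dl & forall r : R, r \in `[a, b] -> r != s ->
    `|r - s| < dl -> `|(f r - f s) / (r - s) - l| < e.
Proof.
rewrite /deriv_on; split=> [/cvgrPdist_lt h e e0|h].
  have := h e e0; rewrite near_withinE /dnbhs near_withinE.
  move=> /nbhs_ballP[dl /= dl0 hdl]; exists dl => // r rab rs rd.
  rewrite distrC; apply: (hdl r) => //.
  by rewrite /ball /= distrC.
apply/cvgrPdist_lt => e e0; have [dl dl0 hdl] := h e e0.
rewrite near_withinE /dnbhs near_withinE; apply/nbhs_ballP; exists dl => //= r rd rs rab.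
rewrite distrC; apply: hdl => //.
by move: rd; rewrite /ball /= distrC.
Qed.

Lemma is_deriveP f (s l : R) : is_derive s (1 : R) f l <->
  forall e : R, 0 < e -> exists2 dl : R, 0 < dl & forall r : R, r != s ->
    `|r - s| < dl -> `|(f r - f s) / (r - s) - l| < e.
Proof.
have Q (h : R) : h^-1 *: ((f \o shift s) (h *: (1 : R)) - f s) = (f (h + s) - f s) / h.
  by rewrite /= [h *: 1]mulr1 [_ *: _]mulrC.
split=> [[df dl] e e0|h].
  have cv := df; move: dl; rewrite /derive => dl.
  have {cv} /cvgrPdist_lt/(_ e e0) : (fun h : R => h^-1 *: ((f \o shift s) (h *: (1 : R)) - f s)) @ 0^' --> l.
    by rewrite -dl; exact: cv.
  rewrite /dnbhs near_withinE => /nbhs_ballP[dl' /= dl0 hdl]; exists dl' => // r rs rd.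
  have := hdl (r - s); rewrite /ball /= sub0r normrN => /(_ rd).
  rewrite subr_eq0 => /(_ rs); rewrite [_ *: 1]mulr1 subrK [_ *: _]mulrC distrC.
  exact.
have cv : (fun h : R => h^-1 *: ((f \o shift s) (h *: (1 : R)) - f s)) @ 0^' --> l.
  apply/cvgrPdist_lt => e e0; have [dl dl0 hdl] := h e e0.
  rewrite /dnbhs near_withinE; apply/nbhs_ballP; exists dl => //= r.
  rewrite /ball /= sub0r normrN => rd r0; rewrite Q distrC.
  have := hdl (r + s); rewrite addrK; apply => //.
  by rewrite -subr_eq0 addrK.
split; first by apply/cvg_ex; exists l.
by rewrite /derive; apply/cvg_lim => //; exact: norm_hausdorff.
Qed.

Lemma is_derive_deriv_on (a b : R) f (s l : R) : is_derive s (1 : R) f l -> deriv_on a b f s l.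
Proof.
move=> /is_deriveP h; apply/deriv_onP => e /h[dl dl0 hdl].
by exists dl => // r _; exact: hdl.
Qed.

Lemma deriv_on_interior (a b : R) f (s l : R) : s \in `]a, b[ -> deriv_on a b f s l ->
  is_derive s (1 : R) f l.
Proof.
rewrite in_itv /= => /andP[as_ sb] /deriv_onP h; apply/is_deriveP => e /h[dl dl0 hdl].
exists (Num.min dl (Num.min (s - a) (b - s))).
  by rewrite !lt_min dl0 !subr_gt0 as_ sb.
move=> r rs; rewrite !lt_min => /and3P[rd r1 r2]; apply: hdl => //.
rewrite in_itv /=; move: r1 r2; rewrite !ltr_norml => /andP[r1 _] /andP[_ r2].
by apply/andP; split; lra.
Qed.

Lemma deriv_on_sub (a b a' b' : R) f (s l : R) : a <= a' -> b' <= b ->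
  deriv_on a b f s l -> deriv_on a' b' f s l.
Proof.
move=> aa bb /deriv_onP h; apply/deriv_onP => e /h[dl dl0 hdl]; exists dl => // r.
rewrite in_itv /= => /andP[r1 r2]; apply: hdl.
by rewrite in_itv /= (le_trans aa) //= (le_trans r2).
Qed.

Lemma deriv_on_ext (a b : R) f g (s l : R) : s \in `[a, b] ->
  (forall r, r \in `[a, b] -> f r = g r) -> deriv_on a b f s l -> deriv_on a b g s l.
Proof.
move=> sab fg /deriv_onP h; apply/deriv_onP => e /h[dl dl0 hdl]; exists dl => // r rab.
by rewrite -!fg //; exact: hdl.
Qed.

Lemma deriv_onD (a b : R) f g (s l m : R) : deriv_on a b f s l -> deriv_on a b g s m ->
  deriv_on a b (fun r => f r + g r) s (l + m).
Proof.
rewrite /deriv_on => hf hg.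
rewrite (_ : (fun r => _) = (fun r => (f r - f s) / (r - s) + (g r - g s) / (r - s))).
  exact: (cvgD hf hg).
by apply/funext => r; ring.
Qed.

Lemma deriv_onZ (a b c : R) f (s l : R) : deriv_on a b f s l ->
  deriv_on a b (fun r => c * f r) s (c * l).
Proof.
rewrite /deriv_on => hf.
rewrite (_ : (fun r => _) = (fun r => c * ((f r - f s) / (r - s)))).
  by apply: cvgM; [exact: cvg_cst | exact: hf].
by apply/funext => r; ring.
Qed.

Lemma deriv_onN (a b : R) f (s l : R) : deriv_on a b f s l ->
  deriv_on a b (fun r => - f r) s (- l).
Proof.
move=> h; have := @deriv_onZ a b (-1) f s l h; rewrite mulN1r.
by congr deriv_on; apply/funext => r; rewrite mulN1r.
Qed.

Lemma deriv_onB (a b : R) f g (s l m : R) : deriv_on a b f s l -> deriv_on a b g s m ->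
  deriv_on a b (fun r => f r - g r) s (l - m).
Proof. by move=> hf /deriv_onN; exact: deriv_onD. Qed.

Lemma deriv_on_continuous (a b : R) f (s l : R) : deriv_on a b f s l ->
  f r @[r --> within `[a, b] (nbhs s)] --> f s.
Proof.
move=> /deriv_onP h; apply/cvgrPdist_lt => e e0.
have [dl dl0 hdl] := h 1 ltr01.
rewrite near_withinE; apply/nbhs_ballP.
exists (Num.min dl (e / (`|l| + 1))).
  by rewrite /= lt_min dl0 divr_gt0 // ltr_pwDr.
move=> r; rewrite /ball /= distrC lt_min => /andP[rd re] rab.
have [->|rs] := eqVneq r s; first by rewrite subrr normr0.
have q := hdl r rab rs rd.
have rs0 : 0 < `|r - s| by rewrite normr_gt0 subr_eq0.
have e1 : f r - f s = ((f r - f s) / (r - s)) * (r - s) by rewrite divfK // subr_eq0.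
rewrite distrC e1 normrM.
have q2 : `|(f r - f s) / (r - s)| <= `|l| + 1.
  rewrite -[X in `|X|](subrK l); apply: (le_trans (ler_normD _ _)).
  by rewrite addrC lerD2l ltW.
apply: (le_lt_trans (ler_wpM2r (ltW rs0) q2)).
by rewrite mulrC -ltr_pdivlMr // ltr_pwDr.
Qed.

Lemma deriv_on_within (a b : R) f df : (forall s, s \in `[a, b] -> deriv_on a b f s (df s)) ->
  {within `[a, b], continuous f}.
Proof.
move=> h; rewrite continuous_subspace_in => s; rewrite inE => sab.
rewrite /prop_for /continuous_at.
have [_ | //] := nbhs_subspaceP `[a, b] s.
by apply: (@deriv_on_continuous a b f s (df s)); exact: h.
Qed.

Lemma deriv_on_MVT (a b : R) f df r s : (forall s, s \in `[a, b] -> deriv_on a b f s (df s)) ->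
  r \in `[a, b] -> s \in `[a, b] -> r < s ->
  exists2 u, u \in `]r, s[ & f s - f r = df u * (s - r).
Proof.
rewrite !in_itv /= => h /andP[ar rb] /andP[as_ sb] rs.
apply: MVT => // [x|].
  rewrite in_itv /= => /andP[rx xs]; apply: (@deriv_on_interior a b).
    by rewrite in_itv /= (le_lt_trans ar) //= (lt_le_trans xs).
  by apply: h; rewrite in_itv /= (le_trans ar (ltW rx)) //= (le_trans (ltW xs)).
apply: (@deriv_on_within r s f df) => u; rewrite in_itv /= => /andP[ru us].
apply: (@deriv_on_sub a b) => //; apply: h.
by rewrite in_itv /= (le_trans ar) //= (le_trans us).
Qed.

(** Two limits can be compared as soon as the interval contains points close to [s] and distinct
    from it. Such a point is taken on the right of [s], or on the left when [s] is the right end; on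
    a one-point interval there is none. *)
Lemma deriv_on_unique (a b : R) f (s l m : R) : a < b -> s \in `[a, b] ->
  deriv_on a b f s l -> deriv_on a b f s m -> l = m.
Proof.
move=> ab; rewrite in_itv /= => /andP[as_ sb] /deriv_onP hl /deriv_onP hm.
apply/eqP; rewrite -subr_eq0 -normr_le0; apply/ler_addgt0Pl => e e0; rewrite addr0.
have e2 : 0 < e / 2 by rewrite divr_gt0.
have [d1 d10 h1] := hl _ e2; have [d2 d20 h2] := hm _ e2.
have [r rab [rs r1 r2]] : exists2 r, r \in `[a, b] & [/\ r != s, `|r - s| < d1 & `|r - s| < d2].
  pose dd := Num.min d1 d2 / 2.
  have m0 : 0 < Num.min d1 d2 by rewrite lt_min d10 d20.
  have dd0 : 0 < dd by rewrite divr_gt0.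
  have ddm : dd < Num.min d1 d2 by rewrite /dd; lra.
  have [dd1 dd2] : dd < d1 /\ dd < d2 by move: ddm; rewrite lt_min => /andP[].
  have [sb'|sb'] := ltP s b.
    exists (Num.min (s + dd) b).
      by rewrite in_itv /= le_min ge_min lexx orbT (ltW ab) andbT; apply/andP; split => //; lra.
    have p1 : s < Num.min (s + dd) b by rewrite lt_min sb' ltrDl dd0.
    have p2 : Num.min (s + dd) b <= s + dd by rewrite ge_min lexx.
    by rewrite gt_eqF // gtr0_norm ?subr_gt0 //; split=> //; lra.
  exists (Num.max (s - dd) a).
    by rewrite in_itv /= ge_max le_max lexx orbT (ltW ab) andbT /=; lra.
  have p1 : Num.max (s - dd) a < s by rewrite gt_max ltrBlDr ltrDl dd0 /=; lra.
  have p2 : s - dd <= Num.max (s - dd) a by rewrite le_max lexx.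
  by rewrite lt_eqF // distrC gtr0_norm ?subr_gt0 //; split=> //; lra.
have := h1 r rab rs r1; have := h2 r rab rs r2.
set q := (_ / _) => q1 q2.
have -> : l - m = (q - m) - (q - l) by ring.
by rewrite (le_trans (ler_normB _ _)) // ltW // (splitr e) ltrD.
Qed.

Lemma within_integrable (a b : R) f : {within `[a, b], continuous f} ->
  mu.-integrable `[a, b] (EFin \o f).
Proof. by move=> cf; apply: continuous_compact_integrable => //; exact: segment_compact. Qed.

Lemma deriv_on_FTC (a b : R) f df : a < b ->
  (forall s, s \in `[a, b] -> deriv_on a b f s (df s)) ->
  {within `[a, b], continuous df} ->
  \int[mu]_(s in `[a, b]) df s = f b - f a.
Proof.
move=> ab h cdf; rewrite /Rintegral (@continuous_FTC2 _ df f a b) //.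
  have [_ ca cb] : [/\ True, f x @[x --> a^'+] --> f a & f x @[x --> b^'-] --> f b].
    have [_ ca cb] := (continuous_within_itvP f ab).1 (deriv_on_within h).
    by [].
  split => // x xab; have : is_derive x (1 : R) f (df x).
    apply: (deriv_on_interior xab); apply: h.
    by move: xab; rewrite !in_itv /= => /andP[/ltW -> /ltW ->].
  by case.
move=> x xab; have : is_derive x (1 : R) f (df x).
  apply: (deriv_on_interior xab); apply: h.
  by move: xab; rewrite !in_itv /= => /andP[/ltW -> /ltW ->].
by case=> _ <-; rewrite derive1E.
Qed.

Lemma within_intD (a b : R) f g : {within `[a, b], continuous f} ->
  {within `[a, b], continuous g} ->
  \int[mu]_(s in `[a, b]) (f s + g s) = \int[mu]_(s in `[a, b]) f s + \int[mu]_(s in `[a, b]) g s.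
Proof. by move=> cf cg; apply: RintegralD => //; exact: within_integrable. Qed.

Lemma within_intZ (a b c : R) f : {within `[a, b], continuous f} ->
  \int[mu]_(s in `[a, b]) (c * f s) = c * \int[mu]_(s in `[a, b]) f s.
Proof. by move=> cf; apply: RintegralZl => //; exact: within_integrable. Qed.

Lemma within_int_le (a b : R) f g : {within `[a, b], continuous f} ->
  {within `[a, b], continuous g} -> (forall s, s \in `[a, b] -> f s <= g s) ->
  \int[mu]_(s in `[a, b]) f s <= \int[mu]_(s in `[a, b]) g s.
Proof. by move=> cf cg h; apply: le_Rintegral => //; exact: within_integrable. Qed.

Lemma int_cst (a b c : R) : a <= b -> \int[mu]_(s in `[a, b]) c = c * (b - a).
Proof.
move=> ab; rewrite Rintegral_cst //= lebesgue_measure_itv /= lte_fin.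
move: ab; rewrite le_eqVlt => /orP[/eqP ->|->] //.
by rewrite ltxx subrr mulr0.
Qed.

End OneVariable.

(** * Uniformity over compact sets *)

Section UniformConvergence.
Context {R : realType}.

(** Tube lemma: compactness of [A] turns smallness near each [(a0, y)] into one neighbourhood of
    [a0] valid for all [y]. Continuity of integrals, differentiation under the integral and uniform
    moduli in time all rest on it. *)
Lemma compact_uniform (X Y : topologicalType) (A : set Y) (G : X * Y -> R) a0 :
  compact A -> continuous G -> (forall y, A y -> G (a0, y) = 0) ->
  forall e : R, 0 < e -> \forall a \near a0, forall y, A y -> `|G (a, y)| < e.
Proof.
move=> /compact_near_coveringP cA cG G0 e e0.
apply: (cA X (nbhs a0) (fun a y => `|G (a, y)| < e)) => y Ay.
have := cG (a0, y); rewrite /continuous_at G0 // => /cvgrPdist_lt/(_ e e0).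
case=> -[U V] /= [Ua Vy] UV; exists (V, U) => //= -[y' a'] [/= Vy' Ua'].
by have := UV (a', y') (conj Ua' Vy'); rewrite sub0r normrN.
Qed.

End UniformConvergence.

(** * The integral over the torus: continuity, linearity, differentiation under the integral *)

Section TorusIntegral.
Context {R : realType}.
Local Notation mu := (@lebesgue_measure R).

Definition cube {d} : set 'rV[R]_d := [set v | forall i, `[0, 1]%classic (v ord0 i)].

Lemma compact_cube d : compact (@cube d).
Proof. by apply: (@rV_compact R d (fun=> `[0, 1]%classic)) => i; exact: segment_compact. Qed.

Lemma cube_row d (x : R) (y : 'rV[R]_d) : x \in `[0, 1] -> cube y ->
  cube (row_mx (x%:M : 'rV[R]_1) y : 'rV[R]_d.+1).
Proof.
move=> hx hy i; have := splitP (i : 'I_(1 + d)).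
case: (@splitP 1 d i) => j ij _.
  have -> : i = lshift d j by apply/val_inj.
  by rewrite (@row_mxEl _ 1 1 d) mxE !ord1 eqxx mulr1n.
have -> : i = rshift 1 j by apply/val_inj.
by rewrite (@row_mxEr _ 1 1 d).
Qed.

Lemma continuous_row d : continuous (fun p : R * 'rV[R]_d =>
  row_mx (p.1%:M : 'rV[R]_1) p.2 : 'rV[R]_d.+1).
Proof.
apply: continuous_mx => i k; case: (@splitP 1 d k) => j kj.
  have -> : k = lshift d j by apply/val_inj.
  rewrite (_ : (fun _ => _) = (fun p : R * 'rV[R]_d => p.1)); first exact: continuous_fst.
  by apply/funext => p; rewrite (@row_mxEl _ 1 1 d) mxE (ord1 i) (ord1 j) eqxx mulr1n.
have -> : k = rshift 1 j by apply/val_inj.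
rewrite (_ : (fun _ => _) = (fun p : R * 'rV[R]_d => p.2 i j)).
  move=> p; apply: (@continuous_comp _ _ _ snd (fun M : 'rV[R]_d => M i j)).
    exact: continuous_snd.
  exact: coord_continuous.
by apply/funext => p; rewrite (@row_mxEr _ 1 1 d).
Qed.

Lemma int01_continuous (X : topologicalType) (F : X * R -> R) : continuous F ->
  continuous (fun a => \int[mu]_(x in `[0, 1]) F (a, x)).
Proof.
move=> cF a0; apply/cvgrPdist_le => e e0.
pose G (p : X * R) := F (a0, p.2) - F p.
have cFa a : continuous (fun x => F (a, x)).
  move=> x; apply: (@continuous_comp _ _ _ (pair a) F); last exact: cF.
  by apply: (@continuous_pair _ _ _ (fun=> a) id) => y; [exact: cst_continuous | exact: cvg_id].
have cG : continuous G.
  move=> p; apply: cvgB; last exact: cF.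
  apply: (@continuous_comp _ _ _ snd (fun x => F (a0, x))); last exact: cFa.
  exact: continuous_snd.
have := compact_uniform (@segment_compact _ 0 1) cG _ e0 => /(_ a0) h.
apply: filterS (h _) => [a ha|y _]; last by rewrite /G subrr.
have ci a' : mu.-integrable `[0, 1] (EFin \o (fun x => F (a', x))).
  by apply: within_integrable; apply: continuous_subspaceT; exact: cFa.
rewrite -RintegralB //; apply: le_trans (le_normr_Rintegral _ _) _ => //.
  apply: within_integrable; apply: continuous_subspaceT => x.
  by apply: cvgB; exact: cFa.
have -> : e = \int[mu]_(x in `[0, 1]) e by rewrite int_cst // subr0 mulr1.
apply: within_int_le => [||x x01]; last first.
- by apply/ltW/ha; move: x01.
- by apply: continuous_subspaceT; exact: cst_continuous.
apply: continuous_subspaceT => x; apply: (@cvg_norm _ _ _ _ _ (fun x => F (a0, x) - F (a, x))).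
by apply: cvgB; exact: cFa.
Qed.

(** An arbitrary parameter space makes the induction on the dimension possible: the first coordinate
    joins the parameter, [X] becoming [X * R], and is then integrated out by [int01_continuous]. *)
Lemma tint_continuous d (X : topologicalType) (f : X * 'rV[R]_d -> R) : continuous f ->
  continuous (fun a => tint (fun y => f (a, y))).
Proof.
elim: d X f => [|d IH] X f cf /=.
  move=> a; apply: (@continuous_comp _ _ _ (fun a => (a, 0 : 'rV[R]_0)) f); last exact: cf.
  by apply: (@continuous_pair _ _ _ id (fun=> 0 : 'rV[R]_0)) => x; [exact: cvg_id | exact: cst_continuous].
apply: (@int01_continuous X (fun p : X * R =>
  tint (fun y : 'rV[R]_d => f (p.1, row_mx (p.2%:M : 'rV[R]_1) y)))).
apply: (IH _ (fun q : (X * R) * 'rV[R]_d => f (q.1.1, row_mx (q.1.2%:M : 'rV[R]_1) q.2))).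
move=> q; apply: (@continuous_comp _ _ _
  (fun q : (X * R) * 'rV[R]_d => (q.1.1, row_mx (q.1.2%:M : 'rV[R]_1) q.2 : 'rV[R]_d.+1)) f);
  last exact: cf.
apply: (@continuous_pair _ _ _ (fun q : (X * R) * 'rV[R]_d => q.1.1)
  (fun q : (X * R) * 'rV[R]_d => row_mx (q.1.2%:M : 'rV[R]_1) q.2 : 'rV[R]_d.+1)).
  by move=> z; apply: (@continuous_comp _ _ _ fst fst); exact: continuous_fst.
move=> z; apply: (@continuous_comp _ _ _ (fun q : (X * R) * 'rV[R]_d => (q.1.2, q.2))
  (fun p : R * 'rV[R]_d => row_mx (p.1%:M : 'rV[R]_1) p.2 : 'rV[R]_d.+1)); last exact: continuous_row.
apply: (@continuous_pair _ _ _ (fun q : (X * R) * 'rV[R]_d => q.1.2) snd).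
  move=> w; apply: (@continuous_comp _ _ _ fst snd); [exact: continuous_fst|exact: continuous_snd].
exact: continuous_snd.
Qed.

Lemma continuous_section d (f : 'rV[R]_d.+1 -> R) : continuous f ->
  continuous (fun p : R * 'rV[R]_d => f (row_mx (p.1%:M : 'rV[R]_1) p.2)).
Proof.
move=> cf p; apply: (@continuous_comp _ _ _ (fun p : R * 'rV[R]_d =>
  row_mx (p.1%:M : 'rV[R]_1) p.2 : 'rV[R]_d.+1) f); [exact: continuous_row|exact: cf].
Qed.

Lemma continuous_slice (X Y Z : topologicalType) (f : X * Y -> Z) (x : X) :
  continuous f -> continuous (fun y => f (x, y)).
Proof.
move=> cf y; apply: (@continuous_comp _ _ _ (pair x) f); last exact: cf.
by apply: (@continuous_pair _ _ _ (fun=> x) id) => z; [exact: cst_continuous | exact: cvg_id].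
Qed.

Lemma tint_section_cont d (f : 'rV[R]_d.+1 -> R) : continuous f ->
  {within `[0, 1], continuous (fun x : R => tint (fun y : 'rV[R]_d =>
    f (row_mx (x%:M : 'rV[R]_1) y)))}.
Proof.
move=> cf; apply: continuous_subspaceT; exact: (tint_continuous (continuous_section cf)).
Qed.

Lemma tintD d (f g : 'rV[R]_d -> R) : continuous f -> continuous g ->
  tint (fun y => f y + g y) = tint f + tint g.
Proof.
elim: d f g => [|d IH] f g cf cg //=.
rewrite -within_intD; [|exact: tint_section_cont..].
apply: eq_Rintegral => x _.
rewrite IH //; [exact: (continuous_slice (continuous_section cf))|].
exact: (continuous_slice (continuous_section cg)).
Qed.

Lemma tintZ d (c : R) (f : 'rV[R]_d -> R) : continuous f ->
  tint (fun y => c * f y) = c * tint f.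
Proof.
elim: d f => [|d IH] f cf //=.
rewrite -within_intZ; last exact: tint_section_cont.
apply: eq_Rintegral => x _.
by rewrite IH //; exact: (continuous_slice (continuous_section cf)).
Qed.

Lemma tintN d (f : 'rV[R]_d -> R) : continuous f -> tint (fun y => - f y) = - tint f.
Proof.
move=> cf; rewrite -mulN1r -tintZ //; congr tint.
by apply/funext => y; rewrite mulN1r.
Qed.

Lemma tintB d (f g : 'rV[R]_d -> R) : continuous f -> continuous g ->
  tint (fun y => f y - g y) = tint f - tint g.
Proof.
move=> cf cg; rewrite tintD ?tintN //; exact: continuous_opp.
Qed.

Lemma tint_le d (f g : 'rV[R]_d -> R) : continuous f -> continuous g ->
  (forall y, cube y -> f y <= g y) -> tint f <= tint g.
Proof.
elim: d f g => [|d IH] f g cf cg fg /=; first by apply: fg => -[].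
apply: within_int_le; [exact: tint_section_cont..|] => x x01.
apply: IH; [exact: (continuous_slice (continuous_section cf))|
  exact: (continuous_slice (continuous_section cg))|] => y hy.
by apply: fg; exact: cube_row.
Qed.

Lemma tint_cst d (c : R) : tint (fun _ : 'rV[R]_d => c) = c.
Proof. by elim: d => [|d IH] //=; rewrite IH int_cst // subr0 mulr1. Qed.

Lemma eq_tint d (f g : 'rV[R]_d -> R) : (forall x, f x = g x) -> tint f = tint g.
Proof. by move=> fg; congr tint; apply/funext. Qed.

Lemma tint_norm_le d (f : 'rV[R]_d -> R) (C : R) : continuous f ->
  (forall y, cube y -> `|f y| <= C) -> `|tint f| <= C.
Proof.
move=> cf hC; have cC (c : R) : continuous (fun _ : 'rV[R]_d => c) by exact: cst_continuous.
rewrite ler_norml -[X in - X](@tint_cst d) -[X in _ && (_ <= X)](@tint_cst d) -tintN //.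
by rewrite !tint_le // => y /hC; rewrite ler_norml => /andP[].
Qed.

Lemma tint_bigsum d (I : Type) (r : seq I) (F : I -> 'rV[R]_d -> R) :
  (forall j, continuous (F j)) ->
  tint (fun x => \sum_(j <- r) F j x) = \sum_(j <- r) tint (F j).
Proof.
move=> cF; elim: r => [|j r IH].
  by under eq_fun do rewrite big_nil; rewrite tint_cst big_nil.
under eq_fun do rewrite big_cons; rewrite tintD ?big_cons ?IH //.
have : Ck 0 (fun x => \sum_(j <- r) F j x) by apply: Ck_sum => i; split.
by case.
Qed.

(** At each point the mean value theorem replaces the difference quotient by [g] at a time between
    [r] and [s]. That time depends on the point, but [g] is close to [g s] uniformly over the
    cube. *)
Lemma tint_deriv_on d (a b : R) (f g : R -> 'rV[R]_d -> R) :
  CtCk a b 0 f -> CtCk a b 0 g ->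
  (forall s, s \in `[a, b] -> forall x, deriv_on a b (f ^~ x) s (g s x)) ->
  forall s, s \in `[a, b] -> deriv_on a b (fun s => tint (f s)) s (tint (g s)).
Proof.
move=> Hf Hg dfg s sab; apply/deriv_onP => e e0.
have ab : a <= b by move: sab; rewrite in_itv /= => /andP[]; exact: le_trans.
pose G (p : R * 'rV[R]_d) := g (clamp a b p.1) p.2 - g s p.2.
have cgs : continuous (g s) by exact: CtCk_slice_cont Hg sab.
have cG : continuous G.
  apply: continuous_sub; first exact: (CtCk_clamp ab Hg).
  move=> p.
  by apply: (@continuous_comp _ _ _ snd (g s)); [exact: continuous_snd|exact: cgs].
have e2 : 0 < e / 2 by rewrite divr_gt0.
have := compact_uniform (@compact_cube d) cG _ e2 => /(_ s) h.
have /nbhs_ballP[dl /= dl0 hdl] := h (fun y _ => ltac:(by rewrite /G /= clampE // subrr)).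
exists dl => // r rab rs rd.
have cfr u : u \in `[a, b] -> continuous (f u) by move=> uab; exact: (CtCk_slice_cont Hf uab).
have cq : continuous (fun x => (r - s)^-1 * (f r x - f s x)).
  apply: continuous_mul; first exact: continuous_const.
  by apply: continuous_sub; exact: cfr.
have -> : (tint (f r) - tint (f s)) / (r - s) - tint (g s) =
    tint (fun x => (r - s)^-1 * (f r x - f s x) - g s x).
  rewrite tintB // tintZ; last by apply: continuous_sub; exact: cfr.
  by rewrite tintB 1?mulrC //; exact: cfr.
apply: (@le_lt_trans _ _ (e / 2)); last by lra.
apply: tint_norm_le => [|y hy]; first exact: continuous_sub.
have [u uab [us ->]] : exists2 u, u \in `[a, b] & `|u - s| < dl /\
    (r - s)^-1 * (f r y - f s y) = g u y.
  have [rs'|rs'] := ltP r s.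
    have [u ur E] := deriv_on_MVT (fun s sab => dfg s sab y) rab sab rs'.
    move: ur; rewrite in_itv /= => /andP[u1 u2].
    exists u; first by move: rab sab; rewrite !in_itv /= => /andP[? ?] /andP[? ?]; lra.
    split; first by move: rd; rewrite !ltr_norml => /andP[? ?]; lra.
    have -> : f r y - f s y = g u y * (r - s) by apply: oppr_inj; rewrite opprB E; ring.
    by rewrite mulrC mulfK // subr_eq0.
  have {}rs' : s < r by rewrite lt_neqAle eq_sym rs.
  have [u ur E] := deriv_on_MVT (fun s sab => dfg s sab y) sab rab rs'.
  move: ur; rewrite in_itv /= => /andP[u1 u2].
  exists u; first by move: rab sab; rewrite !in_itv /= => /andP[? ?] /andP[? ?]; lra.
  split; first by move: rd; rewrite !ltr_norml => /andP[? ?]; lra.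
  by rewrite E mulrC mulfK // subr_eq0.
have := hdl u; rewrite /ball /= distrC us => /(_ isT y hy).
by rewrite /G /= clampE // => /ltW.
Qed.

Lemma tint_is_derive d (f g : R -> 'rV[R]_d -> R) :
  continuous (fun p : R * 'rV[R]_d => f p.1 p.2) ->
  continuous (fun p : R * 'rV[R]_d => g p.1 p.2) ->
  (forall s x, is_derive s (1 : R) (f ^~ x) (g s x)) ->
  forall s, is_derive s (1 : R) (fun s => tint (f s)) (tint (g s)).
Proof.
move=> cf cg dfg s; apply: (@deriv_on_interior _ (s - 1) (s + 1)).
  by rewrite in_itv /= ltrBlDr !ltrDl ltr01.
apply: tint_deriv_on => [||r _ x|].
- by split => //; exact: continuous_subspaceT.
- by split => //; exact: continuous_subspaceT.
- by apply: is_derive_deriv_on; exact: dfg.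
- by rewrite in_itv /= lerBlDr !lerDl ler01.
Qed.

End TorusIntegral.

(** * Periodic functions *)

Section Periodicity.
Context {R : realType} {d : nat}.
Local Notation E := 'rV[R]_d.

Lemma periodic_nat (Y : Type) (f : E -> Y) (x : E) (i : 'I_d) (n : nat) : periodic f ->
  f (x + n%:R *: basis i) = f x.
Proof.
move=> pf; elim: n => [|n IH]; first by rewrite scale0r addr0.
by rewrite (_ : n.+1%:R = n%:R + 1 :> R) ?scalerDl ?scale1r ?addrA ?pf // -natr1.
Qed.

Lemma periodic_int (Y : Type) (f : E -> Y) (x : E) (i : 'I_d) (n : int) : periodic f ->
  f (x + n%:~R *: basis i) = f x.
Proof.
move=> pf; case: n => n; first exact: periodic_nat.
rewrite NegzE mulrNz scaleNr -(periodic_nat _ i n.+1 pf) addrNK //.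
Qed.

Lemma periodic_lattice (Y : Type) (f : E -> Y) (x : E) (r : seq 'I_d) (n : 'I_d -> int) :
  periodic f -> f (x + \sum_(i <- r) (n i)%:~R *: basis i) = f x.
Proof.
move=> pf; elim: r x => [|i r IH] x; first by rewrite big_nil addr0.
by rewrite big_cons addrA IH periodic_int.
Qed.

(** The representative is chosen before the periodic function, so several fields, for instance one
    curve at two times, can be moved to the cube simultaneously. *)
Lemma cube_repr (x : E) : exists2 y, cube y &
  forall (Y : Type) (f : E -> Y), periodic f -> f x = f y.
Proof.
exists (x + \sum_i (- Num.floor (x 0 i))%:~R *: basis i).
  move=> i /=; rewrite in_itv /= !mxE summxE (bigD1 i) //= big1 ?addr0.
    rewrite !mxE !eqxx mulr1 mulrNz subr_ge0 lerBlDl.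
    apply/andP; split; first exact: floor_le_tmp.
    by apply/ltW; have := lt_succ_floor (x ord0 i); rewrite intrD.
  by move=> j ji; rewrite !mxE eqxx eq_sym (negbTE ji) mulr0.
by move=> Y f pf; rewrite (periodic_lattice x _ (fun i => - Num.floor (x 0 i)) pf).
Qed.

Lemma cube_nonempty : @cube R d !=set0.
Proof. by exists 0 => i /=; rewrite mxE in_itv /= lexx ler01. Qed.

Lemma compact_itv_cube (a b : R) : compact (`[a, b]%classic `*` @cube R d).
Proof. by apply: compact_setX; [exact: segment_compact | exact: compact_cube]. Qed.

Implicit Types (f g : R -> E -> R).

Lemma curve_bounded (a b : R) k f : a <= b -> (forall s, s \in `[a, b] -> periodic (f s)) ->
  CtCk a b k f -> exists2 C : R, 0 < C & forall s x, s \in `[a, b] -> `|f s x| <= C.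
Proof.
move=> ab pf Hf; have cf := CtCk_clamp ab Hf.
pose F (p : R * E) := `|f (clamp a b p.1) p.2|.
have cF : continuous F.
  by move=> p; apply: (@cvg_norm _ R^o _ _ _ (fun p : R * E => f (clamp a b p.1) p.2)); exact: cf.
have ne : `[a, b]%classic `*` @cube R d !=set0.
  have [y hy] := cube_nonempty; exists (a, y); split => //=.
  by rewrite in_itv /= lexx.
have [c _ hc] := compact_EVT_max ne (@compact_itv_cube a b) (continuous_subspaceT cF).
exists (F c + 1); first by rewrite ltr_wpDl // normr_ge0.
move=> s x sab; have [y hy ->] := cube_repr x; last exact: pf.
have := hc (s, y); rewrite inE /F /= clampE // => h.
by apply: le_trans (h _) _ => //; rewrite lerDl.
Qed.

Lemma field_bounded k (w : E -> R) : periodic w -> Ck k w ->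
  exists2 C : R, 0 < C & forall x, `|w x| <= C.
Proof.
move=> pw /(Ck_CtCk 0 0) hw.
have [C C0 h] := curve_bounded (lexx 0) (fun _ _ => pw) hw.
by exists C => // x; apply: (h 0 x); exact: itv00.
Qed.

Lemma field_pos_bound k (w : E -> R) : periodic w -> Ck k w -> (forall x, 0 < w x) ->
  exists2 m : R, 0 < m & forall x, m <= w x.
Proof.
move=> pw /Ck_cont cw w0.
have [c _ hc] := compact_EVT_min cube_nonempty (@compact_cube R d) (continuous_subspaceT cw).
exists (w c) => // x; have [y hy ->] := cube_repr x => //.
by apply: hc; rewrite inE.
Qed.

(** In [compact_uniform] the time increment plays the parameter near 0, while base time and position
    range over a compact set; clamping keeps the incremented time in the interval. *)
Lemma curve_time_uniform (a b : R) k f : a <= b ->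
  (forall s, s \in `[a, b] -> periodic (f s)) -> CtCk a b k f ->
  forall e : R, 0 < e -> exists2 dl : R, 0 < dl & forall r s x, r \in `[a, b] -> s \in `[a, b] ->
    `|r - s| < dl -> `|f r x - f s x| < e.
Proof.
move=> ab pf Hf e e0; have cf := CtCk_clamp ab Hf.
pose G (p : R * (R * E)) := f (clamp a b (p.2.1 + p.1)) p.2.2 - f (clamp a b p.2.1) p.2.2.
have cG : continuous G.
  apply: continuous_sub.
    move=> p; apply: (@continuous_comp _ _ _ (fun p : R * (R * E) => (p.2.1 + p.1, p.2.2))
      (fun p : R * E => f (clamp a b p.1) p.2)); last exact: cf.
    apply: (@continuous_pair _ _ _ (fun p : R * (R * E) => p.2.1 + p.1) (fun p => p.2.2)).
      apply: continuous_add; last exact: continuous_fst.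
      by move=> q; apply: (@continuous_comp _ _ _ snd fst); [exact: continuous_snd|exact: continuous_fst].
    by move=> q; apply: (@continuous_comp _ _ _ snd snd); exact: continuous_snd.
  move=> p; apply: (@continuous_comp _ _ _ snd (fun p : R * E => f (clamp a b p.1) p.2)).
    exact: continuous_snd.
  exact: cf.
have := compact_uniform (@compact_itv_cube a b) cG _ e0 => /(_ 0) h.
have /nbhs_ballP[dl /= dl0 hdl] := h (fun y _ => ltac:(by rewrite /G /= addr0 subrr)).
exists dl => // r s x rab sab rs.
have [y hy xy] := cube_repr x.
have := hdl (r - s); rewrite /ball /= sub0r normrN => /(_ rs (s, y)) /=.
rewrite /G /= (_ : s + (r - s) = r); last by ring.
rewrite !clampE // (xy _ _ (pf _ rab)) (xy _ _ (pf _ sab)).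
by apply; split.
Qed.

(** Reversal of time, which turns a terminal value problem into an initial value problem for the
    backward maximum principle. *)
Lemma CtCk_rev (a b : R) k f : a <= b -> CtCk a b k f -> CtCk a b k (fun s => f (a + b - s)).
Proof.
move=> ab; have rin s : s \in `[a, b] -> a + b - s \in `[a, b].
  by rewrite !in_itv /= => /andP[? ?]; apply/andP; split; lra.
have cS f' : {within `[a, b] `*` [set: E], continuous (fun p : R * E => f' p.1 p.2)} ->
    {within `[a, b] `*` [set: E], continuous (fun p : R * E => f' (a + b - p.1) p.2)}.
  move=> h; apply/(within_clamp _ ab).
  have := (within_clamp (fun p : R * E => f' p.1 p.2) ab).1 h => /= cf p.
  rewrite (_ : (fun p : R * E => _) = (fun p : R * E => f' (clamp a b p.1) p.2) \o
     (fun p : R * E => (a + b - clamp a b p.1, p.2))).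
    apply: continuous_comp; last exact: cf.
    apply: (@continuous_pair _ _ _ (fun p : R * E => a + b - clamp a b p.1) snd).
      apply: continuous_sub; first exact: continuous_const.
      move=> q; apply: (@continuous_comp _ _ _ fst (clamp a b)); first exact: continuous_fst.
      exact: continuous_clamp.
    exact: continuous_snd.
  by apply/funext => q /=; rewrite (clampE (rin _ (clamp_in _ ab))).
elim: k f => [|k IH] f [cf hf].
  by split => //; exact: cS.
split; first exact: cS.
by move=> i; have [h1 h2] := hf i; split; [move=> s /rin; exact: h1 | exact: IH h2].
Qed.

Lemma deriv_on_rev (a b : R) (h : R -> R) (s l : R) : deriv_on a b h (a + b - s) l ->
  deriv_on a b (fun r => h (a + b - r)) s (- l).
Proof.
move=> /deriv_onP H; apply/deriv_onP => e /H[dl dl0 hdl]; exists dl => // r rab rs rd.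
have := hdl (a + b - r); rewrite (_ : a + b - r - (a + b - s) = - (r - s)); last by ring.
rewrite normrN invrN mulrN => H2; rewrite -normrN opprB addrC.
apply: H2 => //; first by move: rab; rewrite !in_itv /= => /andP[? ?]; apply/andP; split; lra.
by rewrite (inj_eq (addrI _)) (inj_eq (@oppr_inj _)).
Qed.

End Periodicity.

(** * Integration by parts on the torus *)

Section Divergence.
Context {R : realType}.

Lemma basis_lshift d : basis (lshift d (0 : 'I_1)) = row_mx (1%:M : 'rV[R]_1) (0 : 'rV[R]_d).
Proof.
apply/rowP => k; rewrite !mxE /=; case: splitP => j kj; rewrite !mxE.
  have -> : k = lshift d j by exact/val_inj.
  by rewrite (ord1 j) !eqxx.
by rewrite (_ : k = rshift 1 j) ?eq_rlshift //; exact/val_inj.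
Qed.

Lemma basis_rshift d (j : 'I_d) : basis (rshift 1 j) = row_mx (0 : 'rV[R]_1) (basis j).
Proof.
apply/rowP => k; rewrite !mxE /=; case: splitP => l kl; rewrite !mxE.
  by rewrite (_ : k = lshift d l) ?eq_lrshift //; exact/val_inj.
by rewrite (_ : k = rshift 1 l) ?eq_rshift //; exact/val_inj.
Qed.

Lemma row_line_l d (x r : R) (y : 'rV[R]_d) :
  row_mx ((x + r)%:M : 'rV[R]_1) y = row_mx (x%:M : 'rV[R]_1) y + r *: basis (lshift d (0 : 'I_1)).
Proof.
rewrite basis_lshift scale_row_mx add_row_mx scaler0 addr0.
by rewrite scale_scalar_mx mulr1 raddfD.
Qed.

Lemma row_line_r d (x r : R) (y : 'rV[R]_d) (j : 'I_d) :
  row_mx (x%:M : 'rV[R]_1) (y + r *: basis j) = row_mx (x%:M : 'rV[R]_1) y + r *: basis (rshift 1 j).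
Proof. by rewrite basis_rshift scale_row_mx add_row_mx scaler0 addr0. Qed.

Lemma partial_section d (f : 'rV[R]_d.+1 -> R) (x : R) (j : 'I_d) (y : 'rV[R]_d) :
  (forall z, derivable f z (basis (rshift 1 j : 'I_d.+1))) ->
  derivable (fun y : 'rV[R]_d => f (row_mx (x%:M : 'rV[R]_1) y)) y (basis j) /\
  partial j (fun y : 'rV[R]_d => f (row_mx (x%:M : 'rV[R]_1) y)) y =
  partial (rshift 1 j : 'I_d.+1) f (row_mx (x%:M : 'rV[R]_1) y).
Proof.
move=> df; apply: is_derive_partial.
rewrite (_ : (fun r : R => _) = (fun r : R => f ((row_mx (x%:M : 'rV[R]_1) y : 'rV[R]_d.+1) +
   r *: basis (rshift 1 j : 'I_d.+1)))); last by apply/funext => r; rewrite row_line_r.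
rewrite -[X in partial _ f X]addr0 -[X in _ + X](scale0r (basis (rshift 1 j : 'I_d.+1))).
exact: is_derive_line.
Qed.

(** For the first coordinate, integrate the others out and apply the fundamental theorem of
    calculus: periodicity identifies the two end values. Any other coordinate survives in each
    slice, where the induction hypothesis applies. *)
Lemma tint_partial d (i : 'I_d) (f : 'rV[R]_d -> R) : periodic f -> Ck 1 f ->
  tint (partial i f) = 0.
Proof.
elim: d i f => [|d IH] i f pf Hf; first by case: i.
have cf : continuous f := Ck_cont Hf.
have cp k : continuous (partial k f) by exact: Ck_cont (Ck_partial k Hf).
case: (@splitP 1 d i) => j ij.
  have {ij} -> : i = lshift d (0 : 'I_1) :> 'I_d.+1 by move: ij; rewrite (ord1 j) => ij; apply/val_inj; exact: ij.
  set k : 'I_d.+1 := lshift d (0 : 'I_1).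
  pose m (x : R) := tint (fun y : 'rV[R]_d => f (row_mx (x%:M : 'rV[R]_1) y)).
  have dm x : is_derive x (1 : R) m (tint (fun y : 'rV[R]_d => partial k f (row_mx (x%:M : 'rV[R]_1) y))).
    apply: (tint_is_derive (f := fun x (y : 'rV[R]_d) => f (row_mx (x%:M : 'rV[R]_1) y))
       (g := fun x (y : 'rV[R]_d) => partial k f (row_mx (x%:M : 'rV[R]_1) y))).
    - exact: continuous_section.
    - exact: continuous_section.
    move=> s y; rewrite (_ : (fun r : R => _) = (fun r : R =>
        f ((row_mx (0%:M : 'rV[R]_1) y : 'rV[R]_d.+1) + r *: basis k))); last first.
      by apply/funext => r; rewrite -row_line_l add0r.
    have -> : row_mx (s%:M : 'rV[R]_1) y = (row_mx (0%:M : 'rV[R]_1) y : 'rV[R]_d.+1) + s *: basis k.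
      by rewrite -row_line_l add0r.
    apply: is_derive_line; exact: Ck_derivable Hf.
  rewrite /= (@deriv_on_FTC _ 0 1 m) //; last 2 first.
  - by move=> s _; apply: is_derive_deriv_on.
  - exact: tint_section_cont.
  rewrite /m (_ : (fun y : 'rV[R]_d => f (row_mx 1%:M y)) = (fun y => f (row_mx 0%:M y))) ?subrr //.
  apply/funext => y; rewrite -[1 in LHS]add0r row_line_l scale1r.
  exact: pf.
have {ij} -> : i = rshift 1 j :> 'I_d.+1 by exact/val_inj.
rewrite /= (@eq_Rintegral _ _ _ _ _ (fun=> 0)) ?int_cst ?mul0r // => x _.
have ps (l : 'I_d) y := @partial_section d f x l y
  (fun z => @Ck_derivable _ _ _ _ (rshift 1 l : 'I_d.+1) z Hf).
rewrite -(IH j (fun y : 'rV[R]_d => f (row_mx (x%:M : 'rV[R]_1) y))).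
- by apply: eq_tint => y; rewrite (ps j y).2.
- move=> y l; rewrite -[basis l]scale1r row_line_r scale1r; exact: pf.
split; first exact: (continuous_slice (continuous_section cf)).
move=> l; split; first by move=> y; exact: (ps l y).1.
split => //; rewrite (_ : partial l _ = fun y => partial (rshift 1 l : 'I_d.+1) f (row_mx (x%:M : 'rV[R]_1) y)).
  exact: (continuous_slice (continuous_section (cp _))).
by apply/funext => y; rewrite (ps l y).2.
Qed.

Lemma comp_periodic d (v : 'rV[R]_d -> 'rV[R]_d) i : periodic v -> periodic (comp i v).
Proof. by move=> pv x j; rewrite /comp pv. Qed.

End Divergence.

(** * Maximum principles in time and space *)

Section MaximumPrinciple.
Context {R : realType}.

Lemma lt_dl2 (x : R) : 0 < x -> x / 2 < x.
Proof. by move=> x0; lra. Qed.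

(** Second derivative test without a Taylor expansion: if [l] were negative, [h' u / u] would be
    negative for all small positive [u], whereas the mean value theorem at the minimum produces such
    a [u] with [h' u] nonnegative. *)
Lemma line_min (h h' : R -> R) (l : R) : (forall r, h 0 <= h r) ->
  (forall r : R, is_derive r (1 : R) h (h' r)) -> is_derive (0 : R) (1 : R) h' l ->
  h' 0 = 0 /\ 0 <= l.
Proof.
move=> hmin dh dh'.
have h0 : h' 0 = 0.
  apply/eqP; rewrite -normr_le0 leNgt; apply/negP => n0.
  have [dl dl0 hdl] := (is_deriveP _ _ _).1 (dh 0) _ n0.
  have dl2 : 0 < dl / 2 by rewrite divr_gt0.
  have dl3 : dl / 2 < dl by lra.
  have q r : 0 <= r -> 0 <= (h r - h 0) / r.
    by move=> r0; rewrite divr_ge0 // subr_ge0.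
  have q' r : r <= 0 -> (h r - h 0) / r <= 0.
    by move=> r0; rewrite mulr_ge0_le0 ?subr_ge0 ?invr_le0.
  have [p|p] := ltP 0 (h' 0).
    have := hdl (- (dl / 2)); rewrite subr0 normrN gtr0_norm // oppr_eq0 gt_eqF //.
    move=> /(_ isT dl3); rewrite (gtr0_norm p) ltr_norml => /andP[+ _].
    by have := q' (- (dl / 2)); rewrite oppr_le0 ltW // => /(_ isT); lra.
  have := hdl (dl / 2); rewrite subr0 gtr0_norm // gt_eqF //.
  move=> /(_ isT dl3); rewrite (ler0_norm p) ltr_norml => /andP[_].
  by have := q (dl / 2); rewrite ltW // => /(_ isT); lra.
split => //; rewrite leNgt; apply/negP => l0.
have nl : 0 < - l by rewrite oppr_gt0.
have [dl dl0 hdl] := (is_deriveP _ _ _).1 dh' _ nl.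
have dl2 : 0 < dl / 2 by rewrite divr_gt0.
have ch : continuous h := is_derive_continuous dh.
have [u] := MVT dl2 (fun x _ => dh x) (continuous_subspaceT ch).
rewrite in_itv /= subr0 => /andP[u0 u1] E.
have := hmin (dl / 2); rewrite -subr_ge0 E pmulr_lge0 // => hu.
have := hdl u; rewrite gt_eqF // subr0 gtr0_norm // => /(_ isT).
rewrite h0 subr0 => H; have {}H := H (lt_trans u1 (lt_dl2 dl0)).
have : 0 <= h' u / u by rewrite divr_ge0 // ltW.
by move: H; rewrite ltr_norml => /andP[_]; lra.
Qed.

Lemma is_derive_affine (c s0 s : R) : is_derive s (1 : R) (fun r => c * (r - s0)) c.
Proof.
apply/is_deriveP => e e0; exists 1 => // r rs _.
rewrite (_ : c * (r - s0) - c * (s - s0) = c * (r - s)); last by ring.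
by rewrite mulfK ?subr_eq0 // subrr normr0.
Qed.

(** Quotients taken from the left of a minimum are nonpositive, and [a < s] leaves room on that
    side; the final time [s = b] is thus covered. *)
Lemma deriv_on_min (a b : R) (k : R -> R) (s l : R) : a < s -> s \in `[a, b] ->
  deriv_on a b k s l -> (forall r, r \in `[a, b] -> k s <= k r) -> l <= 0.
Proof.
move=> as_ sab /deriv_onP h kmin; apply/ler_addgt0Pl => e e0; rewrite addr0.
have [dl dl0 hdl] := h e e0.
pose r := Num.max a (s - dl / 2).
have dl2 : 0 < dl / 2 by rewrite divr_gt0.
have rs : r < s by rewrite gt_max as_ ltrBlDr ltrDl.
have ra : a <= r by rewrite le_max lexx.
have rd : s - dl / 2 <= r by rewrite le_max lexx orbT.
have rab : r \in `[a, b].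
  by move: sab; rewrite !in_itv /= => /andP[_ sb]; rewrite ra /= ltW // (lt_le_trans rs).
have := hdl r rab; rewrite lt_eqF // ltr0_norm ?subr_lt0 // => /(_ isT) H.
have {H} := H (ltac:(lra)); rewrite ltr_norml => /andP[H _].
have : (k r - k s) / (r - s) <= 0.
  by rewrite mulr_ge0_le0 ?subr_ge0 ?kmin // invr_le0 subr_le0 ltW.
by lra.
Qed.

Variable d : nat.
Local Notation E := 'rV[R]_d.

Lemma lap_min (w : E -> R) (x : E) : Ck 2 w -> (forall y, w x <= w y) ->
  (forall i, partial i w x = 0) /\ 0 <= lap w x.
Proof.
move=> Hw wmin.
have H i : partial i w x = 0 /\ 0 <= partial i (partial i w) x.
  have x0 : x + 0 *: basis i = x by rewrite scale0r addr0.
  have := @line_min (fun r => w (x + r *: basis i)) (fun r => partial i w (x + r *: basis i))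
     (partial i (partial i w) (x + 0 *: basis i)); rewrite x0; apply.
  - by move=> r; exact: wmin.
  - by move=> r; apply: is_derive_line; exact: Ck_derivable Hw.
  - rewrite -[X in partial i (partial i w) X]x0; apply: is_derive_line.
    exact: Ck_derivable (Ck_partial i Hw).
split=> [i|]; first exact: (H i).1.
by rewrite /lap sumr_ge0 // => i _; exact: (H i).2.
Qed.

(** No equation is fixed: the differential inequality is asked only at negative values with
    vanishing gradient and nonnegative Laplacian. This form serves linear Fokker-Planck equations
    and differences of Hamilton-Jacobi solutions alike. *)
Lemma max_principle (a b C : R) (f g : R -> E -> R) : a <= b ->
  (forall s, s \in `[a, b] -> periodic (f s)) -> CtCk a b 2 f ->
  (forall s, s \in `[a, b] -> forall x, deriv_on a b (f ^~ x) s (g s x)) ->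
  (forall x, 0 <= f a x) ->
  (forall s, s \in `[a, b] -> forall x, (forall i, partial i (f s) x = 0) ->
     0 <= lap (f s) x -> f s x < 0 -> C * f s x <= g s x) ->
  forall s, s \in `[a, b] -> forall x, 0 <= f s x.
Proof.
(* At a negative minimum of [expR (- lam * s) * f] minimality in time gives [g <= lam * f]. Any rate
   above [C] makes the right side smaller than [C * f], contradicting the hypothesis. *)
move=> ab pf Hf dfg fa hC; pose lam : R := C + 1.
pose w (p : R * E) := expR (- lam * clamp a b p.1) * f (clamp a b p.1) p.2.
have cf := CtCk_clamp ab Hf.
have cw : continuous w.
  apply: continuous_mul => // p.
  apply: (@continuous_comp _ _ _ (fun p : R * E => - lam * clamp a b p.1) expR); last first.
    exact: continuous_expR.
  apply: continuous_mul; first exact: continuous_const.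
  move=> q; apply: (@continuous_comp _ _ _ fst (clamp a b)); first exact: continuous_fst.
  exact: continuous_clamp.
have ne : `[a, b]%classic `*` @cube R d !=set0.
  have [y hy] := @cube_nonempty R d; exists (a, y); split => //=.
  by rewrite in_itv /= lexx.
have [[s0 x0]] := compact_EVT_min ne (@compact_itv_cube _ d a b) (continuous_subspaceT cw).
rewrite inE => -[/= sab hx0] wmin.
have {}wmin s x : s \in `[a, b] -> expR (- lam * s0) * f s0 x0 <= expR (- lam * s) * f s x.
  move=> sab'; have [y hy ->] := cube_repr x; last exact: pf.
  by have := wmin (s, y); rewrite inE /w /= !clampE //; apply; split.
have [f0|f0] := leP 0 (f s0 x0).
  move=> s sab' x; rewrite -(pmulr_rge0 _ (expR_gt0 (- lam * s))).
  by apply: le_trans (wmin s x sab'); rewrite mulr_ge0 // expR_ge0.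
exfalso.
have as0 : a < s0.
  rewrite lt_neqAle; move: (sab); rewrite in_itv /= => /andP[-> _]; rewrite andbT.
  by apply/eqP => E1; move: f0; rewrite -E1 ltNge fa.
have spmin x : f s0 x0 <= f s0 x.
  by have := wmin s0 x sab; rewrite ler_pM2l // expR_gt0.
have [g0 l0] := lap_min (CtCk_slice Hf sab) spmin.
have h1 := hC s0 sab x0 g0 l0 f0.
(* Minimality of the weighted function says that [f] at [x0] stays above this exponential profile,
   touching it at [s0]. *)
pose k r := f r x0 - f s0 x0 * expR (lam * (r - s0)).
have dk : deriv_on a b k s0 (g s0 x0 - f s0 x0 * lam).
  apply: deriv_onB; first exact: dfg.
  apply: (@deriv_onZ _ a b (f s0 x0) (fun r => expR (lam * (r - s0)))).
  apply: is_derive_deriv_on.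
  have := @is_derive1_comp R expR (fun r => lam * (r - s0)) s0 (expR (lam * (s0 - s0))) lam.
  move=> /(_ (is_derive_expR _) (is_derive_affine _ _ _)).
  by rewrite subrr mulr0 expR0 mul1r.
have : g s0 x0 - f s0 x0 * lam <= 0.
  apply: (deriv_on_min as0 sab dk) => r rab.
  rewrite /k subrr mulr0 expR0 mulr1 subrr subr_ge0.
  have : expR (lam * r) * (expR (- lam * s0) * f s0 x0) <=
      expR (lam * r) * (expR (- lam * r) * f r x0) by rewrite ler_pM2l ?expR_gt0 // wmin.
  rewrite !mulrA -!expRD.
  rewrite !mulNr subrr expR0 mul1r => h; apply: le_trans h.
  by rewrite mulrC (_ : lam * (r - s0) = lam * r - lam * s0) ?mulNr //; ring.
have : f s0 x0 * lam < C * f s0 x0 by rewrite /lam mulrDr mulr1 mulrC; lra.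
lra.
Qed.

Lemma max_principle_backward (a b C : R) (f g : R -> E -> R) : a <= b ->
  (forall s, s \in `[a, b] -> periodic (f s)) -> CtCk a b 2 f ->
  (forall s, s \in `[a, b] -> forall x, deriv_on a b (f ^~ x) s (g s x)) ->
  (forall x, 0 <= f b x) ->
  (forall s, s \in `[a, b] -> forall x, (forall i, partial i (f s) x = 0) ->
     0 <= lap (f s) x -> f s x < 0 -> C * f s x <= - g s x) ->
  forall s, s \in `[a, b] -> forall x, 0 <= f s x.
Proof.
move=> ab pf Hf dfg fb hC.
have rin s : s \in `[a, b] -> a + b - s \in `[a, b].
  by rewrite !in_itv /= => /andP[? ?]; apply/andP; split; lra.
move=> s sab x; rewrite (_ : s = a + b - (a + b - s)); last by ring.
apply: (@max_principle a b C (fun s => f (a + b - s)) (fun s x => - g (a + b - s) x)).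
- exact: ab.
- by move=> r /rin; exact: pf.
- exact: CtCk_rev.
- by move=> r /rin rab y; apply: (@deriv_on_rev _ a b (f ^~ y)); exact: dfg.
- by move=> y; rewrite (_ : a + b - a = b) //; ring.
- by move=> r /rin rab y; exact: hC.
- exact: rin.
Qed.

End MaximumPrinciple.

(** * Moving averages *)

Section MovingAverage.
Context {R : realType} {d : nat}.
Local Notation E := 'rV[R]_d.
Implicit Types (f g : E -> R).

(** A quantitative [Ck], with one constant for the function and its derivatives up to order [k]. The
    bound holds on the whole space, so shifts and averages preserve it with the same constant, which
    is essential for iterating the scheme. *)
Fixpoint Bk (C : R) (k : nat) f : Prop :=
  (continuous f /\ forall x, `|f x| <= C) /\
  if k is k'.+1 then
    forall i, (forall x, derivable f x (basis i)) /\ Bk C k' (partial i f)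
  else True.

Arguments Bk : simpl never.

Lemma Bk_cont C k f : Bk C k f -> continuous f.
Proof. by case: k => [|k] [[]]. Qed.

Lemma Bk_le C k f : Bk C k f -> forall x, `|f x| <= C.
Proof. by case: k => [|k] [[]]. Qed.

Lemma Bk_derivable C k f i x : Bk C k.+1 f -> derivable f x (basis i).
Proof. by case=> _ h; exact: (h i).1. Qed.

Lemma Bk_partial C k f i : Bk C k.+1 f -> Bk C k (partial i f).
Proof. by case=> _ h; exact: (h i).2. Qed.

Lemma Bk_Ck C k f : Bk C k f -> Ck k f.
Proof.
elim: k f => [|k IH] f [[cf _] hf]; first by split.
by split=> // i; split; [exact: (hf i).1 | exact: IH (hf i).2].
Qed.

Lemma Bk_weak C C' k f : C <= C' -> Bk C k f -> Bk C' k f.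
Proof.
move=> CC; elim: k f => [|k IH] f [[cf bf] hf].
  by split => //; split => // x; exact: le_trans (bf x) CC.
split; first by split => // x; exact: le_trans (bf x) CC.
by move=> i; split; [exact: (hf i).1 | exact: IH (hf i).2].
Qed.

Lemma Bk_shift C k f (c : E) : Bk C k f -> Bk C k (fun x => f (x + c)).
Proof.
elim: k f => [|k IH] f Hf.
  by split => //; split; [exact: Ck_cont (Ck_shift c (Bk_Ck Hf)) | move=> x; exact: Bk_le Hf _].
split.
  by split; [exact: Ck_cont (Ck_shift c (Bk_Ck Hf)) | move=> x; exact: Bk_le Hf _].
move=> i; split; first by move=> x; apply: derivable_shift; exact: Bk_derivable Hf.
rewrite (_ : partial i _ = fun x => partial i f (x + c)); first exact: IH (Bk_partial i Hf).
by apply/funext => x; rewrite partial_shift.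
Qed.

Lemma BkD C C' k f g : Bk C k f -> Bk C' k g -> Bk (C + C') k (fun x => f x + g x).
Proof.
elim: k f g => [|k IH] f g Hf Hg.
  split=> //; split; first by apply: continuous_add; [exact: Bk_cont Hf | exact: Bk_cont Hg].
  by move=> x; rewrite (le_trans (ler_normD _ _)) // lerD ?(Bk_le Hf) ?(Bk_le Hg).
split.
  split; first by apply: continuous_add; [exact: Bk_cont Hf | exact: Bk_cont Hg].
  by move=> x; rewrite (le_trans (ler_normD _ _)) // lerD ?(Bk_le Hf) ?(Bk_le Hg).
move=> i; split.
  by move=> x; apply: derivable_add; [exact: Bk_derivable Hf | exact: Bk_derivable Hg].
rewrite (_ : partial i _ = fun x => partial i f x + partial i g x).
  exact: IH (Bk_partial i Hf) (Bk_partial i Hg).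
by apply/funext => x; rewrite partial_add //; [exact: Bk_derivable Hf | exact: Bk_derivable Hg].
Qed.

Lemma BkZ C (c : R) k f : Bk C k f -> Bk (`|c| * C) k (fun x => c * f x).
Proof.
have B g : continuous g /\ (forall x, `|g x| <= C) ->
    continuous (fun x => c * g x) /\ (forall x, `|c * g x| <= `|c| * C).
  move=> [cg bg]; split; first by apply: continuous_mul => //; exact: continuous_const.
  by move=> x; rewrite normrM ler_wpM2l.
elim: k f => [|k IH] f [bf hf]; first by split => //; exact: B.
split; first exact: B.
move=> i; have [h1 h2] := hf i; split; first by move=> x; exact: derivable_scale.
rewrite (_ : partial i _ = fun x => c * partial i f x); first exact: IH.
by apply/funext => x; rewrite partial_scale.
Qed.

(* The integral over [0, 1] is written as [tint] in dimension one, so that its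
   differentiation lemmas apply. *)
Definition avg (h : R) (i : 'I_d) f : E -> R :=
  fun x => tint (fun r : 'rV[R]_1 => f (x + (h * r 0 0) *: basis i)).

Lemma continuous_translate h (i : 'I_d) :
  continuous (fun p : E * 'rV[R]_1 => p.1 + (h * p.2 0 0) *: (basis i : E)).
Proof.
apply: continuous_mx => k l.
rewrite (_ : (fun p => _) = fun p : E * 'rV[R]_1 =>
   p.1 k l + (h * p.2 0 0) * (basis i : E) k l); last by apply/funext => p; rewrite !mxE.
apply: continuous_add.
  move=> p; apply: (@continuous_comp _ _ _ fst (fun M : E => M k l)).
    exact: continuous_fst.
  exact: coord_continuous.
apply: continuous_mul; last exact: continuous_const.
apply: continuous_mul; first exact: continuous_const.
move=> p; apply: (@continuous_comp _ _ _ snd (fun M : 'rV[R]_1 => M 0 0)).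
  exact: continuous_snd.
exact: coord_continuous.
Qed.

Lemma continuous_line f h (i : 'I_d) : continuous f ->
  continuous (fun p : E * 'rV[R]_1 => f (p.1 + (h * p.2 0 0) *: (basis i : E))).
Proof.
move=> cf p; apply: (@continuous_comp _ _ _
  (fun p : E * 'rV[R]_1 => p.1 + (h * p.2 0 0) *: (basis i : E)) f); last exact: cf.
exact: continuous_translate.
Qed.

Lemma avg_cont h i f : continuous f -> continuous (avg h i f).
Proof. by move=> cf; exact: (tint_continuous (@continuous_line f h i cf)). Qed.

Lemma avg_periodic h i f : periodic f -> periodic (avg h i f).
Proof. by move=> pf x j; apply: eq_tint => r; rewrite addrAC pf. Qed.

(** Used with [c] equal to zero for sup bounds, to [f x] for the mollification error, and to the
    exact flux for the consistency of the scheme. *)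
Lemma avg_dist h i f x (c e : R) : continuous f ->
  (forall r : R, 0 <= r <= 1 -> `|f (x + (h * r) *: basis i) - c| <= e) ->
  `|avg h i f x - c| <= e.
Proof.
move=> cf hc.
have cs : continuous (fun r : 'rV[R]_1 => f (x + (h * r 0 0) *: (basis i : E))).
  exact: (@continuous_slice _ _ _ (fun p : E * 'rV[R]_1 => f (p.1 + (h * p.2 0 0) *: (basis i : E))) x
    (@continuous_line f h i cf)).
rewrite -[X in _ - X](@tint_cst R 1) /avg -tintB //; last exact: continuous_const.
apply: tint_norm_le; first by apply: continuous_sub => //; exact: continuous_const.
by move=> r /(_ ord0) /=; rewrite in_itv /=; exact: hc.
Qed.

Lemma avg_le h i f (C : R) : continuous f -> (forall x, `|f x| <= C) ->
  forall x, `|avg h i f x| <= C.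
Proof.
move=> cf bf x; rewrite -[X in `|X|]subr0; apply: avg_dist => // r _.
by rewrite subr0.
Qed.

Lemma avg_partial h i l f x : continuous f -> (forall y, derivable f y (basis l)) ->
  continuous (partial l f) ->
  derivable (avg h i f) x (basis l) /\ partial l (avg h i f) x = avg h i (partial l f) x.
Proof.
move=> cf df cp; apply: is_derive_partial.
have cc (w : E -> R) : continuous w -> continuous (fun q : R * 'rV[R]_1 =>
    w (x + q.1 *: basis l + (h * q.2 0 0) *: (basis i : E))).
  move=> cw q; apply: (@continuous_comp _ _ _
    (fun q : R * 'rV[R]_1 => (x + q.1 *: basis l, q.2))
    (fun p : E * 'rV[R]_1 => w (p.1 + (h * p.2 0 0) *: (basis i : E)))); last exact: continuous_line.
  apply: (@continuous_pair _ _ _ (fun q : R * 'rV[R]_1 => x + q.1 *: basis l) snd).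
    apply: continuous_mx => k m.
    rewrite (_ : (fun q => _) = fun q : R * 'rV[R]_1 => x k m + q.1 * (basis l : E) k m).
      apply: continuous_add; first exact: continuous_const.
      by apply: continuous_mul; [exact: continuous_fst | exact: continuous_const].
    by apply/funext => z; rewrite !mxE.
  exact: continuous_snd.
have := @tint_is_derive R 1 (fun r (z : 'rV[R]_1) => f (x + r *: basis l + (h * z 0 0) *: (basis i : E)))
  (fun r (z : 'rV[R]_1) => partial l f (x + r *: basis l + (h * z 0 0) *: (basis i : E)))
  (cc _ cf) (cc _ cp) _ 0.
rewrite /avg scale0r addr0; apply => s z.
rewrite (_ : (fun r : R => _) = (fun r : R => f ((x + (h * z 0 0) *: basis i) + r *: basis l))).
  rewrite addrAC; exact: is_derive_line.
by apply/funext => r; rewrite addrAC.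
Qed.

(** After differentiation under the integral, the integrand in [r] is the derivative of
    [f (x + (h * r) *: basis i) / h], so the fundamental theorem of calculus leaves only the two end
    points. *)
Lemma avg_partial_same h i f x : h != 0 -> continuous f -> (forall y, derivable f y (basis i)) ->
  continuous (partial i f) ->
  partial i (avg h i f) x = (f (x + h *: basis i) - f x) / h.
Proof.
move=> h0 cf df cp; rewrite (avg_partial h i x cf df cp).2 /avg /=.
pose m (r : R) := f (x + (h * r) *: basis i) / h.
have cm : continuous (fun r : R => partial i f (x + (h * r) *: basis i)).
  move=> r; apply: (@continuous_comp _ _ _ (fun r : R => x + (h * r) *: (basis i : E)) (partial i f)).
    apply: continuous_mx => k l.
    rewrite (_ : (fun r => _) = fun r : R => x k l + h * r * (basis i : E) k l).
      apply: continuous_add; first exact: continuous_const.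
      apply: continuous_mul; last exact: continuous_const.
      by apply: continuous_mul; [exact: continuous_const | move=> u; exact: cvg_id].
    by apply/funext => z; rewrite !mxE.
  exact: cp.
transitivity (\int[@lebesgue_measure R]_(r in `[0, 1]) partial i f (x + (h * r) *: basis i)).
  have row00 (r : R) : (row_mx (r%:M : 'rV[R]_1) (0 : 'rV[R]_0) : 'rV[R]_1) 0 0 = r.
    have <- : lshift 0 (0 : 'I_1) = 0 :> 'I_1 by exact/val_inj.
    by rewrite (@row_mxEl _ 1 1 0) mxE !ord1 eqxx.
  by apply: eq_Rintegral => r _; rewrite row00.
rewrite (@deriv_on_FTC _ 0 1 m) //.
- by rewrite /m mulr1 mulr0 scale0r addr0 mulrBl.
- move=> r _; apply: is_derive_deriv_on.
  have dg := @is_derive1_comp R (fun r : R => f (x + r *: basis i)) (fun r => h * (r - 0)) r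
    (partial i f (x + (h * (r - 0)) *: basis i)) h.
  have {}dg := dg (is_derive_line (df _)) (is_derive_affine _ _ _).
  rewrite subr0 in dg.
  apply/is_deriveP => e e0.
  have eh : 0 < e * `|h| by rewrite mulr_gt0 // normr_gt0.
  have [dl dl0 hdl] := (is_deriveP _ _ _).1 dg _ eh.
  exists dl => // u ur ud; have := hdl u ur ud.
  rewrite /= !subr0 -ltr_pdivrMr ?normr_gt0 // -normf_div; apply: le_lt_trans.
  rewrite le_eqVlt; apply/orP; left; apply/eqP; congr (`|_|).
  by rewrite /m; field; rewrite h0 subr_eq0.
- exact: continuous_subspaceT.
Qed.

Lemma avg_Bk C h i k f : Bk C k f -> Bk C k (avg h i f).
Proof.
elim: k f => [|k IH] f Hf.
  by split => //; split; [exact: avg_cont (Bk_cont Hf) | exact: avg_le (Bk_cont Hf) (Bk_le Hf)].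
split.
  by split; [exact: avg_cont (Bk_cont Hf) | exact: avg_le (Bk_cont Hf) (Bk_le Hf)].
have ap l x := @avg_partial h i l f x (Bk_cont Hf) (fun y => @Bk_derivable C k f l y Hf)
  (Bk_cont (Bk_partial l Hf)).
move=> l; split; first by move=> x; exact: (ap l x).1.
rewrite (_ : partial l _ = avg h i (partial l f)); first exact: IH (Bk_partial l Hf).
by apply/funext => x; rewrite (ap l x).2.
Qed.

Lemma avg_Ck h i k f : Ck k f -> Ck k (avg h i f).
Proof.
elim: k f => [|k IH] f Hf; first by split => //; exact: avg_cont (Ck_cont Hf).
split; first exact: avg_cont (Ck_cont Hf).
have ap l x := @avg_partial h i l f x (Ck_cont Hf) (fun y => @Ck_derivable _ _ k f l y Hf)
  (Ck_cont (Ck_partial l Hf)).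
move=> l; split; first by move=> x; exact: (ap l x).1.
rewrite (_ : partial l _ = avg h i (partial l f)); first exact: IH (Ck_partial l Hf).
by apply/funext => x; rewrite (ap l x).2.
Qed.

Definition smooth (h : R) (l : seq 'I_d) f : E -> R := foldr (avg h) f l.

Lemma smooth_Bk C h l k f : Bk C k f -> Bk C k (smooth h l f).
Proof. by move=> Hf; elim: l => //= i l IH; exact: avg_Bk. Qed.

Lemma smooth_periodic h l f : periodic f -> periodic (smooth h l f).
Proof. by move=> pf; elim: l => //= i l IH; exact: avg_periodic. Qed.

(** If the outermost average is along [j], the derivative is a difference of two values bounded by
    [C], divided by [h]; otherwise it passes through that average, and the bound found further
    inside is kept. *)
Lemma smooth_partial C h l k f j : 0 < h -> j \in l -> Bk C k.+1 f ->
  Bk (C * (2 / h)) k.+1 (partial j (smooth h l f)) /\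
  forall x, derivable (smooth h l f) x (basis j).
Proof.
move=> h0 + Hf; elim: l => //= i l IH; rewrite inE => /orP[/eqP ji|jl].
  rewrite {}ji; have Hg := smooth_Bk h l Hf; split; last first.
    by move=> x; exact: (avg_partial h i x (Bk_cont Hg) (fun y => @Bk_derivable C k _ i y Hg)
      (Bk_cont (Bk_partial i Hg))).1.
  have := BkZ h^-1 (BkD (Bk_shift (h *: basis i) Hg) (BkZ (-1) Hg)).
  rewrite normrN normr1 mul1r gtr0_norm ?invr_gt0 //.
  rewrite (_ : h^-1 * (C + C) = C * (2 / h)); last by field; rewrite gt_eqF.
  rewrite (_ : (fun x => _) = partial i (avg h i (smooth h l f))) //.
  apply/funext => x; rewrite avg_partial_same ?gt_eqF //.
  - by rewrite mulN1r mulrC.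
  - exact: Bk_cont Hg.
  - by move=> y; exact: Bk_derivable Hg.
  - exact: Bk_cont (Bk_partial i Hg).
have [H1 H2] := IH jl; have cg := Bk_cont (smooth_Bk h l Hf).
have ap x := avg_partial h i x cg H2 (Bk_cont H1).
split; last by move=> x; exact: (ap x).1.
rewrite (_ : partial j _ = avg h i (partial j (smooth h l f))); first exact: avg_Bk.
by apply/funext => x; rewrite (ap x).2.
Qed.

(* The derivative of an average along its own direction is a difference quotient,
   so averaging once in every direction gains one derivative. *)
Lemma smooth_gain C h k f : 0 <= C -> 0 < h -> Bk C k.+1 f ->
  Bk (C * (1 + 2 / h)) k.+2 (smooth h (enum 'I_d) f).
Proof.
move=> C0 h0 Hf; have Hg := smooth_Bk h (enum 'I_d) Hf.
have hh : 0 <= 2 / h by rewrite divr_ge0 // ltW.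
split.
  split; first exact: Bk_cont Hg.
  move=> x; apply: le_trans (Bk_le Hg x) _.
  by rewrite mulrDr mulr1 lerDl mulr_ge0.
move=> j; have [H1 H2] := smooth_partial h0 (mem_enum 'I_d j : _ = true) Hf.
split; first exact: H2.
apply: Bk_weak H1.
by rewrite mulrDr mulr1 lerDr.
Qed.

Lemma avg_close C h i k f x : 0 <= h -> Bk C k.+1 f -> `|avg h i f x - f x| <= h * C.
Proof.
move=> h0 Hf; apply: avg_dist; first exact: Bk_cont Hf.
move=> r /andP[r0 r1].
apply: le_trans (partial_lipschitz (C := C) _ _ x (h * r)) _.
- by move=> y; exact: Bk_derivable Hf.
- exact: Bk_le (Bk_partial i Hf).
rewrite ger0_norm ?mulr_ge0 // ler_wpM2r ?ler_piMr //.
exact: le_trans (normr_ge0 _) (Bk_le Hf x).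
Qed.

Lemma smooth_close C h l k f x : 0 <= h -> Bk C k.+1 f ->
  `|smooth h l f x - f x| <= (size l)%:R * (h * C).
Proof.
move=> h0 Hf; elim: l => [|i l IH] /=; first by rewrite subrr normr0 mul0r.
have Hg := smooth_Bk h l Hf.
rewrite -(subrK (smooth h l f x) (avg _ _ _ _)) -addrA -natr1 mulrDl mul1r addrC.
by apply: le_trans (ler_normD _ _) _; rewrite lerD // (avg_close _ _ h0 Hg).
Qed.

End MovingAverage.

(** * An explicit scheme for the Fokker-Planck equation *)

Section Scheme.
Context {R : realType} {d : nat}.
Local Notation E := 'rV[R]_d.
Implicit Types (f g p : E -> R) (b : 'I_d -> E -> R).

Definition cdiff (h : R) (i : 'I_d) g : E -> R :=
  fun x => (g (x + h *: basis i) - g (x + (- h) *: basis i)) / (2 * h).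

Definition ldiff (h : R) (i : 'I_d) g : E -> R :=
  fun x => (g (x + h *: basis i) - 2 * g x + g (x + (- h) *: basis i)) / h ^+ 2.

(* One step of the scheme for dp/dt = - div (b p) + Dh lap p. *)
Definition euler (tau h Dh : R) b p : E -> R :=
  fun x => p x + tau * \sum_i (Dh * ldiff h i p x - cdiff h i (fun y => b i y * p y) x).

(* The derivative of the outer average in direction [i] is exactly the finite
   difference of [euler]: each step is an exact discrete continuity equation. *)
Definition flux (h Dh : R) b (i : 'I_d) p : E -> R :=
  avg h i (fun x => (b i x * p x + b i (x + (- h) *: basis i) * p (x + (- h) *: basis i)) / 2
                    - Dh * (p x - p (x + (- h) *: basis i)) / h).

Lemma cdiff_Ck h i k g : Ck k g -> Ck k (cdiff h i g).
Proof.
move=> Hg; rewrite (_ : cdiff h i g = fun x => (2 * h)^-1 *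
  (g (x + h *: basis i) - g (x + (- h) *: basis i))).
  by apply: Ck_scale; apply: CkB; exact: Ck_shift.
by apply/funext => x; rewrite /cdiff mulrC.
Qed.

Lemma ldiff_Ck h i k g : Ck k g -> Ck k (ldiff h i g).
Proof.
move=> Hg; rewrite (_ : ldiff h i g = fun x => (h ^+ 2)^-1 *
  (g (x + h *: basis i) - 2 * g x + g (x + (- h) *: basis i))).
  apply: Ck_scale; apply: CkD; last exact: Ck_shift.
  by apply: CkB; [exact: Ck_shift | exact: Ck_scale].
by apply/funext => x; rewrite /ldiff mulrC.
Qed.

Lemma cdiff_periodic h i g : periodic g -> periodic (cdiff h i g).
Proof. by move=> pg x j; rewrite /cdiff !(addrAC x (basis j)) !pg. Qed.

Lemma ldiff_periodic h i g : periodic g -> periodic (ldiff h i g).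
Proof. by move=> pg x j; rewrite /ldiff !(addrAC x (basis j)) !pg. Qed.

Lemma partial_cdiff h i j k g x : Ck k.+1 g -> partial j (cdiff h i g) x = cdiff h i (partial j g) x.
Proof.
move=> Hg.
have ds c : derivable (fun y => g (y + c)) x (basis j).
  by apply: derivable_shift; exact: Ck_derivable Hg.
rewrite (_ : cdiff h i g = fun x => (2 * h)^-1 *
  (g (x + h *: basis i) - g (x + (- h) *: basis i))); last first.
  by apply/funext => y; rewrite /cdiff mulrC.
by rewrite partial_scale ?partial_sub ?partial_shift //; [rewrite mulrC | exact: derivable_sub].
Qed.

Lemma partial_ldiff h i j k g x : Ck k.+1 g -> partial j (ldiff h i g) x = ldiff h i (partial j g) x.
Proof.
move=> Hg.
have dg : derivable g x (basis j) by exact: Ck_derivable Hg.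
have ds c : derivable (fun y => g (y + c)) x (basis j).
  by apply: derivable_shift; exact: Ck_derivable Hg.
have d1 := derivable_sub (ds (h *: basis i)) (@derivable_scale R d 2 g x j dg).
have d2 := derivable_add d1 (ds ((- h) *: basis i)).
rewrite (_ : ldiff h i g = fun x => (h ^+ 2)^-1 *
  (g (x + h *: basis i) - 2 * g x + g (x + (- h) *: basis i))); last first.
  by apply/funext => y; rewrite /ldiff mulrC.
rewrite (partial_scale _ d2) (partial_add d1 (ds _)).
rewrite (partial_sub (ds (h *: basis i)) (@derivable_scale R d 2 g x j dg)) (partial_scale 2 dg).
by rewrite !partial_shift /ldiff mulrC.
Qed.

Lemma euler_Ck tau h Dh b k p : (forall i, Ck k (b i)) -> Ck k p -> Ck k (euler tau h Dh b p).
Proof.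
move=> Hb Hp; apply: CkD => //; apply: Ck_scale; apply: Ck_sum => i; apply: CkB.
  by apply: Ck_scale; exact: ldiff_Ck.
by apply: cdiff_Ck; apply: CkM.
Qed.

Lemma euler_periodic tau h Dh b p : (forall i, periodic (b i)) -> periodic p ->
  periodic (euler tau h Dh b p).
Proof.
move=> pb pp x j; rewrite /euler pp; congr (_ + _ * _); apply: eq_bigr => i _.
rewrite ldiff_periodic // (@cdiff_periodic h i (fun y => b i y * p y)) //.
by move=> y l; rewrite pb pp.
Qed.

Lemma flux_Ck h Dh b k i p : (forall i, Ck k (b i)) -> Ck k p -> Ck k (flux h Dh b i p).
Proof.
move=> Hb Hp; apply: avg_Ck.
rewrite (_ : (fun x => _) = fun x => 2^-1 * (b i x * p x + b i (x + (- h) *: basis i) *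
   p (x + (- h) *: basis i)) - (Dh / h) * (p x - p (x + (- h) *: basis i))); last first.
  by apply/funext => x; congr (_ - _); [rewrite mulrC | rewrite mulrAC].
apply: CkB; apply: Ck_scale; last by apply: CkB => //; exact: Ck_shift.
by apply: CkD; apply: CkM => //; exact: Ck_shift.
Qed.

Lemma flux_periodic h Dh b i p : (forall i, periodic (b i)) -> periodic p ->
  periodic (flux h Dh b i p).
Proof.
by move=> pb pp; apply: avg_periodic => x j; rewrite !(addrAC x (basis j)) !pb !pp.
Qed.

Lemma euler_flux tau h Dh b k p x : h != 0 -> (forall i, Ck k.+1 (b i)) -> Ck k.+1 p ->
  euler tau h Dh b p x - p x = - tau * \sum_i partial i (flux h Dh b i p) x.
Proof.
move=> h0 Hb Hp; rewrite /euler addrC addKr mulNr -mulrN -sumrN; congr (_ * _).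
apply: eq_bigr => i _; rewrite /flux.
set u := (fun x => _ - _).
have Hu : Ck k.+1 u.
  rewrite (_ : u = fun x => 2^-1 * (b i x * p x + b i (x + (- h) *: basis i) *
     p (x + (- h) *: basis i)) - (Dh / h) * (p x - p (x + (- h) *: basis i))); last first.
    by apply/funext => y; rewrite /u; congr (_ - _); [rewrite mulrC | rewrite mulrAC].
  apply: CkB; apply: Ck_scale; last by apply: CkB => //; exact: Ck_shift.
  by apply: CkD; apply: CkM => //; exact: Ck_shift.
rewrite avg_partial_same //; last 3 first.
- exact: Ck_cont Hu.
- by move=> y; exact: Ck_derivable Hu.
- exact: Ck_cont (Ck_partial i Hu).
have xh : x + h *: basis i + - h *: basis i = x by rewrite scaleNr addrK.
by rewrite /u xh /ldiff /cdiff; field.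
Qed.

Lemma euler_lin tau h Dh b p q (c1 c2 : R) x :
  euler tau h Dh b (fun y => c1 * p y + c2 * q y) x =
  c1 * euler tau h Dh b p x + c2 * euler tau h Dh b q x.
Proof.
rewrite /euler 2!mulrDr addrACA; congr (_ + _).
rewrite !(mulrCA _ tau) -mulrDr; congr (_ * _).
rewrite !mulr_sumr -big_split /=; apply: eq_bigr => i _.
by rewrite /ldiff /cdiff; ring.
Qed.

Section Bounds.
Variables (tau h Dh C B : R) (b : 'I_d -> E -> R).
Hypotheses (tau0 : 0 < tau) (h0 : 0 < h) (Dh0 : 0 <= Dh).
Hypotheses (stab : 2 * d%:R * tau * Dh <= h ^+ 2) (cfl : B * h <= 2 * Dh).
Hypotheses (b1 : forall i, Ck 1 (b i)) (bB : forall i x, `|b i x| <= B).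
Hypothesis db : forall i x, `|partial i (b i) x| <= C.

(* [stab] and [cfl] make all the weights of the scheme nonnegative. *)
Lemma euler_ge0 p x : (forall y, 0 <= p y) -> 0 <= euler tau h Dh b p x.
Proof.
move=> p0; have h2 : 0 < h ^+ 2 by rewrite exprn_gt0.
have -> : euler tau h Dh b p x = p x * (1 - 2 * d%:R * tau * Dh / h ^+ 2) +
   \sum_i (p (x + h *: basis i) * (tau / (2 * h ^+ 2) * (2 * Dh - h * b i (x + h *: basis i))) +
           p (x + - h *: basis i) * (tau / (2 * h ^+ 2) * (2 * Dh + h * b i (x + - h *: basis i)))).
  rewrite /euler mulrBr mulr1 -addrA; congr (_ + _).
  have -> : p x * (2 * d%:R * tau * Dh / h ^+ 2) = \sum_(i < d) (p x * (2 * tau * Dh / h ^+ 2)).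
    by rewrite sumr_const card_ord -[RHS]mulr_natr; ring.
  rewrite -sumrN -big_split /= mulr_sumr; apply: eq_bigr => i _.
  by rewrite /ldiff /cdiff; field; rewrite gt_eqF.
apply: addr_ge0.
  by rewrite mulr_ge0 // subr_ge0 ler_pdivrMr // mul1r.
apply: sumr_ge0 => i _.
have hb y : - (2 * Dh) <= h * b i y <= 2 * Dh.
  rewrite -ler_norml normrM gtr0_norm //; apply: le_trans cfl.
  by rewrite mulrC ler_wpM2r // ltW.
have t2 : 0 <= tau / (2 * h ^+ 2) by rewrite divr_ge0 ?ltW // mulr_gt0.
apply: addr_ge0; apply: mulr_ge0 => //; apply: mulr_ge0 => //.
  by have /andP[_] := hb (x + h *: basis i); lra.
by have /andP[+ _] := hb (x + - h *: basis i); lra.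
Qed.

Lemma cdiff_le g i (M : R) x : Ck 1 g -> (forall y, `|partial i g y| <= M) ->
  `|cdiff h i g x| <= M.
Proof.
move=> Hg hM; rewrite /cdiff normf_div (gtr0_norm (_ : 0 < 2 * h)) ?mulr_gt0 //.
rewrite ler_pdivrMr ?mulr_gt0 //.
have := partial_lipschitz (fun y => @Ck_derivable _ _ 0 g i y Hg) hM (x + - h *: basis i) (2 * h).
rewrite -addrA -scalerDl (_ : - h + 2 * h = h); last by ring.
by move=> H; apply: (le_trans H); rewrite mulrC (gtr0_norm (_ : 0 < 2 * h)) // mulr_gt0.
Qed.

(** On constants the second differences vanish and the defect is [tau] times the discrete divergence
    of the drift. This is where a bound on first derivatives of [b], and on nothing higher, controls
    growth and decay. *)
Lemma euler_cst x : `|euler tau h Dh b (fun=> 1) x - 1| <= d%:R * C * tau.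
Proof.
rewrite /euler addrC addKr normrM (gtr0_norm tau0) mulrC.
apply: ler_wpM2r; first exact: ltW.
apply: le_trans (ler_norm_sum _ _ _) _.
rewrite -[d%:R * C]/(_) mulrC mulr_natr -[X in C *+ X]card_ord -sumr_const.
apply: ler_sum => i _.
rewrite (_ : Dh * _ - _ = - cdiff h i (b i) x) ?normrN ?cdiff_le //.
by rewrite /ldiff /cdiff; field; rewrite gt_eqF.
Qed.

(** Monotonicity and linearity reduce the claim to the constant function: [euler_ge0] is applied to
    [p - m]. The upper bound [euler_le] is obtained in the same way from [N + p] and [N - p]. *)
Lemma euler_ge p (m : R) x : 0 <= m -> (forall y, m <= p y) ->
  (1 - d%:R * C * tau) * m <= euler tau h Dh b p x.
Proof.
move=> m0 hm.
have := @euler_ge0 (fun y => 1 * p y + (- m) * 1) x.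
rewrite (@euler_lin tau h Dh b p (fun=> 1)) mul1r => H.
have {}H := H (fun y => ltac:(by rewrite mul1r mulr1 subr_ge0)).
have := euler_cst x; rewrite ler_norml => /andP[e1 _].
have : m * (1 - d%:R * C * tau) <= m * euler tau h Dh b (fun=> 1) x.
  by rewrite ler_wpM2l //; lra.
by rewrite [_ * m]mulrC; lra.
Qed.

Lemma euler_le p (N : R) x : (forall y, `|p y| <= N) ->
  `|euler tau h Dh b p x| <= (1 + d%:R * C * tau) * N.
Proof.
move=> hN; have N0 : 0 <= N by exact: le_trans (normr_ge0 _) (hN x).
have := euler_cst x; rewrite ler_norml => /andP[_ e1].
have e2 : N * euler tau h Dh b (fun=> 1) x <= N * (1 + d%:R * C * tau).
  by rewrite ler_wpM2l //; lra.
have H1 := @euler_ge0 (fun y => 1 * p y + N * 1) x.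
rewrite (@euler_lin tau h Dh b p (fun=> 1)) mul1r in H1.
have H2 := @euler_ge0 (fun y => (-1) * p y + N * 1) x.
rewrite (@euler_lin tau h Dh b p (fun=> 1)) mulN1r in H2.
have hN' y : - N <= p y <= N by rewrite -ler_norml.
have {}H1 := H1 (fun y => ltac:(by rewrite mul1r mulr1; have /andP[] := hN' y; lra)).
have {}H2 := H2 (fun y => ltac:(by rewrite mulN1r mulr1; have /andP[] := hN' y; lra)).
by rewrite ler_norml [_ * N]mulrC; apply/andP; split; lra.
Qed.

(** Shifted differences commute with derivatives, so the only commutator comes from differentiating
    the drift; a derivative of [p] then obeys the same scheme with a source of lower order in
    [p]. *)
Lemma euler_partial p j x : Ck 1 p -> partial j (euler tau h Dh b p) x =
  euler tau h Dh b (partial j p) x - tau * \sum_i cdiff h i (fun y => partial j (b i) y * p y) x.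
Proof.
move=> Hp; have dp y : derivable p y (basis j) by exact: Ck_derivable Hp.
have dbj i y : derivable (b i) y (basis j) by exact: Ck_derivable (b1 i).
have Hc i : Ck 1 (cdiff h i (fun y => b i y * p y)) by apply: cdiff_Ck; exact: CkM.
have Hl i : Ck 1 (ldiff h i p) by exact: ldiff_Ck.
have ds i : derivable (fun y => Dh * ldiff h i p y - cdiff h i (fun y => b i y * p y) y) x (basis j).
  apply: derivable_sub; last exact: Ck_derivable (Hc i).
  by apply: derivable_scale; exact: Ck_derivable (Hl i).
rewrite /euler partial_add //; last by apply: derivable_scale; exact: derivable_bigsum.
rewrite partial_scale; last exact: derivable_bigsum.
rewrite partial_bigsum // -addrA -mulrBr -sumrB; congr (_ + _ * _); apply: eq_bigr => i _.
rewrite partial_sub; last 2 first.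
- by apply: derivable_scale; exact: Ck_derivable (Hl i).
- exact: Ck_derivable (Hc i).
rewrite partial_scale; last exact: Ck_derivable (Hl i).
rewrite (partial_ldiff h i j x Hp) (partial_cdiff h i j x (CkM (b1 i) Hp)).
rewrite (_ : partial j (fun y => b i y * p y) = fun y => partial j (b i) y * p y + b i y * partial j p y).
  by rewrite /cdiff; field; rewrite gt_eqF.
by apply/funext => y; rewrite partial_mul.
Qed.

End Bounds.
End Scheme.

(** * Stability and consistency of the scheme *)

Section SchemeBounds.
Context {R : realType} {d : nat}.
Local Notation E := 'rV[R]_d.
Implicit Types (f g p : E -> R).

Lemma Ck_der k f : Ck k.+1 f -> forall i x, derivable f x (basis i).
Proof. by move=> Hf i x; exact: Ck_derivable Hf. Qed.
Arguments Ck_der {k f} _ i x.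

Lemma sum_ord_le (F : 'I_d -> R) (M : R) : (forall i, `|F i| <= M) ->
  `|\sum_i F i| <= d%:R * M.
Proof.
move=> hF; apply: (le_trans (ler_norm_sum _ _ _)).
rewrite mulr_natl -[X in M *+ X]card_ord -sumr_const.
by apply: ler_sum => i _.
Qed.

Lemma Ck_Bk2 (N : R) f : Ck 2 f -> (forall x, `|f x| <= N) ->
  (forall i x, `|partial i f x| <= N) ->
  (forall i j x, `|partial j (partial i f) x| <= N) -> Bk N 2 f.
Proof.
move=> Hf h0 h1 h2; split; first by split => //; exact: Ck_cont Hf.
move=> i; have Hi := Ck_partial i Hf; split; first by move=> x; exact: Ck_derivable Hf.
split; first by split => //; exact: Ck_cont Hi.
move=> j; split; first by move=> x; exact: Ck_derivable Hi.
by split => //; split => //; exact: Ck_cont (Ck_partial j Hi).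
Qed.

#[local] Opaque Ck Bk.

Lemma normM_le (a b A B : R) : `|a| <= A -> `|b| <= B -> `|a * b| <= A * B.
Proof. by move=> hA hB; rewrite normrM ler_pM. Qed.

Lemma partial_mul_le f g i x (A A' B B' : R) : Ck 1 f -> Ck 1 g ->
  `|f x| <= A -> `|partial i f x| <= A' -> `|g x| <= B -> `|partial i g x| <= B' ->
  `|partial i (fun y => f y * g y) x| <= A' * B + A * B'.
Proof.
move=> Hf Hg hA hA' hB hB'.
rewrite (partial_mul (Ck_der Hf i x) (Ck_der Hg i x)).
by apply: (le_trans (ler_normD _ _)); rewrite lerD // normM_le.
Qed.

(** Negative powers of [h] are accepted here and in [ldiff_crude]: both serve only the increment
    over one time step, whose factor [tau] is chosen after [h]. *)
Lemma cdiff_crude (h : R) i g x (M : R) : 0 < h -> (forall y, `|g y| <= M) ->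
  `|cdiff h i g x| <= M / h.
Proof.
move=> h0 hM; have h2 : 0 < 2 * h by rewrite mulr_gt0.
rewrite /cdiff normf_div (gtr0_norm h2) ler_pdivrMr //.
rewrite (_ : M / h * (2 * h) = M + M); last by field; rewrite gt_eqF.
by apply: (le_trans (ler_normB _ _)); rewrite lerD.
Qed.

Lemma ldiff_crude (h : R) i g x (M : R) : 0 < h -> (forall y, `|g y| <= M) ->
  `|ldiff h i g x| <= 4 * M / h ^+ 2.
Proof.
move=> h0 hM; have h2 : 0 < h ^+ 2 by rewrite exprn_gt0.
rewrite /ldiff normf_div (gtr0_norm h2) ler_pM2r ?invr_gt0 //.
have := hM (x + h *: basis i); have := hM x; have := hM (x + - h *: basis i).
by rewrite !ler_norml => /andP[? ?] /andP[? ?] /andP[? ?]; apply/andP; split; lra.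
Qed.

Variables (tau h Dh C : R) (b : 'I_d -> E -> R).
Hypotheses (tau0 : 0 < tau) (h0 : 0 < h) (Dh0 : 0 <= Dh).
Hypotheses (stab : 2 * d%:R * tau * Dh <= h ^+ 2) (cfl : C * h <= 2 * Dh).
Hypothesis Hb : forall i, Bk C 3 (b i).

(* 7 = 1 + 2 + 4: a second derivative solves the scheme up to terms with one
   derivative on [b] (twice) and with two. *)
Lemma euler_Bk p (N : R) : Bk N 2 p ->
  Bk ((1 + 7 * d%:R * C * tau) * N) 2 (euler tau h Dh b p).
Proof.
move=> Hp; have N0 : 0 <= N by exact: le_trans (normr_ge0 _) (Bk_le Hp 0).
have C0 (i : 'I_d) : 0 <= C by exact: le_trans (normr_ge0 _) (Bk_le (Hb i) 0).
(* The sign of [C] is known only through a component of the drift; in dimension zero there is none,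
   but the product vanishes. *)
have dC0 : 0 <= d%:R * C * tau.
  case: d C0 => [|d'] C0; first by rewrite !mul0r.
  by rewrite mulr_ge0 ?mulr_ge0 ?(C0 ord0) ?ler0n // ltW.
have dCN0 : 0 <= d%:R * C * tau * N by rewrite mulr_ge0.
clear C0.
have Ckp : Ck 2 p := Bk_Ck Hp.
have Ckb i : Ck 3 (b i) := Bk_Ck (Hb i).
have Ckb1 i : Ck 1 (b i) by exact: Ck_le (Ckb i).
have Ckp1 : Ck 1 p := Ck_pred Ckp.
have bC i x : `|b i x| <= C := Bk_le (Hb i) x.
have Hdb i j : Bk C 2 (partial j (b i)) := Bk_partial j (Hb i).
have Hddb i j l : Bk C 1 (partial l (partial j (b i))) := Bk_partial l (Hdb i j).
have dbC i j x : `|partial j (b i) x| <= C := Bk_le (Hdb i j) x.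
have ddbC i j l x : `|partial l (partial j (b i)) x| <= C := Bk_le (Hddb i j l) x.
have dddbC i j l m x : `|partial m (partial l (partial j (b i))) x| <= C.
  exact: Bk_le (Bk_partial m (Hddb i j l)) x.
have Hdp j : Bk N 1 (partial j p) := Bk_partial j Hp.
have pN x : `|p x| <= N := Bk_le Hp x.
have dpN j x : `|partial j p x| <= N := Bk_le (Hdp j) x.
have ddpN j l x : `|partial l (partial j p) x| <= N := Bk_le (Bk_partial l (Hdp j)) x.
have Ckdp1 j : Ck 1 (partial j p) := Ck_partial j Ckp.
have Ckdb i j : Ck 2 (partial j (b i)) := Ck_partial j (Ckb i).
have Ckdb1 i j : Ck 1 (partial j (b i)) := Ck_pred (Ckdb i j).
have Ckddb i j l : Ck 1 (partial l (partial j (b i))) := Ck_partial l (Ckdb i j).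
have el q x : (forall y, `|q y| <= N) -> `|euler tau h Dh b q x| <= (1 + d%:R * C * tau) * N.
  by move=> hq; apply: (euler_le (C := C) (B := C)).
have tsum (F : 'I_d -> R) (M : R) : (forall i, `|F i| <= M) -> `|tau * \sum_i F i| <= tau * (d%:R * M).
  move=> hF; rewrite normrM (gtr0_norm tau0); apply: ler_wpM2l; first exact: ltW.
  exact: sum_ord_le.
have E1 j : partial j (euler tau h Dh b p) = fun x => euler tau h Dh b (partial j p) x -
    tau * \sum_i cdiff h i (fun y => partial j (b i) y * p y) x.
  by apply/funext => x; exact: euler_partial.
apply: Ck_Bk2.
- exact: (euler_Ck tau h Dh (fun i => Ck_pred (Ckb i)) Ckp).
- by move=> x; apply: (le_trans (el p x pN)); lra.
- move=> j x; rewrite E1; apply: (le_trans (ler_normB _ _)).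
  have := el _ x (dpN j).
  have := tsum (fun i => cdiff h i (fun y => partial j (b i) y * p y) x) (C * N + C * N).
  have H i : `|cdiff h i (fun y => partial j (b i) y * p y) x| <= C * N + C * N.
    apply: (cdiff_le h0 x (CkM (Ckdb1 i j) Ckp1)) => y.
    exact: (partial_mul_le (Ckdb1 i j) Ckp1).
  by move=> /(_ H); lra.
- move=> j l x; rewrite E1.
  have Hc i : Ck 1 (cdiff h i (fun y => partial j (b i) y * p y)) by apply: cdiff_Ck; exact: CkM.
  have dsum : derivable (fun x => \sum_i cdiff h i (fun y => partial j (b i) y * p y) x) x (basis l).
    by apply: derivable_bigsum => i; exact: Ck_derivable (Hc i).
  have de : derivable (euler tau h Dh b (partial j p)) x (basis l).
    by apply: (@Ck_derivable _ _ 0); apply: euler_Ck.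
  rewrite (partial_sub de (@derivable_scale R d tau _ x l dsum)) (partial_scale tau dsum).
  rewrite partial_bigsum; last by move=> i; exact: Ck_derivable (Hc i).
  rewrite euler_partial //.
  have H1 i : `|cdiff h i (fun y => partial l (b i) y * partial j p y) x| <= C * N + C * N.
    apply: (cdiff_le h0 x (CkM (Ckdb1 i l) (Ckdp1 j))) => y.
    exact: (partial_mul_le (Ckdb1 i l) (Ckdp1 j)).
  (* A third derivative of [b] appears in this term, hence the requirement [Bk C 3]. It costs four
     multiples of [C * N], the commutator [H1] two, and the scheme itself one. *)
  have H2 i : `|partial l (cdiff h i (fun y => partial j (b i) y * p y)) x| <=
      C * N + C * N + (C * N + C * N).
    rewrite (partial_cdiff h i l x (CkM (Ckdb1 i j) Ckp1)).
    have -> : partial l (fun y => partial j (b i) y * p y) =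
       fun y => partial l (partial j (b i)) y * p y + partial j (b i) y * partial l p y.
      apply/funext => y.
      by rewrite (partial_mul (Ck_der (Ckdb1 i j) l y) (Ck_der Ckp1 l y)).
    have K1 := CkM (Ckddb i j l) Ckp1; have K2 := CkM (Ckdb1 i j) (Ckdp1 l).
    apply: (cdiff_le h0 x (CkD K1 K2)) => y; rewrite (partial_add (Ck_der K1 i y) (Ck_der K2 i y)).
    apply: (le_trans (ler_normD _ _)); rewrite lerD //.
      exact: (partial_mul_le (Ckddb i j l) Ckp1).
    exact: (partial_mul_le (Ckdb1 i j) (Ckdp1 l)).
  apply: (le_trans (ler_normB _ _)).
  have := ler_normB (euler tau h Dh b (partial l (partial j p)) x)
    (tau * \sum_i cdiff h i (fun y => partial l (b i) y * partial j p y) x).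
  have := el _ x (ddpN j l); have := tsum _ _ H1; have := tsum _ _ H2.
  by lra.
Qed.

(** Three sources of error: [b i * p] is sampled at distance at most [h] (first term), the
    difference quotient is a derivative at distance at most [2 * h] (second), and the viscosity is
    [Dh] in place of [D] (third). *)
Lemma flux_close (D : R) i p (N : R) x : Bk N 2 p ->
  `|flux h Dh b i p x - (b i x * p x - D * partial i p x)| <=
  (2 * C * h + 2 * Dh * h + `|Dh - D|) * N.
Proof.
move=> Hp; have N0 : 0 <= N by exact: le_trans (normr_ge0 _) (Bk_le Hp 0).
have Ckp : Ck 2 p := Bk_Ck Hp.
have Ckp1 : Ck 1 p := Ck_pred Ckp.
have Ckb1 : Ck 1 (b i) by exact: Ck_le (Bk_Ck (Hb i)).
have C0 : 0 <= C by exact: le_trans (normr_ge0 _) (Bk_le (Hb i) 0).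
have uL y k : `|b i (y + k *: basis i) * p (y + k *: basis i) - b i y * p y| <= `|k| * (C * N + C * N).
  apply: (@partial_lipschitz _ _ (fun y => b i y * p y)).
    by move=> z; exact: Ck_derivable (CkM Ckb1 Ckp1).
  move=> z; apply: partial_mul_le => //; [exact: Bk_le (Hb i) z|
    exact: Bk_le (Bk_partial i (Hb i)) z|exact: Bk_le Hp z|exact: Bk_le (Bk_partial i Hp) z].
have pL y k : `|partial i p (y + k *: basis i) - partial i p y| <= `|k| * N.
  apply: partial_lipschitz; first by move=> z; exact: Ck_derivable (Ck_partial i Ckp).
  exact: Bk_le (Bk_partial i (Bk_partial i Hp)).
apply: avg_dist.
  apply: (@Ck_cont _ _ 1).
  rewrite (_ : (fun x => _) = fun x => 2^-1 * (b i x * p x + b i (x + (- h) *: basis i) *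
     p (x + (- h) *: basis i)) - (Dh / h) * (p x - p (x + (- h) *: basis i))); last first.
    by apply/funext => y; congr (_ - _); [rewrite mulrC | rewrite mulrAC].
  apply: CkB; apply: Ck_scale; last by apply: CkB => //; exact: Ck_shift.
  by apply: CkD; [exact: CkM Ckb1 Ckp1 | exact: CkM (Ck_shift _ Ckb1) (Ck_shift _ Ckp1)].
move=> r /andP[r0 r1].
have hr0 : 0 <= h * r by rewrite mulr_ge0 // ltW.
have hr1 : h * r <= h by rewrite ler_piMr // ltW.
set y := x + (h * r) *: basis i.
have yh : y + - h *: basis i = x + (h * r - h) *: basis i by rewrite /y -addrA -scalerDl.
have CN : 0 <= C * N + C * N by rewrite addr_ge0 ?mulr_ge0.
have U1 : `|b i y * p y - b i x * p x| <= h * (C * N + C * N).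
  by apply: (le_trans (uL x _)); rewrite ler_wpM2r // ger0_norm.
have U2 : `|b i (y + - h *: basis i) * p (y + - h *: basis i) - b i x * p x| <= h * (C * N + C * N).
  rewrite yh; apply: (le_trans (uL x _)); rewrite ler_wpM2r //.
  by rewrite ler_norml; apply/andP; split; lra.
have [s sh E] := @partial_MVT _ _ p y i (- h) (fun z => Ck_der Ckp i z).
have sh' : `|h * r + s| <= 2 * h.
  apply: (le_trans (ler_normD _ _)); rewrite ger0_norm //.
  by move: sh; rewrite normrN (gtr0_norm h0); lra.
set q := (p y - p (y + - h *: basis i)) / h.
have qE : q = partial i p (x + (h * r + s) *: basis i).
  by rewrite /q -opprB E scalerDl addrA -/y; field; rewrite gt_eqF.
have P1 : `|q - partial i p x| <= 2 * h * N.
  by rewrite qE; apply: (le_trans (pL _ _)); rewrite ler_wpM2r.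
have P2 : `|partial i p x| <= N := Bk_le (Bk_partial i Hp) x.
rewrite -mulrA -/q.
rewrite (_ : _ - _ = ((b i y * p y - b i x * p x) + (b i (y + - h *: basis i) *
   p (y + - h *: basis i) - b i x * p x)) / 2 - Dh * (q - partial i p x)
   - (Dh - D) * partial i p x); last by field.
apply: (le_trans (ler_normB _ _)); rewrite [X in _ <= X]mulrDl lerD //; last first.
  by rewrite normrM ler_wpM2l.
apply: (le_trans (ler_normB _ _)); rewrite [X in _ <= X]mulrDl lerD //; last first.
  by rewrite normrM (ger0_norm Dh0) (_ : 2 * Dh * h * N = Dh * (2 * h * N)) ?ler_wpM2l //; ring.
rewrite normf_div (gtr0_norm (_ : 0 < 2)) // ler_pdivrMr //.
apply: (le_trans (ler_normD _ _)).
by rewrite (_ : 2 * C * h * N * 2 = h * (C * N + C * N) + h * (C * N + C * N)) ?lerD //; ring.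
Qed.

(** Increments of the density and of its gradient are both needed, to compare the interpolant in
    time with the nodes. The factor 2 accounts for the commutator in the gradient; the density alone
    would need it once. *)
Lemma euler_step p (N : R) : Bk N 2 p ->
  (forall x, `|euler tau h Dh b p x - p x| <= tau * (d%:R * (Dh * (4 * N / h ^+ 2) + 2 * (C * N / h)))) /\
  (forall j x, `|partial j (euler tau h Dh b p) x - partial j p x| <=
     tau * (d%:R * (Dh * (4 * N / h ^+ 2) + 2 * (C * N / h)))).
Proof.
move=> Hp; have N0 : 0 <= N by exact: le_trans (normr_ge0 _) (Bk_le Hp 0).
have bC i x : `|b i x| <= C := Bk_le (Hb i) x.
have dbC i j x : `|partial j (b i) x| <= C := Bk_le (Bk_partial j (Hb i)) x.
have pN x : `|p x| <= N := Bk_le Hp x.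
have dpN j x : `|partial j p x| <= N := Bk_le (Bk_partial j Hp) x.
have C0 (i : 'I_d) : 0 <= C by exact: le_trans (normr_ge0 _) (Bk_le (Hb i) 0).
have CN (i : 'I_d) : 0 <= C * N / h by rewrite divr_ge0 ?mulr_ge0 ?(C0 i) // ltW.
have tsum (F : 'I_d -> R) (M : R) : (forall i, `|F i| <= M) -> `|tau * \sum_i F i| <= tau * (d%:R * M).
  move=> hF; rewrite normrM (gtr0_norm tau0); apply: ler_wpM2l; first exact: ltW.
  exact: sum_ord_le.
have H q x i : (forall y, `|q y| <= N) ->
    `|Dh * ldiff h i q x - cdiff h i (fun y => b i y * q y) x| <= Dh * (4 * N / h ^+ 2) + C * N / h.
  move=> qN; apply: (le_trans (ler_normB _ _)); rewrite lerD //.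
    by rewrite normrM (ger0_norm Dh0) ler_wpM2l // ldiff_crude.
  by apply: cdiff_crude => // y; apply: normM_le.
split=> [x|j x].
  rewrite /euler addrC addKr; apply: tsum => i; apply: (le_trans (H p x i pN)).
  by have {CN C0} := CN i; lra.
rewrite euler_partial //; last 2 first.
- by move=> i; exact: Ck_le (Bk_Ck (Hb i)).
- exact: Ck_pred (Bk_Ck Hp).
rewrite /euler addrAC (addrC (partial j p x)) addrK -mulrBr -sumrB.
apply: tsum => i; apply: (le_trans (ler_normB _ _)).
rewrite (_ : 2 * (C * N / h) = C * N / h + C * N / h); last by ring.
rewrite addrA lerD ?(H _ x i (dpN j)) //.
by apply: cdiff_crude => // y; apply: normM_le.
Qed.

End SchemeBounds.

(** * Interpolation in time *)

Section TimeInterpolation.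
Context {R : realType}.

(* [hat] is the piecewise linear bump supported in [-1, 1] and [ramp] its C^1
   primitive, going from 0 to 1. *)
Definition rpart (u : R) : R := Num.max 0 u.
Definition hat (u : R) : R := rpart (u + 1) - 2 * rpart u + rpart (u + (-1)).
Definition rsq (u : R) : R := rpart u * rpart u / 2.
Definition ramp (u : R) : R := rsq (u + 1) - 2 * rsq u + rsq (u + (-1)).

Lemma rpart_pos u : 0 <= u -> rpart u = u.
Proof. by move=> h; rewrite /rpart max_r. Qed.

Lemma rpart_neg u : u <= 0 -> rpart u = 0.
Proof. by move=> h; rewrite /rpart max_l. Qed.

(** The remainder of first order is at most the square of the increment in each of the four sign
    cases, so the radius [e] itself serves the tolerance [e]. *)
Lemma is_derive_rsq u : is_derive u (1 : R) rsq (rpart u).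
Proof.
apply/is_deriveP => e e0; exists e => // r ru re.
have r0 : r - u != 0 by rewrite subr_eq0.
apply: le_lt_trans re.
rewrite (_ : (rsq r - rsq u) / (r - u) - rpart u = (rsq r - rsq u - rpart u * (r - u)) / (r - u)); last by field.
rewrite normf_div ler_pdivrMr ?normr_gt0 // -normrM -expr2 [X in _ <= X]ger0_norm ?sqr_ge0 //.
rewrite /rsq ler_norml; have [hu|hu] := leP 0 u; have [hr|hr] := leP 0 r.
- by rewrite !rpart_pos //; apply/andP; split; nra.
- by rewrite (rpart_pos hu) (rpart_neg (ltW hr)); apply/andP; split; nra.
- by rewrite (rpart_pos hr) (rpart_neg (ltW hu)); apply/andP; split; nra.
- by rewrite (rpart_neg (ltW hr)) (rpart_neg (ltW hu)); apply/andP; split; nra.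
Qed.

Lemma is_derive_translate (f : R -> R) (c u l : R) : is_derive (u + c) (1 : R) f l ->
  is_derive u (1 : R) (fun u => f (u + c)) l.
Proof.
move=> /is_deriveP h; apply/is_deriveP => e /h[dl dl0 hdl]; exists dl => // r ru rd.
have := hdl (r + c); rewrite (_ : r + c - (u + c) = r - u); last by ring.
by apply => //; rewrite (inj_eq (addIr c)).
Qed.

Lemma is_derive_ramp u : is_derive u (1 : R) ramp (hat u).
Proof.
have h1 := is_derive_translate (is_derive_rsq (u + 1)).
have h2 := is_derive_rsq u.
have h3 := is_derive_translate (is_derive_rsq (u + (-1))).
have h4 := @deriv_onD R (u - 1) (u + 1) _ _ u _ _ (@deriv_onB R (u - 1) (u + 1) _ _ u _ _
  (is_derive_deriv_on _ _ h1) (@deriv_onZ R (u - 1) (u + 1) 2 _ u _ (is_derive_deriv_on _ _ h2)))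
  (is_derive_deriv_on _ _ h3).
apply: deriv_on_interior h4.
by rewrite in_itv /= ltrBlDr !ltrDl ltr01.
Qed.

Lemma continuous_rpart : continuous rpart.
Proof.
move=> u; apply: (@continuous_max _ R (fun=> 0) id); [exact: cvg_cst | exact: cvg_id].
Qed.

Lemma continuous_hat : continuous hat.
Proof.
have c k : continuous (fun u => rpart (u + k)).
  move=> u; apply: (@continuous_comp _ _ _ (fun u => u + k) rpart); last exact: continuous_rpart.
  by apply: continuous_add => [v|]; [exact: cvg_id | exact: continuous_const].
apply: continuous_add => //; apply: continuous_sub => //.
by apply: continuous_mul; [exact: continuous_const | exact: continuous_rpart].
Qed.

Lemma hat_ge0 u : 0 <= hat u.
Proof. by rewrite /hat /rpart /Num.max; do 3 (case: ifP => ?); lra. Qed.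

Lemma hat_eq0 u : 1 <= `|u| -> hat u = 0.
Proof.
rewrite ler_normr => h; rewrite /hat; case/orP: h => h.
  by rewrite !rpart_pos; lra.
by rewrite !rpart_neg; lra.
Qed.

Lemma ramp_eq1 u : 1 <= u -> ramp u = 1.
Proof. by move=> h; rewrite /ramp /rsq !rpart_pos; [field|lra..]. Qed.

Lemma ramp_eq0 u : u <= -1 -> ramp u = 0.
Proof. by move=> h; rewrite /ramp /rsq !rpart_neg; [ring|lra..]. Qed.

Lemma ramp_itv u : 0 <= ramp u <= 1.
Proof.
have [h|h] := leP 1 u; first by rewrite ramp_eq1 // ler01 lexx.
have [h'|h'] := leP u (-1); first by rewrite ramp_eq0 // ler01 lexx.
rewrite /ramp /rsq (rpart_pos (_ : 0 <= u + 1)) ?(rpart_neg (_ : u + (-1) <= 0)); [|lra..].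
have [k|k] := leP 0 u; first by rewrite (rpart_pos k); apply/andP; split; nra.
by rewrite (rpart_neg (ltW k)); apply/andP; split; nra.
Qed.

(** Each [hat] is a second difference of [rpart], so the sum telescopes; the nodes 0 to [M], both
    included, are what covers [[0, M]]. *)
Lemma sum_hat (M : nat) (sg : R) : 0 <= sg <= M%:R -> \sum_(k < M.+1) hat (sg - k%:R) = 1.
Proof.
move=> /andP[s0 sM].
have E n : \sum_(k < n) hat (sg - k%:R) =
    (rpart (sg + 1) - rpart sg) - (rpart (sg + 1 - n%:R) - rpart (sg - n%:R)).
  elim: n => [|n IH]; first by rewrite big_ord0 !subr0 subrr.
  rewrite big_ord_recr /= IH /hat (_ : n.+1%:R = n%:R + 1 :> R); last by rewrite natr1.
  rewrite (_ : sg - n%:R + 1 = sg + 1 - n%:R); last by ring.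
  rewrite (_ : sg + 1 - (n%:R + 1) = sg - n%:R); last by ring.
  rewrite (_ : sg - n%:R + (-1) = sg - (n%:R + 1)); last by ring.
  by ring.
rewrite E -natr1 (rpart_pos s0) rpart_pos; last by lra.
by rewrite !rpart_neg; lra.
Qed.

Lemma sum_indicator (M c : nat) : \sum_(j < M) ((j : nat) == c)%:R <= 1 :> R.
Proof.
suff -> : \sum_(j < M) ((j : nat) == c)%:R = (c < M)%N%:R :> R.
  by case: (c < M)%N; rewrite ?ler01.
elim: M => [|M IH]; first by rewrite big_ord0 ltn0.
rewrite big_ord_recr /= IH [(c < M.+1)%N]ltnS.
by case: (ltngtP c M) => _; rewrite ?addr0 ?add0r.
Qed.

Lemma sum_telescope (q : nat -> R) (M k : nat) : (k <= M)%N ->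
  \sum_(j < M) (j < k)%N%:R * (q j.+1 - q j) = q k - q 0%N.
Proof.
elim: M k => [|M IH] k; first by rewrite leqn0 => /eqP ->; rewrite big_ord0 subrr.
rewrite leq_eqVlt => /orP[/eqP ->|kM].
  rewrite big_ord_recr /= ltnSn mul1r.
  rewrite (eq_bigr (fun j : 'I_M => (j < M)%N%:R * (q j.+1 - q j))).
    by rewrite IH //; ring.
  by move=> j _; rewrite ltn_ord ltnS ltnW.
by rewrite big_ord_recr /= IH // ltnNge -ltnS kM mul0r addr0.
Qed.

(** The weight of the increment [j] is exactly 1 for [j < k] and 0 otherwise, except at [j = 0],
    where the subtracted ramp is at half height, and at the three indices around [k]. Each of these
    four exceptions costs at most [2 * dl], whence the 8. *)
Lemma interp_close (q : nat -> R) (dl sg : R) (M k : nat) : (k < M)%N -> 0 <= dl ->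
  (forall j, (j < M)%N -> `|q j.+1 - q j| <= dl) -> 0 <= sg -> `|sg - k%:R| < 1 ->
  `|q 0%N + \sum_(j < M) (ramp (sg - j%:R) - ramp (0 - j%:R)) * (q j.+1 - q j) - q k| <= 8 * dl.
Proof.
move=> kM dl0 hq s0; rewrite ltr_norml => /andP[k1 k2].
rewrite (_ : _ - q k = \sum_(j < M) (ramp (sg - j%:R) - ramp (0 - j%:R) - (j < k)%N%:R)
   * (q j.+1 - q j)); last first.
  rewrite (_ : q k = (q k - q 0%N) + q 0%N); last by ring.
  rewrite -(sum_telescope q (ltnW kM)).
  rewrite (_ : forall x y z : R, x + y - (z + x) = y - z); last by move=> *; ring.
  by rewrite -sumrB; apply: eq_bigr => j _; ring.
apply: (le_trans (ler_norm_sum _ _ _)).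
apply: (@le_trans _ _ (\sum_(j < M) (((j : nat) == 0%N)%:R + ((j : nat) == k.-1)%:R + ((j : nat) == k)%:R
   + ((j : nat) == k.+1)%:R) * (2 * dl))).
  apply: ler_sum => j _.
  have key : `|ramp (sg - j%:R) - ramp (0 - j%:R) - (j < k)%N%:R| <=
      (((j : nat) == 0%N)%:R + ((j : nat) == k.-1)%:R + ((j : nat) == k)%:R + ((j : nat) == k.+1)%:R) * 2.
    have [J|] := boolP [|| (j : nat) == 0%N, (j : nat) == k.-1, (j : nat) == k | (j : nat) == k.+1].
      apply: (@le_trans _ _ 2).
        have /andP[a1 a2] := ramp_itv (sg - j%:R); have /andP[a3 a4] := ramp_itv (0 - j%:R).
        by rewrite ler_norml; case: (j < k)%N => /=; apply/andP; split; lra.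
      have p0 (e : bool) : 0 <= e%:R :> R by exact: ler0n.
      have := p0 ((j : nat) == 0%N); have := p0 ((j : nat) == k.-1).
      have := p0 ((j : nat) == k); have := p0 ((j : nat) == k.+1).
      by case/or4P: J => ->; rewrite mulr1n; lra.
    rewrite !negb_or => /and4P[j0 j1 j2 j3].
    have jpos : (1 <= j)%N by rewrite lt0n.
    have -> : ramp (0 - j%:R) = 0.
      by apply: ramp_eq0; rewrite sub0r lerN2 ler1n.
    have [jk|kj] := ltnP j k.
      have jk2 : (j.+2 <= k)%N.
        rewrite ltn_neqAle jk andbT; apply: contra j1 => /eqP <-.
        by rewrite /=.
      have -> : ramp (sg - j%:R) = 1.
        apply: ramp_eq1; have : j.+2%:R <= k%:R :> R by rewrite ler_nat.
        by rewrite -!natr1; lra.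
      by rewrite subr0 subrr normr0 mulr_ge0 // !addr_ge0.
    have kj2 : (k.+2 <= j)%N.
      by rewrite ltn_neqAle eq_sym j3 ltn_neqAle eq_sym j2.
    have -> : ramp (sg - j%:R) = 0.
      apply: ramp_eq0; have : k.+2%:R <= j%:R :> R by rewrite ler_nat.
      by rewrite -!natr1; lra.
    by rewrite !subrr normr0 mulr_ge0 // !addr_ge0.
  rewrite normrM [X in _ <= X]mulrA; apply: ler_pM => //.
  exact: hq.
rewrite -mulr_suml !big_split /=.
have := sum_indicator M 0; have := sum_indicator M k.-1; have := sum_indicator M k.
have := sum_indicator M k.+1.
set s1 := \sum_(_ < _) _; set s2 := \sum_(_ < _) _; set s3 := \sum_(_ < _) _; set s4 := \sum_(_ < _) _.
move=> h1 h2 h3 h4; rewrite (_ : 8 * dl = 4 * (2 * dl)); last by ring.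
by rewrite ler_wpM2r ?mulr_ge0 //; lra.
Qed.

End TimeInterpolation.

(** * Bounds uniform over the coordinates and over time *)

Section FiniteChoice.
Context {R : realType} {d : nat}.
Local Notation E := 'rV[R]_d.

(** A sum dominates each of its positive terms, and monotonicity of [P] does the rest; the summand 1
    keeps the constant positive when the index type is empty. *)
Lemma fin_bound (I : finType) (P : I -> R -> Prop) :
  (forall i, exists2 C, 0 < C & P i C) -> (forall i C C', C <= C' -> P i C -> P i C') ->
  exists2 C, 0 < C & forall i, P i C.
Proof.
move=> H mono.
have /choice[f hf] : forall i, exists c, 0 < c /\ P i c.
  move=> i; by have [C C0 PC] := H i; exists C.
exists (1 + \sum_i f i).
  by rewrite ltr_pwDl // sumr_ge0 // => i _; exact: ltW (hf i).1.
move=> i; apply: mono (hf i).2; rewrite (bigD1 i) //= addrCA lerDl addr_ge0 //.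
by rewrite sumr_ge0 // => j _; exact: ltW (hf j).1.
Qed.

Lemma curve_Bk (a b : R) k (f : R -> E -> R) : a <= b ->
  (forall s, s \in `[a, b] -> periodic (f s)) -> CtCk a b k f ->
  exists2 C : R, 0 < C & forall s, s \in `[a, b] -> Bk C k (f s).
Proof.
move=> ab; elim: k f => [|k IH] f pf Hf.
  have [C C0 hC] := curve_bounded ab pf Hf; exists C => // s sab.
  by split => //; split; [exact: CtCk_slice_cont Hf sab | move=> x; exact: hC].
have [C C0 hC] := curve_bounded ab pf Hf.
have [C' C'0 hC'] : exists2 C' : R, 0 < C' & forall i : 'I_d,
    forall s, s \in `[a, b] -> Bk C' k (partial i (f s)).
  apply: fin_bound => [i|i B B' BB h s sab]; last exact: Bk_weak BB (h s sab).
  apply: IH (CtCk_partial i Hf) => s sab; exact: partial_periodic (pf s sab).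
exists (C + C'); first exact: addr_gt0.
move=> s sab; split.
  split; first exact: CtCk_slice_cont Hf sab.
  by move=> x; apply: le_trans (hC s x sab) _; rewrite lerDl ltW.
move=> i; split; first by move=> x; exact: CtCk_derivable Hf sab.
by apply: Bk_weak (hC' i s sab); rewrite lerDr ltW.
Qed.

Lemma field_Bk k (w : E -> R) : periodic w -> Ck k w -> exists2 C : R, 0 < C & Bk C k w.
Proof.
move=> pw /(Ck_CtCk 0 0) hw.
have [C C0 h] := curve_Bk (lexx 0) (fun _ _ => pw) hw.
by exists C => //; apply: (h 0); exact: itv00.
Qed.

Lemma clamp_lipschitz (a b s r : R) : s \in `[a, b] -> `|clamp a b r - s| <= `|r - s|.
Proof.
rewrite in_itv /= => /andP[h1 h2]; rewrite /clamp.
have [rb|rb] := leP b r.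
  rewrite max_r; last exact: le_trans h1 h2.
  by rewrite !ger0_norm ?subr_ge0 ?(le_trans h2) // lerB.
have [ra|ra] := leP a r; first by [].
by rewrite distrC [X in _ <= X]distrC !ger0_norm ?subr_ge0 ?(le_trans (ltW ra)) // lerB // ltW.
Qed.

End FiniteChoice.

(** * Exponential bounds on powers, derivatives of finite sums *)

Section Powers.
Context {R : realType}.

Lemma pow_le_expR (c tau L : R) (k : nat) : 0 <= c -> 0 <= tau -> k%:R * tau <= L ->
  (1 + c * tau) ^+ k <= expR (c * L).
Proof.
move=> c0 t0 kL; apply: (@le_trans _ _ (expR (c * tau) ^+ k)).
  rewrite lerXn2r ?nnegrE ?expR_ge0 ?addr_ge0 ?mulr_ge0 //; exact: expR_ge1Dx.
by rewrite -expRM_natl ler_expR mulrCA ler_wpM2l.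
Qed.

(** With [x = c * tau] at most one half, [(1 - x) * (1 + 2 * x)] is at least 1, and [1 + 2 * x] is
    at most [expR (2 * x)]; the factor 2 in the exponent is the price of a lower bound. *)
Lemma pow_ge_expR (c tau L : R) (k : nat) : 0 <= c -> 0 <= tau -> c * tau <= 2^-1 ->
  k%:R * tau <= L -> expR (- (2 * c * L)) <= (1 - c * tau) ^+ k.
Proof.
move=> c0 t0 ct kL; apply: (@le_trans _ _ (expR (- (2 * (c * tau))) ^+ k)).
  rewrite -expRM_natl ler_expR mulrN lerN2.
  rewrite (_ : k%:R * (2 * (c * tau)) = 2 * c * (k%:R * tau)); last by ring.
  by rewrite ler_wpM2l // mulr_ge0.
have ct0 : 0 <= c * tau by rewrite mulr_ge0.
rewrite lerXn2r ?nnegrE ?expR_ge0 //; first by rewrite subr_ge0; lra.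
have h := expR_ge1Dx (2 * (c * tau)).
have e0 := expR_gt0 (2 * (c * tau)).
rewrite expRN -[leLHS]mul1r ler_pdivrMr //; nra.
Qed.

Lemma le_sum6 (x1 x2 x3 x4 x5 x6 : R) (y := x1 + x2 + x3 + x4 + x5 + x6) : 0 <= x1 -> 0 <= x2 ->
    0 <= x3 -> 0 <= x4 -> 0 <= x5 -> 0 <= x6 ->
    [/\ x1 <= y, x2 <= y & x3 <= y] /\ [/\ x4 <= y, x5 <= y & x6 <= y].
Proof. by move=> *; rewrite /y; do 2 split; lra. Qed.

Lemma deriv_on_cst (a b c s : R) : deriv_on a b (fun=> c) s 0.
Proof.
apply/deriv_onP => e e0; exists 1 => // r _ _ _.
by rewrite subrr mul0r subr0 normr0.
Qed.

Lemma deriv_on_sum (I : Type) (r : seq I) (a b s : R) (F : I -> R -> R) (l : I -> R) :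
  (forall i, deriv_on a b (F i) s (l i)) ->
  deriv_on a b (fun u => \sum_(i <- r) F i u) s (\sum_(i <- r) l i).
Proof.
move=> h; elim: r => [|i r IH].
  by under eq_fun do rewrite big_nil; rewrite big_nil; exact: deriv_on_cst.
by under eq_fun do rewrite big_cons; rewrite big_cons; exact: deriv_onD.
Qed.

End Powers.

(** * Approximate solutions of the Fokker-Planck equation *)

Section Approximation.
Context {R : realType} {d : nat}.
Local Notation E := 'rV[R]_d.

Fixpoint scheme (tau h Dh : R) (bk : nat -> 'I_d -> E -> R) (p0 : E -> R) (k : nat) : E -> R :=
  if k is k'.+1 then euler tau h Dh (bk k') (scheme tau h Dh bk p0 k') else p0.

#[local] Opaque Ck Bk CtCk.

(** * From the scheme to a curve in continuous time, for fixed parameters *)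

Section Core.
Variables (a T D tau h Dh C C1 N0 m0 e1 L : R) (n : nat).
Variables (b : 'I_d -> R -> E -> R) (bk : nat -> 'I_d -> E -> R) (p0 : E -> R).
Hypotheses (aT : a < T) (D0 : 0 <= D) (tau0 : 0 < tau) (ntau : n%:R * tau = T - a).
Hypothesis hL : T - a + tau <= L.
Hypotheses (h0 : 0 < h) (Dh0 : 0 <= Dh).
Hypotheses (stab : 2 * d%:R * tau * Dh <= h ^+ 2) (cfl : C * h <= 2 * Dh).
Hypotheses (C0 : 0 <= C) (C10 : 0 <= C1).
Hypotheses (Hbk : forall k i, Bk C 3 (bk k i)) (Hbk1 : forall k i, Bk C1 1 (bk k i)).
Hypothesis pbk : forall k i, periodic (bk k i).
Hypotheses (pp0 : periodic p0) (Hp0 : Bk N0 2 p0) (m00 : 0 <= m0) (p0m : forall x, m0 <= p0 x).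
Hypothesis C1tau : d%:R * C1 * tau <= 2^-1.
Hypothesis bC1 : forall i s x, s \in `[a, T] -> `|b i s x| <= C1.
Hypothesis bke : forall k i s x, s \in `[a, T] -> `|a + k%:R * tau - s| < tau ->
  `|bk k i x - b i s x| <= e1.

Let q := scheme tau h Dh bk p0.
(** [N] bounds the iterates in C^2 and deteriorates with the mollification; the sup bound [NN] and
    the lower bound [mm] involve only [C1]. [G] bounds increments per unit of time. *)
Let N : R := N0 * expR (7 * d%:R * C * L).
Let NN : R := N0 * expR (d%:R * C1 * L).
Let mm : R := m0 * expR (- (2 * (d%:R * C1) * L)).
Let G : R := d%:R * (Dh * (4 * N / h ^+ 2) + 2 * (C * N / h)).

Let N00 : 0 <= N0. Proof. exact: le_trans (normr_ge0 _) (Bk_le Hp0 0). Qed.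

(** One node beyond [T] is included, because the ramp centred at node [n] already uses [q n.+1];
    hence the extra [tau] in [hL]. *)
Let kL k : (k <= n.+1)%N -> k%:R * tau <= L.
Proof.
move=> kn; have : k%:R <= n%:R + 1 :> R by rewrite natr1 ler_nat.
move=> /(ler_wpM2r (ltW tau0)); by rewrite mulrDl mul1r ntau => h1; exact: le_trans h1 hL.
Qed.

Let q_Bk k : (k <= n.+1)%N -> Bk N 2 (q k).
Proof.
move=> kn; apply: (@Bk_weak _ _ (N0 * (1 + 7 * d%:R * C * tau) ^+ k)).
  rewrite /N ler_wpM2l //; apply: pow_le_expR; [|exact: ltW|exact: kL].
  by rewrite !mulr_ge0.
elim: k {kn} => [|k IH]; first by rewrite expr0 mulr1.
rewrite exprS mulrCA; by apply: euler_Bk => //; exact: Hbk.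
Qed.

Let bk1 k i : Ck 1 (bk k i). Proof. exact: Bk_Ck (Hbk1 k i). Qed.

Let q_le k x : (k <= n.+1)%N -> `|q k x| <= NN.
Proof.
move=> kn; apply: (@le_trans _ _ (N0 * (1 + d%:R * C1 * tau) ^+ k)); last first.
  rewrite /NN ler_wpM2l //; apply: pow_le_expR; [|exact: ltW|exact: kL].
  by rewrite mulr_ge0.
elim: k x {kn} => [|k IH] x; first by rewrite expr0 mulr1; exact: Bk_le Hp0 x.
rewrite exprS mulrCA; apply: (euler_le (B := C)) => //.
- by move=> i y; exact: Bk_le (Hbk k i) y.
- by move=> i y; exact: Bk_le (Bk_partial i (Hbk1 k i)) y.
Qed.

Let q_ge k x : (k <= n.+1)%N -> mm <= q k x.
Proof.
move=> kn; have dC : 0 <= d%:R * C1 by rewrite mulr_ge0.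
have d1 : 0 <= 1 - d%:R * C1 * tau by rewrite subr_ge0 (le_trans C1tau) // invf_le1 // ler1n.
apply: (@le_trans _ _ (m0 * (1 - d%:R * C1 * tau) ^+ k)).
  rewrite /mm ler_wpM2l //; apply: pow_ge_expR => //; [exact: ltW|exact: kL].
elim: k x {kn} => [|k IH] x; first by rewrite expr0 mulr1.
rewrite exprS mulrCA; apply: (euler_ge (B := C)) => //.
- by move=> i y; exact: Bk_le (Hbk k i) y.
- by move=> i y; exact: Bk_le (Bk_partial i (Hbk1 k i)) y.
- by rewrite mulr_ge0 // exprn_ge0.
Qed.

Let q_periodic k : periodic (q k).
Proof. by elim: k => [|k IH] //; apply: euler_periodic. Qed.

Let q_Ck k : Ck 2 (q k).
Proof.
elim: k => [|k IH]; first exact: Bk_Ck Hp0.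
exact: (euler_Ck tau h Dh (fun i => Ck_pred (Bk_Ck (Hbk k i))) IH).
Qed.

Let q_step k x : (k <= n)%N -> `|q k.+1 x - q k x| <= tau * G.
Proof.
by move=> kn; exact: (euler_step tau0 h0 Dh0 (Hbk k) (q_Bk (leqW kn))).1.
Qed.

Let q_step' k j x : (k <= n)%N -> `|partial j (q k.+1) x - partial j (q k) x| <= tau * G.
Proof.
by move=> kn; exact: (euler_step tau0 h0 Dh0 (Hbk k) (q_Bk (leqW kn))).2.
Qed.

Let G0 : 0 <= tau * G.
Proof.
have N_0 : 0 <= N by rewrite /N mulr_ge0 // expR_ge0.
rewrite mulr_ge0 ?(ltW tau0) // /G mulr_ge0 // addr_ge0 // mulr_ge0 //.
  by apply: divr_ge0; [exact: mulr_ge0 | exact: sqr_ge0].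
by apply: divr_ge0; [exact: mulr_ge0 | exact: ltW].
Qed.

Let u (k : nat) (s : R) : R := tau^-1 * (s - (a + k%:R * tau)).

Let uE k s : u k s = tau^-1 * (s - a) - k%:R.
Proof. by rewrite /u; field; rewrite gt_eqF. Qed.

Let cu k : continuous (u k).
Proof.
apply: continuous_mul; first exact: continuous_const.
apply: continuous_sub; last exact: continuous_const.
by move=> s; exact: cvg_id.
Qed.

(** The ramp of node 0 is half way up at time [a]; subtracting the values at [a] makes the curve
    start exactly at [p0]. *)
Let pint (s : R) (x : E) : R :=
  q 0%N x + \sum_(k < n.+1) (ramp (u k s) - ramp (u k a)) * (q k.+1 x - q k x).

Let Jint (i : 'I_d) (s : R) (x : E) : R :=
  \sum_(k < n.+1) hat (u k s) * flux h Dh (bk k) i (q k) x.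

Let pdot (s : R) (x : E) : R :=
  \sum_(k < n.+1) hat (u k s) * tau^-1 * (q k.+1 x - q k x).

Let flux_C1 k i : Ck 1 (flux h Dh (bk k) i (q k)).
Proof. by apply: flux_Ck => //; exact: Ck_pred (q_Ck k). Qed.

Let c_hat k : continuous (fun s => hat (u k s)).
Proof.
by move=> s; apply: (@continuous_comp _ _ _ (u k) hat); [exact: cu | exact: continuous_hat].
Qed.

Let c_ramp k : continuous (fun s => ramp (u k s)).
Proof.
move=> s; apply: (@continuous_comp _ _ _ (u k) ramp); first exact: cu.
exact: (@is_derive_continuous _ ramp hat is_derive_ramp).
Qed.

Let pint_CtCk : CtCk a T 2 pint.
Proof.
apply: CtCkD; first exact: (Ck_CtCk a T (q_Ck 0)).
apply: (@CtCk_sum _ _ _ _ a T 2 (fun (k : 'I_n.+1) s x =>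
  (ramp (u k s) - ramp (u k a)) * (q k.+1 x - q k x))) => k.
apply: (@CtCkM _ _ a T 2 (fun s _ => ramp (u k s) - ramp (u k a)) (fun _ x => q k.+1 x - q k x)).
  apply: CtCk_time; apply: continuous_subspaceT; apply: continuous_sub => //.
  exact: continuous_const.
by apply: Ck_CtCk; apply: CkB.
Qed.

Let Jint_CtCk i : CtCk a T 1 (Jint i).
Proof.
apply: (@CtCk_sum _ _ _ _ a T 1 (fun (k : 'I_n.+1) s x =>
  hat (u k s) * flux h Dh (bk k) i (q k) x)) => k.
apply: (@CtCkM _ _ a T 1 (fun s _ => hat (u k s)) (fun _ x => flux h Dh (bk k) i (q k) x)).
  by apply: CtCk_time; apply: continuous_subspaceT.
exact: Ck_CtCk.
Qed.

Let pdot_CtCk : CtCk a T 0 pdot.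
Proof.
apply: (@CtCk_sum _ _ _ _ a T 0 (fun (k : 'I_n.+1) s x =>
  hat (u k s) * tau^-1 * (q k.+1 x - q k x))) => k.
apply: (@CtCkM _ _ a T 0 (fun s _ => hat (u k s) * tau^-1) (fun _ x => q k.+1 x - q k x)).
  apply: CtCk_time; apply: continuous_subspaceT; apply: continuous_mul => //.
  exact: continuous_const.
by apply: Ck_CtCk; apply: (Ck_le (isT : (0 <= 2)%N)); apply: CkB.
Qed.

Let pint_deriv s x : deriv_on a T (pint ^~ x) s (pdot s x).
Proof.
rewrite -[pdot s x]add0r; apply: (@deriv_onD _ a T (fun=> q 0%N x)).
  exact: deriv_on_cst.
apply: (@deriv_on_sum _ _ _ a T s (fun (k : 'I_n.+1) s => (ramp (u k s) - ramp (u k a)) * (q k.+1 x - q k x))) => k.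
rewrite [_ * (q _ x - _)]mulrC.
rewrite (_ : (fun s => _) = fun s => (q k.+1 x - q k x) * (ramp (u k s) - ramp (u k a))); last first.
  by apply/funext => r; rewrite mulrC.
apply: deriv_onZ; rewrite -[hat _ / _]subr0; apply: deriv_onB; last exact: deriv_on_cst.
apply: is_derive_deriv_on.
exact: (@is_derive1_comp R ramp (u k) s (hat (u k s)) tau^-1 (is_derive_ramp _) (is_derive_affine _ _ _)).
Qed.

(** Ramps differentiate to hats divided by [tau], and each increment is [- tau] times the divergence
    of a flux. The same hats weight [Jint], so interpolation keeps the continuity equation exact. *)
Let pdotE s x : pdot s x = - \sum_i partial i (Jint i s) x.
Proof.
rewrite (eq_bigr (fun i => \sum_(k < n.+1) hat (u k s) * partial i (flux h Dh (bk k) i (q k)) x)); last first.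
  move=> i _; rewrite /Jint partial_bigsum.
    by apply: eq_bigr => k _; rewrite partial_scale //; exact: Ck_derivable (flux_C1 k i).
  by move=> k; apply: derivable_scale; exact: Ck_derivable (flux_C1 k i).
rewrite exchange_big /= -sumrN; apply: eq_bigr => k _.
have h00 : h != 0 by rewrite gt_eqF.
have E1 : q k.+1 x - q k x = - tau * \sum_i partial i (flux h Dh (bk k) i (q k)) x.
  exact: (euler_flux tau Dh x h00 (bk1 k) (Ck_pred (q_Ck k))).
rewrite E1 -mulr_sumr; by field; rewrite gt_eqF.
Qed.

Let node s k : s \in `[a, T] -> `|u k s| < 1 -> `|a + k%:R * tau - s| < tau.
Proof.
move=> _; rewrite /u normrM (gtr0_norm (_ : 0 < tau^-1)) ?invr_gt0 // mulrC.
by rewrite ltr_pdivrMr // mul1r distrC.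
Qed.

Let pint_close s x k : s \in `[a, T] -> (k < n.+1)%N -> `|u k s| < 1 ->
  `|pint s x - q k x| <= 8 * (tau * G).
Proof.
rewrite in_itv /= => /andP[as_ sT] kn; rewrite uE => hk; rewrite /pint.
rewrite (eq_bigr (fun j : 'I_n.+1 => (ramp (tau^-1 * (s - a) - j%:R) - ramp (0 - j%:R)) * (q j.+1 x - q j x))); last first.
  by move=> j _; rewrite !uE subrr mulr0.
apply: (interp_close (q := fun k => q k x)) => //.
- by move=> j; rewrite ltnS; exact: q_step.
- by rewrite mulr_ge0 ?subr_ge0 // invr_ge0 ltW.
Qed.

Let pint_close' s i x k : s \in `[a, T] -> (k < n.+1)%N -> `|u k s| < 1 ->
  `|partial i (pint s) x - partial i (q k) x| <= 8 * (tau * G).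
Proof.
rewrite in_itv /= => /andP[as_ sT] kn; rewrite uE => hk; rewrite /pint.
have dq j : derivable (q j) x (basis i) by exact: Ck_derivable (q_Ck j).
have dj (j : nat) : derivable (fun x => q j.+1 x - q j x) x (basis i) by exact: derivable_sub.
rewrite partial_add //; last by apply: derivable_bigsum => j; exact: (@derivable_scale R d _ _ x i (dj j)).
rewrite partial_bigsum; last by move=> j; exact: (@derivable_scale R d _ _ x i (dj j)).
rewrite (eq_bigr (fun j : 'I_n.+1 => (ramp (tau^-1 * (s - a) - j%:R) - ramp (0 - j%:R)) * (partial i (q j.+1) x - partial i (q j) x))); last first.
  by move=> j _; rewrite !uE subrr mulr0 (partial_scale _ (dj j)) (partial_sub (dq j.+1) (dq j)).
apply: (interp_close (q := fun k => partial i (q k) x)) => //.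
- by move=> j; rewrite ltnS; exact: q_step'.
- by rewrite mulr_ge0 ?subr_ge0 // invr_ge0 ltW.
Qed.

Let hat_sum s : s \in `[a, T] -> \sum_(k < n.+1) hat (u k s) = 1.
Proof.
rewrite in_itv /= => /andP[as_ sT].
rewrite (eq_bigr (fun k : 'I_n.+1 => hat (tau^-1 * (s - a) - k%:R))); last by move=> k _; rewrite uE.
apply: sum_hat; rewrite mulr_ge0 ?subr_ge0 ?invr_ge0 ?(ltW tau0) //=.
by rewrite mulrC ler_pdivrMr // ntau lerB.
Qed.

(** The hats are nonnegative weights of sum 1, and only nodes within one time step of [s] have a
    nonzero weight; estimates at those nodes pass to the average. *)
Let average_close s (v : nat -> R) (w e : R) : s \in `[a, T] ->
  (forall k, (k < n.+1)%N -> `|u k s| < 1 -> `|v k - w| <= e) ->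
  `|\sum_(k < n.+1) hat (u k s) * v k - w| <= e.
Proof.
move=> sab hv; rewrite -[X in _ - X]mul1r -(hat_sum sab) mulr_suml -sumrB.
apply: (le_trans (ler_norm_sum _ _ _)).
rewrite -[X in _ <= X]mul1r -(hat_sum sab) mulr_suml; apply: ler_sum => k _.
rewrite -mulrBr normrM (ger0_norm (hat_ge0 _)).
have [h1|h1] := leP 1 `|u k s|; first by rewrite hat_eq0 // !mul0r.
by rewrite ler_wpM2l ?hat_ge0 // hv.
Qed.

Lemma approx_core : exists (p : R -> E -> R) (J : 'I_d -> R -> E -> R),
  [/\ scalar_curve a T p,
      (forall i s, s \in `[a, T] -> periodic (J i s)) /\ (forall i, CtCk a T 1 (J i)),
      (forall s, s \in `[a, T] -> forall x,
         deriv_on a T (p ^~ x) s (- \sum_i partial i (J i s) x)),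
      (forall x, p a x = p0 x) /\
      (forall s x, s \in `[a, T] -> mm - 8 * (tau * G) <= p s x) &
      forall i s x, s \in `[a, T] ->
        `|J i s x - (b i s x * p s x - D * partial i (p s) x)| <=
        (2 * C * h + 2 * Dh * h + `|Dh - D|) * N + (e1 * NN + C1 * (8 * (tau * G)))
        + D * (8 * (tau * G))].
Proof.
exists pint, Jint; split.
- split=> [s _ x i||]; last 2 first.
  + exact: pint_CtCk.
  + by exists pdot.
  rewrite /pint q_periodic; congr (_ + _); apply: eq_bigr => k _.
  by rewrite !q_periodic.
- split=> // i s _ x j; apply: eq_bigr => k _; congr (_ * _).
  by apply: flux_periodic.
- by move=> s _ x; rewrite -pdotE.
- split=> [x|s x sab].
    by rewrite /pint big1 ?addr0 // => k _; rewrite subrr mul0r.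
  (* The hat average of the iterates is a convex combination and inherits their lower bound; the
     ramp interpolant differs from it by at most this amount. *)
  have : `|\sum_(k < n.+1) hat (u k s) * q k x - pint s x| <= 8 * (tau * G).
    apply: (@average_close s (fun k => q k x)) => // k kn hk; rewrite distrC; exact: pint_close.
  rewrite ler_norml => /andP[_].
  have : mm <= \sum_(k < n.+1) hat (u k s) * q k x.
    rewrite -[X in X <= _]mul1r -(hat_sum sab) mulr_suml; apply: ler_sum => k _.
    by rewrite ler_wpM2l ?hat_ge0 // q_ge // ltnW.
  by lra.
move=> i s x sab; apply: (@average_close s (fun k => flux h Dh (bk k) i (q k) x)) => // k kn hk.
have f1 := flux_close h0 Dh0 (Hbk k) D i x (q_Bk (ltnW kn)).
have f2 := pint_close x sab kn hk; have f3 := pint_close' i x sab kn hk.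
have f4 := bke i x sab (node sab hk); have f5 := q_le x (ltnW kn).
have f6 := bC1 i x sab.
(* The error splits into consistency of the flux at the node, replacement of [bk k] by [b] and of
   [q k] by the interpolant in the drift term, and replacement of the gradient in the diffusion
   term. *)
rewrite (_ : _ - _ = (flux h Dh (bk k) i (q k) x - (bk k i x * q k x - D * partial i (q k) x)) +
  ((bk k i x - b i s x) * q k x - b i s x * (pint s x - q k x)) +
  D * (partial i (pint s) x - partial i (q k) x)); last by ring.
apply: (le_trans (ler_normD _ _)); rewrite lerD //; last by rewrite normrM (ger0_norm D0) ler_wpM2l.
apply: (le_trans (ler_normD _ _)); rewrite lerD //.
by apply: (le_trans (ler_normB _ _)); rewrite lerD // normM_le.
Qed.

End Core.

(** The order of quantifiers is the point: [m] and [K] are fixed before [e], since they see the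
    drift only through its C^1 bound. Dividing a flux error of size [K * e] by a density above [m]
    is then harmless. *)
Lemma fp_approx (a T D : R) (b : 'I_d -> R -> E -> R) (p0 : E -> R) :
  a < T -> 0 <= D -> (forall i s, s \in `[a, T] -> periodic (b i s)) ->
  (forall i, CtCk a T 1 (b i)) -> periodic p0 -> Ck 2 p0 -> (forall x, 0 < p0 x) ->
  exists m K : R, [/\ 0 < m, 0 <= K & forall e : R, 0 < e ->
    exists (p : R -> E -> R) (J : 'I_d -> R -> E -> R),
    [/\ scalar_curve a T p,
        (forall i s, s \in `[a, T] -> periodic (J i s)) /\ (forall i, CtCk a T 1 (J i)),
        (forall s, s \in `[a, T] -> forall x,
           deriv_on a T (p ^~ x) s (- \sum_i partial i (J i s) x)),
        (forall x, p a x = p0 x) /\ (forall s x, s \in `[a, T] -> m <= p s x) &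
        forall i s x, s \in `[a, T] ->
          `|J i s x - (b i s x * p s x - D * partial i (p s) x)| <= K * e]].
Proof.
move=> aT D0 pb Hb pp0 Hp0 p0pos.
have aT' := ltW aT; pose l := T - a; have l0 : 0 < l by rewrite subr_gt0.
have [C1 C10 HC1] : exists2 C1 : R, 0 < C1 & forall i : 'I_d, forall s, s \in `[a, T] -> Bk C1 1 (b i s).
  apply: fin_bound => [i|i B B' BB H s sab]; last exact: Bk_weak BB (H s sab).
  exact: (curve_Bk aT' (pb i) (Hb i)).
have [N0 N00 HN0] := field_Bk pp0 Hp0.
have [m0 m00 Hm0] := field_pos_bound pp0 Hp0 p0pos.
(* Room for the extra step beyond [T], as [tau] will be at most [l]. *)
pose L := 2 * l.
pose NN := N0 * expR (d%:R * C1 * L).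
pose mm := m0 * expR (- (2 * (d%:R * C1) * L)).
have NN0 : 0 <= NN by rewrite mulr_ge0 ?expR_ge0 // ltW.
have mm0 : 0 < mm by rewrite mulr_gt0 // expR_gt0.
have dd : 0 <= d%:R :> R by exact: ler0n.
have dC1 : 0 <= d%:R * C1 by rewrite mulr_ge0 // ltW.
(* Half of [mm] is given up to interpolation in time. In the second constant, 1 pays for the
   consistency of the flux, [2 * NN] for the error on the drift, [C1] for the density in the drift
   term and [D] for the gradient. *)
exists (mm / 2), (1 + 2 * NN + C1 + D); split.
- by rewrite divr_gt0.
- by rewrite !addr_ge0 ?mulr_ge0 // ltW.
move=> e e0.
(* Each mollification moves the drift by at most [d * dl * C1], and two are performed; this width
   keeps their sum below [e]. *)
pose dl := e / (2 * (d%:R * C1) + 1).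
have dl_den : 0 < 2 * (d%:R * C1) + 1 by rewrite ltr_wpDl // mulr_ge0.
have dl0 : 0 < dl by rewrite divr_gt0.
have dle : 2 * (d%:R * (dl * C1)) <= e.
  rewrite (_ : 2 * _ = e * ((2 * (d%:R * C1)) / (2 * (d%:R * C1) + 1))); last first.
    by rewrite /dl; field; rewrite gt_eqF.
  by rewrite ler_piMr ?ltW // ltr_pdivrMr // mul1r ltrDl.
(* Two uses of [smooth_gain], from one derivative to three. *)
pose C := C1 * (1 + 2 / dl) * (1 + 2 / dl).
have C0 : 0 <= C by rewrite /C !mulr_ge0 // ?addr_ge0 ?divr_ge0 // ltW.
pose N := N0 * expR (7 * d%:R * C * L).
have N_0 : 0 <= N by rewrite mulr_ge0 ?expR_ge0 // ltW.
(* With [Dh = D + C * h] the consistency error is [h * (3 * C + 2 * C * h + 2 * D) * N], and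
   [h <= 1] bounds the bracket by [5 * C + 2 * D]. Here [N] depends on [dl] but not on [h]. *)
pose h := Num.min 1 (e / ((5 * C + 2 * D) * N + 1)).
have h_den : 0 < (5 * C + 2 * D) * N + 1 by rewrite ltr_wpDl // mulr_ge0 // addr_ge0 // mulr_ge0.
have h0 : 0 < h by rewrite lt_min ltr01 divr_gt0.
have h1 : h <= 1 by rewrite ge_min lexx.
have he : h * ((5 * C + 2 * D) * N + 1) <= e.
  by rewrite -ler_pdivlMr // ge_min lexx orbT.
(* The extra viscosity keeps the scheme monotone even when [D = 0]. *)
pose Dh := D + C * h.
have Ch : 0 <= C * h by rewrite mulr_ge0 // ltW.
have Dh0 : 0 <= Dh by rewrite addr_ge0.
pose G := d%:R * (Dh * (4 * N / h ^+ 2) + 2 * (C * N / h)).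
have G0 : 0 <= G.
  rewrite /G mulr_ge0 // addr_ge0 // mulr_ge0 //.
    by apply: divr_ge0; [exact: mulr_ge0 | exact: sqr_ge0].
  by apply: divr_ge0; [exact: mulr_ge0 | exact: ltW].
(* The modulus of continuity is stored as its inverse [om]: the condition then weakens as the
   constant grows, as [fin_bound] demands. *)
have [om om0 Hom] : exists2 om : R, 0 < om & forall i : 'I_d, forall r s x,
    r \in `[a, T] -> s \in `[a, T] -> `|r - s| * om < 1 -> `|b i r x - b i s x| < e.
  apply: fin_bound => [i|i B B' BB H r s x rab sab rs].
    have [dt dt0 Hdt] := curve_time_uniform aT' (pb i) (Hb i) e0.
    exists dt^-1; first by rewrite invr_gt0.
    by move=> r s x rab sab; rewrite ltr_pdivrMr // mul1r; exact: Hdt.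
  by apply: H => //; apply: le_lt_trans rs; rewrite ler_wpM2l.
(* [S] adds the reciprocals of all upper bounds wanted for [tau], so the single inequality
   [tau * S < 1] yields the six of them. *)
pose S := 2 * d%:R * Dh / h ^+ 2 + 2 * (d%:R * C1) + om + 8 * G / e + 8 * G / (mm / 2) + l^-1.
have S1 : 0 <= 2 * d%:R * Dh / h ^+ 2 by apply: divr_ge0; [rewrite !mulr_ge0 | exact: sqr_ge0].
have S2 : 0 <= 8 * G / e by apply: divr_ge0; [exact: mulr_ge0 | exact: ltW].
have S3 : 0 <= 8 * G / (mm / 2) by apply: divr_ge0; [exact: mulr_ge0 | apply: divr_ge0 => //; exact: ltW].
have S4 : 0 < l^-1 by rewrite invr_gt0.
have [[R1 R2 R3] [R4 R5 R6]] := le_sum6 S1 (mulr_ge0 (ler0n R 2) dC1) (ltW om0) S2 S3 (ltW S4).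
have S0 : 0 < S by exact: lt_le_trans S4 R6.
pose n := Num.bound (l * S).
have nS : l * S < n%:R.
  by apply: le_lt_trans (archi_boundP _); [exact: lexx | rewrite mulr_ge0 // ltW].
have n0 : 0 < n%:R :> R by apply: le_lt_trans nS; rewrite mulr_ge0 // ltW.
pose tau := l / n%:R.
have tau0 : 0 < tau by rewrite divr_gt0.
have tauS : tau * S < 1 by rewrite /tau mulrAC ltr_pdivrMr // mul1r.
have part A : 0 <= A -> A <= S -> tau * A < 1.
  by move=> A0 AS; apply: le_lt_trans tauS; rewrite ler_wpM2l // ltW.
have P1 : tau * (2 * d%:R * Dh / h ^+ 2) < 1 by exact: (part _ S1 R1).
have P2 : tau * (2 * (d%:R * C1)) < 1 by exact: (part _ (mulr_ge0 (ler0n R 2) dC1) R2).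
have P3 : tau * om < 1 by exact: (part _ (ltW om0) R3).
have P4 : tau * (8 * G / e) < 1 by exact: (part _ S2 R4).
have P5 : tau * (8 * G / (mm / 2)) < 1 by exact: (part _ S3 R5).
have P6 : tau * l^-1 < 1 by exact: (part _ (ltW S4) R6).
have Q4 : 8 * (tau * G) <= e.
  move: P4; rewrite mulrA ltr_pdivrMr // mul1r => /ltW; apply: le_trans.
  by rewrite le_eqVlt; apply/orP; left; apply/eqP; ring.
have Q5 : 8 * (tau * G) <= mm / 2.
  move: P5; rewrite mulrA ltr_pdivrMr ?divr_gt0 // mul1r => /ltW; apply: le_trans.
  by rewrite le_eqVlt; apply/orP; left; apply/eqP; ring.
(* The core is stated for drifts at every index [k], so nodes past [T] reuse the drift at [T]. *)
pose tk (k : nat) := clamp a T (a + k%:R * tau).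
have tkin k : tk k \in `[a, T] by exact: clamp_in.
pose bk (k : nat) (i : 'I_d) := smooth dl (enum 'I_d) (smooth dl (enum 'I_d) (b i (tk k))).
have sz : size (enum 'I_d) = d by rewrite size_enum_ord.
have C1' := ltW C10.
(* The tolerance [2 * e] on the drift consists of [e] for the mollifications and [e] for freezing
   the time at a node. *)
have := @approx_core a T D tau h Dh C C1 N0 m0 (2 * e) L n b bk p0.
case=> //.
- by rewrite /tau mulrC divfK // gt_eqF.
- move: P6; rewrite ltr_pdivrMr // mul1r -/l /L; lra.
- move: P1; rewrite mulrA ltr_pdivrMr ?exprn_gt0 // mul1r => /ltW; apply: le_trans.
  by rewrite le_eqVlt; apply/orP; left; apply/eqP; ring.
- by rewrite /Dh; lra.
- move=> k i; have H1 := smooth_gain C1' dl0 (HC1 i _ (tkin k)).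
  have C11 : 0 <= C1 * (1 + 2 / dl).
    by apply: mulr_ge0 => //; apply: addr_ge0 => //; apply: divr_ge0 => //; exact: ltW.
  exact: (smooth_gain C11 dl0 H1).
- by move=> k i; do 2 apply: smooth_Bk; exact: HC1.
- by move=> k i; do 2 apply: smooth_periodic; exact: pb.
- exact: ltW.
- by move: P2; rewrite mulrA mulrC; lra.
- by move=> i s x sab; exact: Bk_le (HC1 i s sab) x.
- move=> k i s x sab hs.
  have H1 := HC1 i _ (tkin k); have H2 := smooth_Bk dl (enum 'I_d) H1.
  have K1 := smooth_close (enum 'I_d) x (ltW dl0) H1.
  have K2 := smooth_close (enum 'I_d) x (ltW dl0) H2.
  have K3 : `|b i (tk k) x - b i s x| < e.
    apply: Hom => //; apply: le_lt_trans P3; rewrite ler_wpM2r ?(ltW om0) //.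
    exact: le_trans (clamp_lipschitz _ sab) (ltW hs).
  move: K1 K2; rewrite sz /bk; set y1 := smooth _ _ (smooth _ _ _) x; set y2 := smooth _ _ _ x => K1 K2.
  rewrite (_ : y1 - b i s x = (y1 - y2) + (y2 - b i (tk k) x) + (b i (tk k) x - b i s x)); last by ring.
  apply: (le_trans (ler_normD _ _)); have := ler_normD (y1 - y2) (y2 - b i (tk k) x).
  by move: K3 => /ltW; lra.
move=> p [J [HP HJ Hd [Hi Hm] Hc]]; exists p, J; split => //.
  split => // s x sab; apply: le_trans (Hm s x sab).
  by rewrite -/mm -/N -/G; lra.
move=> i s x sab; apply: (le_trans (Hc i s x sab)); rewrite -/NN -/N -/G.
have T1 : (2 * C * h + 2 * Dh * h + `|Dh - D|) * N <= e.
  have DhD : Dh - D = C * h by rewrite /Dh; ring.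
  apply: le_trans he; rewrite DhD (ger0_norm Ch) [X in _ <= X]mulrDr mulr1 /Dh.
  rewrite (_ : (2 * C * h + 2 * (D + C * h) * h + C * h) * N = h * ((3 * C + 2 * (C * h) + 2 * D) * N)); last by ring.
  rewrite -[X in X <= _]addr0 lerD //; last exact: ltW.
  rewrite ler_wpM2l ?(ltW h0) // ler_wpM2r // lerD2r.
  have : C * h <= C by rewrite ler_piMr.
  by lra.
have T2 : C1 * (8 * (tau * G)) <= C1 * e by rewrite ler_wpM2l.
have T3 : D * (8 * (tau * G)) <= D * e by rewrite ler_wpM2l.
rewrite (_ : (1 + 2 * NN + C1 + D) * e = e + (2 * e * NN + C1 * e) + D * e); last by ring.
by rewrite !lerD.
Qed.

End Approximation.

Arguments Ck_der {R d k f} _ i x.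
#[local] Opaque Ck CtCk.

(** * Regularity of composite fields, product rules in space and time *)

Section Curves.
Context {R : realType} {d : nat}.
Local Notation E := 'rV[R]_d.

Lemma comp_grad (f : E -> R) i : comp i (grad f) = partial i f.
Proof. by apply/funext => x; rewrite /comp mxE. Qed.

Lemma comp_scale (p : E -> R) (v : E -> E) i :
  comp i (fun y => p y *: v y) = fun y => p y * comp i v y.
Proof. by apply/funext => x; rewrite /comp mxE. Qed.

Lemma comp_add (u v : E -> E) i : comp i (fun y => u y + v y) = fun y => comp i u y + comp i v y.
Proof. by apply/funext => x; rewrite /comp mxE. Qed.

Lemma CtCk_dot (a b : R) k (u v : R -> E -> E) : (forall i, CtCk a b k (fun s => comp i (u s))) ->
  (forall i, CtCk a b k (fun s => comp i (v s))) -> CtCk a b k (fun s x => dot (u s x) (v s x)).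
Proof.
move=> Hu Hv; apply: (@CtCk_sum _ _ _ _ a b k (fun i s x => comp i (u s) x * comp i (v s) x)) => i.
exact: CtCkM.
Qed.

Lemma CtCk_grad (a b : R) k (f : R -> E -> R) i : CtCk a b k.+1 f ->
  CtCk a b k (fun s => comp i (grad (f s))).
Proof.
by move=> Hf; apply: CtCk_ext (CtCk_partial i Hf) => s _; rewrite comp_grad.
Qed.

Lemma CtCk_lap (a b : R) k (f : R -> E -> R) : CtCk a b k.+2 f -> CtCk a b k (fun s => lap (f s)).
Proof.
move=> Hf; apply: (@CtCk_sum _ _ _ _ a b k (fun i s => partial i (partial i (f s)))) => i.
by do 2 apply: CtCk_partial.
Qed.

Lemma CtCk_comp_add (a b : R) k (u v : R -> E -> E) i :
  CtCk a b k (fun s => comp i (u s)) -> CtCk a b k (fun s => comp i (v s)) ->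
  CtCk a b k (fun s => comp i (fun y => u s y + v s y)).
Proof. by move=> Hu Hv; apply: CtCk_ext (CtCkD Hu Hv) => s _; rewrite comp_add. Qed.

Lemma div_scale (p : E -> R) (v : E -> E) x : Ck 1 p -> (forall i, Ck 1 (comp i v)) ->
  div (fun y => p y *: v y) x = dot (grad p x) (v x) + p x * div v x.
Proof.
move=> Hp Hv; rewrite /div /dot mulr_sumr -big_split /=; apply: eq_bigr => i _.
rewrite comp_scale mxE (partial_mul (Ck_der Hp i x) (Ck_der (Hv i) i x)).
by congr (_ * _ + _); rewrite /comp.
Qed.

Lemma tint_within (a b : R) (f : R -> E -> R) : a <= b -> CtCk a b 0 f ->
  {within `[a, b], continuous (fun s => tint (f s))}.
Proof.
move=> ab Hf; apply: (@subspace_eq_continuous _ _ _ (fun s => tint (f (clamp a b s)))).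
  by move=> s; rewrite inE /= => sab; rewrite /from_subspace /= clampE.
apply: continuous_subspaceT; exact: (tint_continuous (CtCk_clamp ab Hf)).
Qed.

Lemma deriv_onM (a b : R) (f g : R -> R) (s l m : R) : s \in `[a, b] ->
  deriv_on a b f s l -> deriv_on a b g s m ->
  deriv_on a b (fun r => f r * g r) s (l * g s + f s * m).
Proof.
move=> sab hf hg; have cg := deriv_on_continuous hg.
rewrite /deriv_on (_ : (fun r => _) = (fun r => (f r - f s) / (r - s) * g r + f s * ((g r - g s) / (r - s)))).
  apply: cvgD; last by apply: cvgM; [exact: cvg_cst | exact: hg].
  apply: cvgM; first exact: hf.
  apply: cvg_trans cg; apply: cvg_app => A; rewrite /within /=.
  by rewrite nbhs_simpl /dnbhs /within /=; apply: filterS => y hy _.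
by apply/funext => r; ring.
Qed.

Lemma deriv_on_eq (a b : R) (f : R -> R) (s l l' : R) : deriv_on a b f s l -> l = l' ->
  deriv_on a b f s l'.
Proof. by move=> h <-. Qed.

End Curves.

(** * Comparison principles and the cost identity *)

Section FokkerPlanck.
Context {R : realType} {d : nat}.
Local Notation E := 'rV[R]_d.
Variables (D a T : R) (v : R -> E -> E).
Hypotheses (D0 : 0 <= D) (aT : a <= T).
Hypothesis pv : forall s, s \in `[a, T] -> periodic (v s).
Hypothesis Hv : forall i, CtCk a T 1 (fun s => comp i (v s)).

(** Where the gradient vanishes, the divergence reduces to [p * div v]; a bound on [div v] then
    serves as the rate in [max_principle], the diffusion term having the favourable sign. *)
Lemma fp_nonneg (p : R -> E -> R) : (forall s, s \in `[a, T] -> periodic (p s)) -> CtCk a T 2 p ->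
  (forall s, s \in `[a, T] -> forall x,
     deriv_on a T (p ^~ x) s (- div (fun y => p s y *: v s y) x + D * lap (p s) x)) ->
  (forall x, 0 <= p a x) -> forall s, s \in `[a, T] -> forall x, 0 <= p s x.
Proof.
move=> pp Hp dp pa.
have Hdiv : CtCk a T 0 (fun s => div (v s)).
  apply: (@CtCk_sum _ _ _ _ a T 0 (fun i s => partial i (comp i (v s)))) => i.
  exact: (CtCk_partial i (Hv i)).
have pdiv s : s \in `[a, T] -> periodic (div (v s)).
  move=> sab x j; apply: eq_bigr => i _.
  have hp : periodic (comp i (v s)) := @comp_periodic R d _ i (pv sab).
  have hq := @partial_periodic R d i _ hp.
  exact: (hq x j).
have [C C0 hC] := curve_bounded aT pdiv Hdiv.
apply: (max_principle (C := C) aT pp Hp dp pa) => s sab x g0 l0 f0.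
have Hps : Ck 1 (p s) := Ck_pred (CtCk_slice Hp sab).
rewrite (div_scale x Hps) => [|i]; last exact: CtCk_slice (Hv i) sab.
rewrite (_ : dot _ _ = 0); last first.
  by rewrite /dot big1 // => i _; rewrite mxE g0 mul0r.
rewrite add0r; have := hC s x sab; rewrite ler_norml => /andP[h1 _].
have : 0 <= D * lap (p s) x by rewrite mulr_ge0.
have : 0 <= - p s x * (C + div (v s) x) by rewrite mulr_ge0 //; lra.
by rewrite mulNr mulrDr; lra.
Qed.

(** By linearity the difference solves the same equation. The one-sided form is applied twice to
    obtain uniqueness. *)
Lemma fp_unique (p p' : R -> E -> R) : (forall s, s \in `[a, T] -> periodic (p s)) -> CtCk a T 2 p ->
  (forall s, s \in `[a, T] -> periodic (p' s)) -> CtCk a T 2 p' ->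
  (forall s, s \in `[a, T] -> forall x,
     deriv_on a T (p ^~ x) s (- div (fun y => p s y *: v s y) x + D * lap (p s) x)) ->
  (forall s, s \in `[a, T] -> forall x,
     deriv_on a T (p' ^~ x) s (- div (fun y => p' s y *: v s y) x + D * lap (p' s) x)) ->
  (forall x, p' a x <= p a x) -> forall s, s \in `[a, T] -> forall x, p' s x <= p s x.
Proof.
move=> pp Hp pp' Hp' dp dp' pa s sab x; rewrite -subr_ge0.
apply: (@fp_nonneg (fun s x => p s x - p' s x)); last exact: sab.
- by move=> r rab y j; rewrite (pp r rab) (pp' r rab).
- exact: CtCkB.
- move=> r rab y; have := deriv_onB (dp r rab y) (dp' r rab y).
  have Hpr : Ck 2 (p r) := CtCk_slice Hp rab.
  have Hpr' : Ck 2 (p' r) := CtCk_slice Hp' rab.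
  have Hvr i : Ck 1 (comp i (v r)) := CtCk_slice (Hv i) rab.
  have eg i : partial i (fun z => p r z - p' r z) = fun z => partial i (p r) z - partial i (p' r) z.
    by apply/funext => z; rewrite (partial_sub (Ck_der Hpr i z) (Ck_der Hpr' i z)).
  rewrite (div_scale y (Ck_pred Hpr) Hvr) (div_scale y (Ck_pred Hpr') Hvr).
  rewrite (div_scale y (CkB (Ck_pred Hpr) (Ck_pred Hpr')) Hvr).
  rewrite (_ : dot (grad (fun z => p r z - p' r z) y) (v r y) =
     dot (grad (p r) y) (v r y) - dot (grad (p' r) y) (v r y)); last first.
    by rewrite /dot -sumrB; apply: eq_bigr => i _; rewrite !mxE eg mulrBl.
  rewrite (_ : lap (fun z => p r z - p' r z) y = lap (p r) y - lap (p' r) y); last first.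
    rewrite /lap -sumrB; apply: eq_bigr => i _; rewrite eg.
    by rewrite (partial_sub (Ck_der (Ck_partial i Hpr) i y) (Ck_der (Ck_partial i Hpr') i y)).
  move=> H; apply: (deriv_on_eq H).
  move: (dot (grad (p r) y) (v r y)) (dot (grad (p' r) y) (v r y)) (div (v r) y) (lap (p r) y)
    (lap (p' r) y) (p r y) (p' r y) => *; ring.
- by move=> y; rewrite subr_ge0.
Qed.

End FokkerPlanck.

Section HamiltonJacobi.
Context {R : realType} {d : nat}.
Local Notation E := 'rV[R]_d.
Variables (D a T : R) (v : R -> E -> E) (Phi : R -> E -> R).
Hypotheses (D0 : 0 <= D) (aT : a <= T).

Lemma sub_cancel (A x y : R) : 0 <= x - y -> 0 <= - (A - x - (A - y)).
Proof. by lra. Qed.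

(** At a critical point of the difference the two gradients coincide, so the quadratic and transport
    terms cancel and only the diffusion remains; the rate in the maximum principle can be 0. *)
Lemma hjb_compare (f f' : R -> E -> R) : (forall s, s \in `[a, T] -> periodic (f s)) -> CtCk a T 2 f ->
  (forall s, s \in `[a, T] -> periodic (f' s)) -> CtCk a T 2 f' ->
  (forall s, s \in `[a, T] -> forall x, deriv_on a T (f ^~ x) s
     (Phi s x - 2^-1 * dot (grad (f s) x) (grad (f s) x) - dot (v s x) (grad (f s) x) - D * lap (f s) x)) ->
  (forall s, s \in `[a, T] -> forall x, deriv_on a T (f' ^~ x) s
     (Phi s x - 2^-1 * dot (grad (f' s) x) (grad (f' s) x) - dot (v s x) (grad (f' s) x) - D * lap (f' s) x)) ->
  (forall x, f' T x <= f T x) -> forall s, s \in `[a, T] -> forall x, f' s x <= f s x.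
Proof.
move=> pf Hf pf' Hf' df df' fT s sab x; rewrite -subr_ge0.
apply: (@max_principle_backward R d a T 0 (fun s x => f s x - f' s x)
  (fun s x => (Phi s x - 2^-1 * dot (grad (f s) x) (grad (f s) x) - dot (v s x) (grad (f s) x) - D * lap (f s) x)
   - (Phi s x - 2^-1 * dot (grad (f' s) x) (grad (f' s) x) - dot (v s x) (grad (f' s) x) - D * lap (f' s) x))).
- exact: aT.
- by move=> r rab y j; rewrite (pf r rab) (pf' r rab).
- exact: CtCkB.
- by move=> r rab y; apply: deriv_onB; [exact: df | exact: df'].
- by move=> y; rewrite subr_ge0.
- move=> r rab y; have Hfr : Ck 2 (f r) := CtCk_slice Hf rab.
  have Hfr' : Ck 2 (f' r) := CtCk_slice Hf' rab.
  have eg i : partial i (fun z => f r z - f' r z) = fun z => partial i (f r) z - partial i (f' r) z.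
    by apply/funext => z; rewrite (partial_sub (Ck_der Hfr i z) (Ck_der Hfr' i z)).
  have -> : lap (fun z => f r z - f' r z) y = lap (f r) y - lap (f' r) y.
    rewrite /lap -sumrB; apply: eq_bigr => i _; rewrite eg.
    by rewrite (partial_sub (Ck_der (Ck_partial i Hfr) i y) (Ck_der (Ck_partial i Hfr') i y)).
  move=> g0 l0 _.
  have -> : grad (f r) y = grad (f' r) y.
    apply/rowP => i; rewrite !mxE; apply/eqP; rewrite -subr_eq0.
    by have := g0 i; rewrite eg => ->.
  have := mulr_ge0 D0 l0; rewrite mul0r mulrBr; exact: sub_cancel.
- exact: sab.
Qed.

End HamiltonJacobi.

Section CostIdentity.
Context {R : realType} {d : nat}.
Local Notation E := 'rV[R]_d.
Local Notation mu := (@lebesgue_measure R).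
Variables (D a T : R) (v al : R -> E -> E) (Phi phi p : R -> E -> R).
Hypotheses (aT : a < T).
Hypothesis pv : forall s, s \in `[a, T] -> periodic (v s).
Hypothesis pal : forall s, s \in `[a, T] -> periodic (al s).
Hypothesis Hv : forall i, CtCk a T 1 (fun s => comp i (v s)).
Hypothesis Hal : forall i, CtCk a T 1 (fun s => comp i (al s)).
Hypothesis HPhi : CtCk a T 0 Phi.
Hypotheses (pphi : forall s, s \in `[a, T] -> periodic (phi s)) (Hphi : CtCk a T 2 phi).
Hypotheses (pp : forall s, s \in `[a, T] -> periodic (p s)) (Hp : CtCk a T 2 p).
Hypothesis dphi : forall s, s \in `[a, T] -> forall x, deriv_on a T (phi ^~ x) s
  (Phi s x - 2^-1 * dot (grad (phi s) x) (grad (phi s) x) - dot (v s x) (grad (phi s) x) - D * lap (phi s) x).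
Hypothesis dp : forall s, s \in `[a, T] -> forall x,
  deriv_on a T (p ^~ x) s (- div (fun y => p s y *: (v s y + al s y)) x + D * lap (p s) x).

(** Completion of the square, stated on plain reals: [paa], [pag] and [pgg] stand for the products
    among [al] and [grad phi], [dd] for the squared distance, [sW] for a divergence. This and the
    next two identities keep the ring computations away from the analytic terms. *)
Lemma cost_algebra (F dd paa pag pgg pvg q f dv lq lf sW : R) :
  dd = paa - 2 * pag + pgg ->
  sW = - (q * (pvg + pag)) - f * dv + D * (f * lq - q * lf) ->
  (F - 2^-1 * pgg - pvg - D * lf) * q + f * (- dv + D * lq) =
  (2^-1 * paa + F) * q - 2^-1 * (dd * q) + sW.
Proof. by move=> -> ->; field. Qed.

Lemma flux_algebra (f' qc f dqc q' f2 q q2 : R) :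
  - (f' * qc + f * dqc) + D * (f' * q' + f * q2 - (q' * f' + q * f2)) =
  - (f' * qc) - f * dqc + D * (f * q2 - q * f2).
Proof. by ring. Qed.

Lemma sum_algebra (q f : R) (f' v' al' b q2 f2 c : 'I_d -> R) : (forall i, c i = v' i + al' i) ->
  \sum_i (- (f' i * (q * c i)) - f * b i + D * (f * q2 i - q * f2 i)) =
  - (q * (\sum_i v' i * f' i + \sum_i al' i * f' i)) - f * \sum_i b i
  + D * (f * \sum_i q2 i - q * \sum_i f2 i).
Proof.
move=> hc; rewrite big_split /= sumrB sumrN -!mulr_sumr sumrB -!mulr_sumr.
congr (- _ - _ + _); rewrite -big_split mulr_sumr /=.
by apply: eq_bigr => i _; rewrite hc; ring.
Qed.

(* The cost of [al] exceeds the value by half of the time integral of this. *)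
Definition excess (s : R) : R := tint (fun x => dot (al s x - grad (phi s) x) (al s x - grad (phi s) x) * p s x).

Let gphi s x : R :=
  Phi s x - 2^-1 * dot (grad (phi s) x) (grad (phi s) x) - dot (v s x) (grad (phi s) x) - D * lap (phi s) x.
Let gp s x : R := - div (fun y => p s y *: (v s y + al s y)) x + D * lap (p s) x.

(** This field gathers all integrations by parts, of the transport term and of Green's formula for
    the Laplacian: the time derivative of [phi * p] is the running cost minus half the excess
    density plus the divergence of [W], which has zero integral. *)
Let W (s : R) (i : 'I_d) (x : E) : R :=
  - (phi s x * (p s x * comp i (fun y => v s y + al s y) x)) +
  D * (phi s x * partial i (p s) x - p s x * partial i (phi s) x).

Let Hva i : CtCk a T 1 (fun s => comp i (fun y => v s y + al s y)).
Proof. exact: CtCk_comp_add. Qed.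

Let W_Ck s i : s \in `[a, T] -> Ck 1 (W s i).
Proof.
move=> sab; have H1 := Ck_pred (CtCk_slice Hphi sab); have H2 := Ck_pred (CtCk_slice Hp sab).
have H3 := Ck_partial i (CtCk_slice Hp sab); have H4 := Ck_partial i (CtCk_slice Hphi sab).
have H5 := CtCk_slice (Hva i) sab.
exact: (CkD (CkN (CkM H1 (CkM H2 H5))) (Ck_scale D (CkB (CkM H1 H3) (CkM H2 H4)))).
Qed.

Let W_periodic s i : s \in `[a, T] -> periodic (W s i).
Proof.
move=> sab x j; rewrite /W /comp !mxE (pphi sab) (pp sab) (pv sab) (pal sab).
by rewrite (@partial_periodic R d i _ (pp sab)) (@partial_periodic R d i _ (pphi sab)).
Qed.

Let pointwise s x : s \in `[a, T] -> gphi s x * p s x + phi s x * gp s x =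
  (2^-1 * dot (al s x) (al s x) + Phi s x) * p s x
  - 2^-1 * (dot (al s x - grad (phi s) x) (al s x - grad (phi s) x) * p s x)
  + \sum_i partial i (W s i) x.
Proof.
move=> sab; have Hf := CtCk_slice Hphi sab; have Hq := CtCk_slice Hp sab.
have Hf1 := Ck_pred Hf; have Hq1 := Ck_pred Hq.
have Hc i : Ck 1 (comp i (fun y => v s y + al s y)) := CtCk_slice (Hva i) sab.
have EW i : partial i (W s i) x =
   - (partial i (phi s) x * (p s x * comp i (fun y => v s y + al s y) x)) -
   phi s x * partial i (comp i (fun y => p s y *: (v s y + al s y))) x +
   D * (phi s x * partial i (partial i (p s)) x - p s x * partial i (partial i (phi s)) x).
  rewrite comp_scale /W; have K1 := CkM Hq1 (Hc i); have K2 := CkM Hf1 K1.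
  have K3 := CkM Hf1 (Ck_partial i Hq); have K4 := CkM Hq1 (Ck_partial i Hf).
  have K5 := CkB K3 K4.
  rewrite (partial_add (Ck_der (CkN K2) i x) (Ck_der (Ck_scale D K5) i x)).
  rewrite (partial_opp (Ck_der K2 i x)) (partial_mul (Ck_der Hf1 i x) (Ck_der K1 i x)).
  rewrite (partial_scale D (Ck_der K5 i x)) (partial_sub (Ck_der K3 i x) (Ck_der K4 i x)).
  rewrite (partial_mul (Ck_der Hf1 i x) (Ck_der (Ck_partial i Hq) i x)).
  rewrite (partial_mul (Ck_der Hq1 i x) (Ck_der (Ck_partial i Hf) i x)).
  exact: flux_algebra.
have B : \sum_i partial i (W s i) x = - (p s x * (dot (v s x) (grad (phi s) x) + dot (al s x) (grad (phi s) x)))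
    - phi s x * div (fun y => p s y *: (v s y + al s y)) x
    + D * (phi s x * lap (p s) x - p s x * lap (phi s) x).
  rewrite (eq_bigr _ (fun i _ => EW i)).
  rewrite (_ : dot (v s x) (grad (phi s) x) = \sum_i v s x 0 i * partial i (phi s) x); last first.
    by apply: eq_bigr => i _; rewrite mxE.
  rewrite (_ : dot (al s x) (grad (phi s) x) = \sum_i al s x 0 i * partial i (phi s) x); last first.
    by apply: eq_bigr => i _; rewrite mxE.
  apply: (@sum_algebra (p s x) (phi s x) (fun i => partial i (phi s) x) (fun i => v s x 0 i)
    (fun i => al s x 0 i) (fun i => partial i (comp i (fun y => p s y *: (v s y + al s y))) x)
    (fun i => partial i (partial i (p s)) x) (fun i => partial i (partial i (phi s)) x)
    (fun i => comp i (fun y => v s y + al s y) x)) => i.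
  by rewrite /comp mxE.
have A : dot (al s x - grad (phi s) x) (al s x - grad (phi s) x) =
   dot (al s x) (al s x) - 2 * dot (al s x) (grad (phi s) x) + dot (grad (phi s) x) (grad (phi s) x).
  rewrite /dot mulr_sumr -sumrB -big_split /=; apply: eq_bigr => i _.
  by rewrite !mxE; ring.
exact: (cost_algebra (Phi s x) A B).
Qed.

Lemma excess_within : {within `[a, T], continuous excess}.
Proof.
apply: tint_within (ltW aT) _; apply: CtCkM; last exact: CtCk_le Hp.
have H i : CtCk a T 0 (fun s => comp i (fun x => al s x - grad (phi s) x)).
  apply: CtCk_ext (CtCkB (CtCk_le (isT : (0 <= 1)%N) (Hal i))
    (CtCk_le (isT : (0 <= 1)%N) (CtCk_partial i Hphi))) => s _.
  by apply/funext => x; rewrite /comp !mxE.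
exact: CtCk_dot.
Qed.

Lemma cost_identity : tint (fun x => phi T x * p T x) - tint (fun x => phi a x * p a x) =
  \int[mu]_(s in `[a, T]) tint (fun x => (2^-1 * dot (al s x) (al s x) + Phi s x) * p s x)
  - 2^-1 * \int[mu]_(s in `[a, T]) excess s.
Proof.
have H1 : CtCk a T 0 (fun s x => phi s x * p s x).
  by apply: CtCkM; [exact: CtCk_le Hphi | exact: CtCk_le Hp].
have Hal0 i : CtCk a T 0 (fun s => comp i (al s)) by exact: CtCk_le (Hal i).
have Hv0 i : CtCk a T 0 (fun s => comp i (v s)) by exact: CtCk_le (Hv i).
have Hg0 i : CtCk a T 0 (fun s => comp i (grad (phi s))).
  exact: (CtCk_le (isT : (0 <= 1)%N) (CtCk_grad i Hphi)).
have HL : CtCk a T 0 (fun s x => (2^-1 * dot (al s x) (al s x) + Phi s x) * p s x).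
  apply: CtCkM; last exact: CtCk_le Hp.
  apply: CtCkD => //; apply: CtCkM; first exact: CtCk_cst.
  exact: CtCk_dot.
have Hgphi : CtCk a T 0 gphi.
  apply: CtCkB; last by apply: CtCkM; [exact: CtCk_cst | exact: CtCk_lap].
  apply: CtCkB; last exact: CtCk_dot.
  apply: CtCkB => //; apply: CtCkM; first exact: CtCk_cst.
  exact: CtCk_dot.
have Hgp : CtCk a T 0 gp.
  apply: CtCkD; last by apply: CtCkM; [exact: CtCk_cst | exact: CtCk_lap].
  apply: CtCkN; apply: (@CtCk_sum _ _ _ _ a T 0 (fun i s => partial i (comp i (fun y => p s y *: (v s y + al s y))))) => i.
  apply: CtCk_partial; apply: CtCk_ext (CtCkM (CtCk_le (isT : (1 <= 2)%N) Hp) (Hva i)) => s _.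
  by rewrite comp_scale.
have H2 : CtCk a T 0 (fun s x => gphi s x * p s x + phi s x * gp s x).
  by apply: CtCkD; apply: CtCkM => //; [exact: CtCk_le Hp | exact: CtCk_le Hphi].
have dm := tint_deriv_on H1 H2 (fun s sab x => deriv_onM sab (@dphi s sab x) (@dp s sab x)).
rewrite -(deriv_on_FTC aT dm (tint_within (ltW aT) H2)).
have cL := tint_within (ltW aT) HL.
rewrite -(within_intZ _ excess_within) -mulN1r -within_intZ; last first.
  by move=> s; apply: continuous_mul; [exact: continuous_const | exact: excess_within].
rewrite -within_intD //; last first.
  do 2 (apply: (@continuous_mul _ (subspace `[a, T])); first exact: continuous_const).
  exact: excess_within.
apply: eq_Rintegral => s; rewrite inE /= => sab.
under eq_tint => x do rewrite (pointwise x sab).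
have cLs := CtCk_slice_cont HL sab.
have Hex : CtCk a T 0 (fun s x => dot (al s x - grad (phi s) x) (al s x - grad (phi s) x) * p s x).
  apply: CtCkM; last exact: CtCk_le Hp.
  have H i : CtCk a T 0 (fun s => comp i (fun x => al s x - grad (phi s) x)).
    by apply: CtCk_ext (CtCkB (Hal0 i) (Hg0 i)) => r _; apply/funext => x; rewrite /comp !mxE.
  exact: CtCk_dot.
have cex := CtCk_slice_cont Hex sab.
have cW i : continuous (partial i (W s i)) := Ck_cont (Ck_partial i (W_Ck i sab)).
have cW' : continuous (fun x => \sum_i partial i (W s i) x).
  by apply: (@Ck_cont _ _ 0); apply: Ck_sum => i; split.
rewrite tintD //; last first.
  apply: continuous_sub => //; apply: continuous_mul => //; exact: continuous_const.
rewrite tint_bigsum // big1 ?addr0 => [|i _]; last first.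
  by apply: tint_partial; [exact: W_periodic | exact: W_Ck].
rewrite tintB //; last by apply: continuous_mul => //; exact: continuous_const.
by rewrite tintZ // mulN1r.
Qed.

End CostIdentity.

(** * The value function *)

Section Value.
Context {R : realType} {d : nat}.
Local Notation E := 'rV[R]_d.
Local Notation mu := (@lebesgue_measure R).
Variables (D t T : R) (K : (E -> R) -> E -> E) (Ks : (E -> E) -> E -> R).
Variables (F G : (E -> R) -> E -> R) (q0 : E -> R) (q phi : R -> E -> R).
Hypotheses (D0 : 0 <= D) (tT : t < T).
Hypothesis hsol : mfg2_solution D K Ks F G t T q0 q phi.

Local Notation Phi := (fun s => Ftilde Ks F (q s) (phi s)).
Local Notation cost := (mfg1_cost Ks F G T q phi).
Local Notation costs := (mfg1_costs D K Ks F G T q phi).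
Local Notation value := (mfg1_value D K Ks F G T q phi).

Lemma dotC (x y : E) : dot x y = dot y x.
Proof. by apply: eq_bigr => i _; rewrite mulrC. Qed.

Lemma hjb_algebra (f a b k l : R) : f - a - b - k - l = f - k - a - b - l.
Proof. by ring. Qed.

Lemma mfg2_hjb' s : s \in `[t, T] -> forall x, deriv_on t T (phi ^~ x) s
  (Phi s x - 2^-1 * dot (grad (phi s) x) (grad (phi s) x) - dot (K (q s) x) (grad (phi s) x)
   - D * lap (phi s) x).
Proof.
move=> st x; have H := mfg2_hjb hsol st.
apply: (deriv_on_eq (H x)).
by rewrite (dotC (grad (phi s) x) (K (q s) x)) /Ftilde; exact: hjb_algebra.
Qed.

Lemma Phi_algebra (f a b l g : R) : g = f - a - b - l -> g + a + b + l = f.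
Proof. by move=> ->; ring. Qed.

Let pq s : s \in `[t, T] -> periodic (q s). Proof. by case: (mfg2_q hsol) => h _ _; exact: h. Qed.
Let Hq : CtCk t T 2 q. Proof. by case: (mfg2_q hsol). Qed.
Let pphi s : s \in `[t, T] -> periodic (phi s). Proof. by case: (mfg2_phi hsol) => h _ _; exact: h. Qed.
Let Hphi : CtCk t T 2 phi. Proof. by case: (mfg2_phi hsol). Qed.
Let pK s : s \in `[t, T] -> periodic (K (q s)). Proof. exact: (mfg2_vel hsol).1. Qed.
Let HK i : CtCk t T 1 (fun s => comp i (K (q s))). Proof. exact: (mfg2_vel hsol).2. Qed.
Let HK0 i : CtCk t T 0 (fun s => comp i (K (q s))). Proof. exact: CtCk_le (HK i). Qed.
Let Hg0 i : CtCk t T 0 (fun s => comp i (grad (phi s))).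
Proof. exact: (CtCk_le (isT : (0 <= 1)%N) (CtCk_grad i Hphi)). Qed.

(** Continuity in time of [F (q s)] is not among the assumptions. It is recovered from the
    Hamilton-Jacobi equation: the time derivative of [phi] is continuous, is unique because [t < T],
    and every other term of the equation is continuous. *)
Lemma Phi_CtCk : CtCk t T 0 Phi.
Proof.
have [_ _ [g Hg dg]] := mfg2_phi hsol.
have H : CtCk t T 0 (fun s x => g s x + 2^-1 * dot (grad (phi s) x) (grad (phi s) x)
    + dot (K (q s) x) (grad (phi s) x) + D * lap (phi s) x).
  apply: CtCkD; last by apply: CtCkM; [exact: CtCk_cst | exact: CtCk_lap].
  apply: CtCkD; last exact: CtCk_dot.
  by apply: CtCkD => //; apply: CtCkM; [exact: CtCk_cst | exact: CtCk_dot].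
apply: CtCk_ext H => s st; apply/funext => x.
exact: (Phi_algebra (deriv_on_unique tT st (dg s st x) (@mfg2_hjb' s st x))).
Qed.

Lemma phi_dot s : s \in `[t, T] -> continuous (phi s).
Proof. by move=> st; exact: CtCk_slice_cont Hphi st. Qed.

Lemma final_pairing (w : E -> R) : continuous w ->
  tint (fun x => G (q T) x * w x) = - tint (fun x => phi T x * w x).
Proof.
move=> cw; have Tt : T \in `[t, T] by rewrite in_itv /= lexx ltW.
rewrite -tintN; last by apply: continuous_mul => //; exact: phi_dot.
by apply: eq_tint => x; rewrite (mfg2_final hsol) mulNr opprK.
Qed.

Section Start.
Variables (s0 : R) (p0 : E -> R).
Hypothesis s0t : s0 \in `[t, T].

Let ts0 : t <= s0. Proof. by move: s0t; rewrite in_itv /= => /andP[]. Qed.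
Let s0T : s0 <= T. Proof. by move: s0t; rewrite in_itv /= => /andP[]. Qed.
Let sub s : s \in `[s0, T] -> s \in `[t, T].
Proof. by rewrite !in_itv /= => /andP[h ->]; rewrite (le_trans ts0 h). Qed.

Lemma admissible_cost p al : s0 < T -> mfg1_admissible D K T q s0 p0 p al ->
  cost s0 p al = - tint (fun x => phi s0 x * p0 x)
  + 2^-1 * \int[mu]_(s in `[s0, T]) excess al phi p s.
Proof.
move=> lt [[pp Hp _] [pal Hal] fp init].
have TT : T \in `[s0, T] by rewrite in_itv /= lexx s0T.
have := @cost_identity R d D s0 T (fun s => K (q s)) al Phi phi p lt (fun s ss => pK (sub ss)) pal
  (fun i => CtCk_sub ts0 (lexx T) (HK i)) Hal (CtCk_sub ts0 (lexx T) Phi_CtCk)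
  (fun s ss => pphi (sub ss)) (CtCk_sub ts0 (lexx T) Hphi) pp Hp
  (fun s ss x => deriv_on_sub ts0 (lexx T) (@mfg2_hjb' s (sub ss) x)) fp.
rewrite /mfg1_cost final_pairing; last exact: CtCk_slice_cont Hp TT.
rewrite (_ : tint (fun x => phi s0 x * p s0 x) = tint (fun x => phi s0 x * p0 x)); last first.
  by apply: eq_tint => x; rewrite init.
move: (tint _) (tint _) (Rintegral _ _ _) (Rintegral _ _ _) => A1 A2 A3 A4; lra.
Qed.

Lemma admissible_nonneg p al : mfg1_admissible D K T q s0 p0 p al -> (forall x, 0 <= p0 x) ->
  forall s, s \in `[s0, T] -> forall x, 0 <= p s x.
Proof.
move=> [[pp Hp _] [pal Hal] fp init] p00.
apply: (@fp_nonneg R d D s0 T (fun s y => K (q s) y + al s y) D0 s0T _ _ p pp Hp fp).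
- by move=> s ss x j; rewrite (pK (sub ss)) (pal s ss).
- by move=> i; apply: CtCk_comp_add (CtCk_sub ts0 (lexx T) (HK i)) (Hal i).
- by move=> x; rewrite init.
Qed.

Lemma cost_lower p al : s0 < T -> mfg1_admissible D K T q s0 p0 p al -> (forall x, 0 <= p0 x) ->
  - tint (fun x => phi s0 x * p0 x) <= cost s0 p al.
Proof.
move=> lt adm p00; rewrite (admissible_cost lt adm) lerDl mulr_ge0 //.
apply: Rintegral_ge0 => s /= ss; rewrite /excess -[X in X <= _](@tint_cst R d 0).
have [[pp Hp _] [pal Hal] fp init] := adm.
have Hal0 i : CtCk s0 T 0 (fun s => comp i (al s)) by exact: CtCk_le (Hal i).
have Hex : CtCk s0 T 0 (fun s x => dot (al s x - grad (phi s) x) (al s x - grad (phi s) x) * p s x).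
  apply: CtCkM; last exact: CtCk_le Hp.
  have H i : CtCk s0 T 0 (fun s => comp i (fun x => al s x - grad (phi s) x)).
    by apply: CtCk_ext (CtCkB (Hal0 i) (CtCk_sub ts0 (lexx T) (Hg0 i))) => r _; apply/funext => x; rewrite /comp !mxE.
  exact: CtCk_dot.
apply: tint_le; [exact: continuous_const | exact: CtCk_slice_cont Hex ss |].
move=> x _; rewrite mulr_ge0 ?(admissible_nonneg adm) // /dot sumr_ge0 // => i _.
by rewrite -expr2 sqr_ge0.
Qed.

(** The flux of [fp_approx] for the drift [K q + grad phi] is reproduced exactly by a control; its
    distance to [grad phi] is the flux defect divided by the density, so the excess is quadratic in
    the defect. *)
Lemma cost_upper : s0 < T -> scalar_field 2 p0 -> (forall x, 0 < p0 x) -> forall eta : R, 0 < eta ->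
  exists p al, mfg1_admissible D K T q s0 p0 p al /\
    cost s0 p al <= - tint (fun x => phi s0 x * p0 x) + eta.
Proof.
move=> lt [pp0 Hp0] p00 eta eta0.
pose b (i : 'I_d) s x := comp i (K (q s)) x + partial i (phi s) x.
have pb i s : s \in `[s0, T] -> periodic (b i s).
  move=> ss x j; have h1 := @comp_periodic R d _ i (pK (sub ss)).
  have h2 := @partial_periodic R d i _ (pphi (sub ss)).
  by rewrite /b (h1 x j) (h2 x j).
have Hb i : CtCk s0 T 1 (b i).
  apply: CtCk_sub ts0 (lexx T) _; exact: CtCkD (HK i) (CtCk_partial i Hphi).
have [m [C [m0 C0 H]]] := fp_approx lt D0 pb Hb pp0 Hp0 p00.
(* Half the time integral of the excess is at most [c * e ^+ 2]: each of the [d] components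
   contributes at most [(C * e) ^+ 2 / m]. Below, [e <= 1] is imposed so that [e ^+ 2] is dominated
   by [e]. *)
pose c : R := 2^-1 * (T - s0) * (d%:R * (C ^+ 2 / m)).
have c0 : 0 <= c.
  rewrite /c !mulr_ge0 ?subr_ge0 // ?invr_ge0 ?exprn_ge0 //; exact: ltW.
pose e := Num.min 1 (eta / (c + 1)).
have c1 : 0 < c + 1 by rewrite ltr_wpDl.
have e0 : 0 < e by rewrite lt_min ltr01 divr_gt0.
have e1 : e <= 1 by rewrite ge_min lexx.
have ce : c * e ^+ 2 <= eta.
  have : e * (c + 1) <= eta by rewrite -ler_pdivlMr // ge_min lexx orbT.
  apply: le_trans; rewrite expr2 mulrA -[X in _ <= X]mulrC.
  have ce0 : 0 <= c * e by rewrite mulr_ge0 // ltW.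
  apply: (@le_trans _ _ (c * e)); first by rewrite ler_piMr.
  by rewrite ler_wpM2r ?(ltW e0) // lerDl.
have [p [J [HP [pJ HJ] dp [init pm] HC]]] := H e e0.
have [pp Hp Hdot] := HP.
have p_neq0 s : s \in `[s0, T] -> forall x, p s x != 0.
  by move=> ss x; rewrite gt_eqF // (lt_le_trans m0) // pm.
(* The control for which [p *: (K q + al)] has components [J i + D * partial i p]. *)
pose al s x : E := \row_i ((J i s x + D * partial i (p s) x) / p s x - comp i (K (q s)) x).
have comp_al i s : comp i (al s) = fun x => (J i s x + D * partial i (p s) x) / p s x - comp i (K (q s)) x.
  by apply/funext => x; rewrite /comp /al mxE.
have Hal i : CtCk s0 T 1 (fun s => comp i (al s)).
  apply: CtCk_ext (fun s _ => esym (comp_al i s)) _.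
  apply: CtCkB; last exact: CtCk_sub ts0 (lexx T) (HK i).
  apply: CtCkM; last by apply: CtCkV => //; exact: CtCk_le Hp.
  by apply: CtCkD => //; apply: CtCkM; [exact: CtCk_cst | exact: CtCk_partial].
have pal s : s \in `[s0, T] -> periodic (al s).
  move=> ss x j; apply/rowP => i; rewrite !mxE (pJ i s ss) (pp s ss).
  by rewrite (@partial_periodic R d i _ (pp s ss) x j) (@comp_periodic R d _ i (pK (sub ss)) x j).
have velE s x i : s \in `[s0, T] -> p s x * comp i (fun y => K (q s) y + al s y) x =
    J i s x + D * partial i (p s) x.
  move=> ss; rewrite comp_add comp_al addrC subrK mulrC divfK //; exact: p_neq0.
have adm : mfg1_admissible D K T q s0 p0 p al.
  split; [exact: HP | by split | move=> s ss x; apply: (deriv_on_eq (dp s ss x)) | by move=> x; rewrite init].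
  have HJs i : Ck 1 (J i s) := CtCk_slice (HJ i) ss.
  have Hps : Ck 2 (p s) := CtCk_slice Hp ss.
  suff -> : div (fun y => p s y *: (K (q s) y + al s y)) x =
      \sum_i (partial i (J i s) x + D * partial i (partial i (p s)) x).
    by rewrite big_split /= -mulr_sumr /lap opprD subrK.
  apply: eq_bigr => i _; rewrite comp_scale.
  rewrite (_ : (fun y => _) = fun y => J i s y + D * partial i (p s) y); last first.
    by apply/funext => y; exact: velE.
  have Hdp := Ck_partial i Hps.
  by rewrite (partial_add (Ck_der (HJs i) i x) (Ck_der (Ck_scale D Hdp) i x)) (partial_scale D (Ck_der Hdp i x)).
exists p, al; split=> //; rewrite (admissible_cost lt adm) lerD2l.
apply: le_trans ce; rewrite /c -!mulrA ler_wpM2l //.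
have exle s : s \in `[s0, T] -> excess al phi p s <= d%:R * (C ^+ 2 / m) * e ^+ 2.
  move=> ss; rewrite /excess -[X in _ <= X](@tint_cst R d).
  have Hal0 i : CtCk s0 T 0 (fun s => comp i (al s)) by exact: CtCk_le (Hal i).
  have Hex : CtCk s0 T 0 (fun s x => dot (al s x - grad (phi s) x) (al s x - grad (phi s) x) * p s x).
    apply: CtCkM; last exact: CtCk_le Hp.
    have Hd i : CtCk s0 T 0 (fun s => comp i (fun x => al s x - grad (phi s) x)).
      by apply: CtCk_ext (CtCkB (Hal0 i) (CtCk_sub ts0 (lexx T) (Hg0 i))) => r _; apply/funext => x; rewrite /comp !mxE.
    exact: CtCk_dot.
  apply: tint_le; [exact: CtCk_slice_cont Hex ss | exact: continuous_const |].
  move=> x _; rewrite /dot mulr_suml.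
  rewrite -[X in _ <= X]mulrA mulr_natl -[X in _ *+ X]card_ord -sumr_const; apply: ler_sum => i _.
  have psx : 0 < p s x by rewrite (lt_le_trans m0) // pm.
  pose r := J i s x - (b i s x * p s x - D * partial i (p s) x).
  have rle : `|r| <= C * e by exact: HC.
  have -> : (al s x - grad (phi s) x) 0 i = r / p s x.
    have := comp_al i s => /(congr1 (fun f => f x)); rewrite /comp => ax.
    rewrite !mxE /r /b /comp; move: (partial i (phi s) x) (partial i (p s) x) (K (q s) x 0 i) => A1 A2 A3.
    by field; exact: p_neq0.
  rewrite (_ : r / p s x * (r / p s x) * p s x = r ^+ 2 / p s x); last by field; exact: p_neq0.
  have r2 : r ^+ 2 <= C ^+ 2 * e ^+ 2.
    by rewrite -exprMn -real_normK ?num_real // lerXn2r ?nnegrE // mulr_ge0 // ltW.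
  apply: (le_trans (_ : _ <= r ^+ 2 / m)).
    by rewrite ler_wpM2l ?sqr_ge0 // lef_pV2 ?posrE // pm.
  by rewrite (mulrAC (C ^+ 2)) ler_wpM2r // invr_ge0 ltW.
rewrite -[X in _ <= X](_ : \int[mu]_(s in `[s0, T]) (d%:R * (C ^+ 2 / m) * e ^+ 2) = _).
  apply: within_int_le exle; last by apply: continuous_subspaceT; exact: continuous_const.
  exact: (excess_within lt Hal (CtCk_sub ts0 (lexx T) Hphi) Hp).
by rewrite int_cst // mulrC -!mulrA.
Qed.

(** [inf] takes a default value on an empty or unbounded set, so [has_inf] is established together
    with the formula. The case [s0 = T] is separate because the cost identity needs an interval of
    positive length. *)
Lemma value_formula : scalar_field 2 p0 -> (forall x, 0 < p0 x) ->
  has_inf (costs p0 s0) /\ value p0 s0 = - tint (fun x => phi s0 x * p0 x).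
Proof.
move=> Hp0 p00; set V := - tint _.
suff [lb ub] : (forall c, costs p0 s0 c -> V <= c) /\
    (forall eta : R, 0 < eta -> exists2 c, costs p0 s0 c & c <= V + eta).
  have ne : costs p0 s0 !=set0 by have [c hc _] := ub 1 ltr01; exists c.
  have hl : has_lbound (costs p0 s0) by exists V => c; exact: lb.
  split; first by split.
  apply/eqP; rewrite eq_le; apply/andP; split; last exact: lb_le_inf.
  apply/ler_addgt0Pr => eta eta0; have [c hc ce] := ub eta eta0.
  by apply: le_trans ce; apply: ge_inf.
have [lt|Ts0] := ltP s0 T.
  split=> [c [p [al [adm ->]]]|eta eta0].
    by apply: cost_lower => // x; exact: ltW.
  have [p [al [adm ce]]] := cost_upper lt Hp0 p00 eta0.
  by exists (cost s0 p al) => //; exists p, al.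
have s0E : s0 = T by apply/eqP; rewrite eq_le s0T Ts0.
have costE p al : mfg1_admissible D K T q s0 p0 p al -> cost s0 p al = V.
  move=> [_ _ _ init]; rewrite /mfg1_cost /V s0E set_itv1 Rintegral_set1 addr0.
  rewrite -final_pairing; last exact: Ck_cont Hp0.2.
  by apply: eq_tint => x; rewrite -init s0E.
split=> [c [p [al [adm ->]]]|eta eta0]; first by rewrite (costE _ _ adm).
(* On a one-point time interval [deriv_on] is void: constant curves are admissible. *)
have adm : mfg1_admissible D K T q s0 p0 (fun _ => p0) (fun _ _ => 0).
  have triv (h : R -> R) s l : s \in `[s0, T] -> deriv_on s0 T h s l.
    rewrite s0E in_itv /= => hs; apply/deriv_onP => e e0; exists 1 => // r.
    rewrite in_itv /= => hr /eqP rs _; case: rs.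
    by apply/eqP; rewrite eq_le; move: hs hr; lra.
  split.
  - split=> [s _||]; [exact: Hp0.1 | exact: Ck_CtCk Hp0.2 |].
    exists (fun _ _ => 0); first exact: CtCk_cst.
    by move=> s ss x; exact: triv.
  - split; first by [].
    move=> i; apply: CtCk_ext (CtCk_cst s0 T 1 0) => s _.
    by apply/funext => x; rewrite /comp mxE.
  - by move=> s ss x; exact: triv.
  - by [].
exists (cost s0 (fun _ => p0) (fun _ _ => 0)); first by exists (fun _ => p0), (fun _ _ => 0).
by rewrite (costE _ _ adm) lerDl ltW.
Qed.

End Start.
End Value.

(** * First variation, Hamilton-Jacobi equation, uniqueness of the optimal solution *)

Section MainParts.
Context {R : realType} {d : nat}.
Local Notation E := 'rV[R]_d.
Variables (D t T : R) (K : (E -> R) -> E -> E) (Ks : (E -> E) -> E -> R).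
Variables (calF : (E -> R) -> R) (F G : (E -> R) -> E -> R) (q0 : E -> R) (q phi : R -> E -> R).
Hypotheses (D0 : 0 <= D) (tT : t < T) (hK : velocity_operator K Ks).
Hypothesis hF : forall s, s \in `[t, T] -> first_variation calF (q s) (F (q s)).
Hypothesis hsol : mfg2_solution D K Ks F G t T q0 q phi.

Local Notation value := (mfg1_value D K Ks F G T q phi).
Local Notation Phi := (fun s => Ftilde Ks F (q s) (phi s)).

Let pq s : s \in `[t, T] -> periodic (q s). Proof. by case: (mfg2_q hsol) => h _ _; exact: h. Qed.
Let Hq : CtCk t T 2 q. Proof. by case: (mfg2_q hsol). Qed.
Let pphi s : s \in `[t, T] -> periodic (phi s). Proof. by case: (mfg2_phi hsol) => h _ _; exact: h. Qed.
Let Hphi : CtCk t T 2 phi. Proof. by case: (mfg2_phi hsol). Qed.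
Let pK s : s \in `[t, T] -> periodic (K (q s)). Proof. exact: (mfg2_vel hsol).1. Qed.
Let HK i : CtCk t T 1 (fun s => comp i (K (q s))). Proof. exact: (mfg2_vel hsol).2. Qed.

Lemma grad_opp (f : E -> R) x : Ck 1 f -> grad (fun y => - f y) x = - grad f x.
Proof. by move=> Hf; apply/rowP => i; rewrite !mxE (partial_opp (Ck_der Hf i x)). Qed.

Lemma lap_opp (f : E -> R) x : Ck 2 f -> lap (fun y => - f y) x = - lap f x.
Proof.
move=> Hf; rewrite /lap -sumrN; apply: eq_bigr => i _.
rewrite (_ : partial i (fun y => - f y) = fun y => - partial i f y).
  by rewrite (partial_opp (Ck_der (Ck_partial i Hf) i x)).
by apply/funext => y; rewrite (partial_opp (Ck_der (Ck_pred Hf) i y)).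
Qed.

Lemma dotNr (u v : E) : dot u (- v) = - dot u v.
Proof. by rewrite /dot -sumrN; apply: eq_bigr => i _; rewrite mxE mulrN. Qed.

Lemma dotZl (c : R) (u v : E) : dot (c *: u) v = c * dot u v.
Proof. by rewrite /dot mulr_sumr; apply: eq_bigr => i _; rewrite mxE mulrA. Qed.

Lemma continuous_dot (u v : E -> E) : (forall i, continuous (comp i u)) ->
  (forall i, continuous (comp i v)) -> continuous (fun x => dot (u x) (v x)).
Proof.
move=> cu cv; apply: (@Ck_cont _ _ 0).
apply: (@Ck_sum _ _ 'I_d _ 0 (fun i x => comp i u x * comp i v x)) => i.
by apply: CkM; split.
Qed.

(** On the torus a positive density is bounded away from 0 and [eta] is bounded. Hence the value
    formula stays available along [p + r * eta] for small [r] of either sign. *)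
Lemma field_positive_perturb (p eta : E -> R) : scalar_field 2 p -> (forall x, 0 < p x) ->
  scalar_field 2 eta -> exists2 dl : R, 0 < dl & forall r, `|r| < dl ->
    scalar_field 2 (fun x => p x + r * eta x) /\ forall x, 0 < p x + r * eta x.
Proof.
move=> [pp Hp] p0 [pe He].
have [m m0 hm] := field_pos_bound pp Hp p0; have [C C0 hC] := field_bounded pe He.
exists (m / C); first exact: divr_gt0.
move=> r rd; split; first split.
- by move=> x i; rewrite pp pe.
- exact: CkD Hp (Ck_scale r He).
move=> x; have h1 := hm x; have : `|r * eta x| < m.
  rewrite normrM; apply: (le_lt_trans (_ : _ <= `|r| * C)); first by rewrite ler_wpM2l.
  by rewrite -ltr_pdivlMr.
rewrite ltr_norml => /andP[h2 _]; move: h1 h2; move: (r * eta x) (p x) => u v; lra.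
Qed.

(** Near [p] the value is an explicit linear functional, so the difference quotient equals the
    pairing exactly and its error is 0. *)
Lemma first_variation_value p s : scalar_field 2 p -> (forall x, 0 < p x) -> s \in `[t, T] ->
  first_variation (fun p' => value p' s) p (fun x => - phi s x).
Proof.
move=> Hp p0 st; have Hs : Ck 2 (phi s) := CtCk_slice Hphi st.
split.
  split; first by move=> x i; rewrite (pphi st).
  by apply: CkN; exact: Ck_le Hs.
move=> eta Heta; apply/is_deriveP => e e0.
have [dl dl0 hdl] := field_positive_perturb Hp p0 Heta.
exists dl => // r r0; rewrite subr0 => rd; have [Hr r_pos] := hdl r rd.
have cphi : continuous (phi s) := Ck_cont Hs.
have cp : continuous p := Ck_cont Hp.2.
have ce : continuous eta := Ck_cont Heta.2.
have cpp : continuous (fun x => phi s x * p x) by exact: continuous_mul.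
have cpe : continuous (fun x => phi s x * eta x) by exact: continuous_mul.
have z : (fun x => p x + 0 * eta x) = p by apply/funext => x; rewrite mul0r addr0.
rewrite z (value_formula D0 tT hsol st Hr r_pos).2 (value_formula D0 tT hsol st Hp p0).2.
under eq_tint => x do rewrite mulrDr mulrCA.
rewrite tintD //; last by apply: continuous_mul => //; exact: continuous_const.
rewrite tintZ //; under [tint (fun x => - _ * _)]eq_tint => x do rewrite mulNr.
rewrite tintN //; move: (tint _) (tint _) => A B.
rewrite (_ : (_ / _ - _) = 0) ?normr0 //; by field.
Qed.

Lemma hj_algebra (a b c e f g dU X1 X4 X5 : R) :
  dU = - (a - b - 2^-1 * c - e - D * f) -> X1 = c -> X4 = - f -> X5 = - e - g -> g = b ->
  dU - 2^-1 * X1 + a + D * X4 + X5 = 0.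
Proof. by move=> -> -> -> -> ->; ring. Qed.

Lemma hjb_mul_algebra (f S a k l p : R) :
  (f - S - 2^-1 * a - k - D * l) * p = f * p - S * p - 2^-1 * (a * p) - k * p - D * (l * p).
Proof. by ring. Qed.

Lemma value_hamilton_jacobi p s : scalar_field 2 p -> (forall x, 0 < p x) -> s \in `[t, T] ->
  exists dU : R, deriv_on t T (value p) s dU /\
    let V := fun x => - phi s x in
    dU - 2^-1 * tint (fun x => dot (grad V x) (grad V x) * p x)
    + tint (fun x => F (q s) x * p x)
    + D * tint (fun x => p x * lap V x)
    + tint (fun x => p x * dot (K (q s) x) (grad V x) + q s x * dot (K p x) (grad V x)) = 0.
Proof.
move=> Hp p0 st; have Hs : Ck 2 (phi s) := CtCk_slice Hphi st.
have Hqs : Ck 2 (q s) := CtCk_slice Hq st.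
pose gphi r x := Phi r x - 2^-1 * dot (grad (phi r) x) (grad (phi r) x)
  - dot (K (q r) x) (grad (phi r) x) - D * lap (phi r) x.
exists (- tint (fun x => gphi s x * p x)); split.
  apply: (@deriv_on_ext _ t T (fun r => - tint (fun x => phi r x * p x))) => //.
    by move=> r rt; rewrite (value_formula D0 tT hsol rt Hp p0).2.
  apply: deriv_onN.
  apply: (@tint_deriv_on R d t T (fun r x => phi r x * p x) (fun r x => gphi r x * p x)) => //.
  - by apply: CtCkM; [exact: CtCk_le Hphi | apply: Ck_CtCk; exact: Ck_le Hp.2].
  - apply: CtCkM; last by apply: Ck_CtCk; exact: Ck_le Hp.2.
    have HK0 i : CtCk t T 0 (fun r => comp i (K (q r))) by exact: CtCk_le (HK i).
    have Hg0 i : CtCk t T 0 (fun r => comp i (grad (phi r))).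
      exact: (CtCk_le (isT : (0 <= 1)%N) (CtCk_grad i Hphi)).
    apply: CtCkB; last by apply: CtCkM; [exact: CtCk_cst | exact: CtCk_lap].
    apply: CtCkB; last exact: CtCk_dot.
    apply: CtCkB; first exact: (Phi_CtCk tT hsol).
    by apply: CtCkM; [exact: CtCk_cst | exact: CtCk_dot].
  - move=> r rt x; have H := @mfg2_hjb' R d D t T K Ks F G q0 q phi hsol r rt x.
    have c : deriv_on t T (fun=> p x) r 0.
      by apply: is_derive_deriv_on; exact: is_derive_cst.
    by apply: (deriv_on_eq (deriv_onM rt H c)); rewrite mulr0 addr0.
have cp : continuous p := Ck_cont Hp.2.
have Hgs i : Ck 1 (comp i (grad (phi s))) by rewrite comp_grad; exact: Ck_partial.
have cg i : continuous (comp i (grad (phi s))) := Ck_cont (Hgs i).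
have cK i : continuous (comp i (K (q s))) := CtCk_slice_cont (HK i) st.
have cKp i : continuous (comp i (K p)) := Ck_cont ((vel_field hK Hp).2 i).
(* Testing [Ks w] against [p] gives, by adjointness, the integral of [dot (w x) (K p x)]: the term
   of [Ftilde] that distinguishes it from [F] becomes the term with [K p]. *)
pose w x : E := q s x *: grad (phi s) x.
have comp_w i : comp i w = fun x => q s x * comp i (grad (phi s)) x by exact: comp_scale.
have Hw : vector_field 1 w.
  split=> [x j|i]; last by rewrite comp_w; exact: CkM (Ck_pred Hqs) (Hgs i).
  rewrite /w (pq st); congr (_ *: _); apply/rowP => i; rewrite !mxE.
  exact: (@partial_periodic R d i _ (pphi st) x j).
have cw i : continuous (comp i w) := Ck_cont (Hw.2 i).
have cF : continuous (F (q s)) := Ck_cont (hF st).1.2.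
have cS : continuous (Ks w) := Ck_cont (vel_adj_field hK Hw).2.
have cl : continuous (lap (phi s)).
  by apply: (@Ck_cont _ _ 0); apply: Ck_sum => i; do 2 apply: Ck_partial.
have c1 : continuous (fun x => F (q s) x * p x) by exact: continuous_mul.
have c2 : continuous (fun x => Ks w x * p x) by exact: continuous_mul.
have c3 : continuous (fun x => dot (grad (phi s) x) (grad (phi s) x) * p x).
  by apply: continuous_mul => //; exact: continuous_dot.
have c4 : continuous (fun x => dot (K (q s) x) (grad (phi s) x) * p x).
  by apply: continuous_mul => //; exact: continuous_dot.
have c5 : continuous (fun x => lap (phi s) x * p x) by exact: continuous_mul.
have c6 : continuous (fun x => dot (w x) (K p x)) by exact: continuous_dot.
have c3' : continuous (fun x => 2^-1 * (dot (grad (phi s) x) (grad (phi s) x) * p x)).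
  by apply: continuous_mul => //; exact: continuous_const.
have c5' : continuous (fun x => D * (lap (phi s) x * p x)).
  by apply: continuous_mul => //; exact: continuous_const.
have eg x := @grad_opp (phi s) x (Ck_pred Hs); have el x := @lap_opp (phi s) x Hs.
move=> V; rewrite /V.
apply: (@hj_algebra _ (tint (fun x => Ks w x * p x))
  (tint (fun x => dot (grad (phi s) x) (grad (phi s) x) * p x))
  (tint (fun x => dot (K (q s) x) (grad (phi s) x) * p x))
  (tint (fun x => lap (phi s) x * p x)) (tint (fun x => dot (w x) (K p x)))).
- congr (- _); under eq_tint => x do rewrite /gphi /Ftilde hjb_mul_algebra.
  have c12 := continuous_sub c1 c2; have c123 := continuous_sub c12 c3'.
  have c1234 := continuous_sub c123 c4.
  by rewrite (tintB c1234 c5') (tintB c123 c4) (tintB c12 c3') (tintB c1 c2) (tintZ _ c3) (tintZ _ c5).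
- by apply: eq_tint => x; rewrite eg dotNr dotC dotNr opprK.
- by rewrite -tintN //; apply: eq_tint => x; rewrite el mulrN mulrC.
- rewrite -tintN // -tintB //; last exact: continuous_opp.
  apply: eq_tint => x; rewrite eg !dotNr /w dotZl (dotC (K p x)) !mulrN.
  by rewrite (mulrC (p x)).
- exact: (vel_adjoint hK Hw Hp).
Qed.

Lemma mfg2_mfg1_solution : mfg1_solution D K Ks F G T q phi t q0 q phi.
Proof.
split; try by case: hsol.
move=> s st x; have H := @mfg2_hjb' R d D t T K Ks F G q0 q phi hsol s st x.
apply: (deriv_on_eq H); move: (Ftilde _ _ _ _ _) (dot _ _) (dot _ _) (lap _ _) => A B C L; ring.
Qed.

Lemma mfg1_solution_unique p psi : mfg1_solution D K Ks F G T q phi t q0 p psi ->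
  forall s, s \in `[t, T] -> forall x, p s x = q s x /\ psi s x = phi s x.
Proof.
case=> -[pp Hp _] [ppsi Hpsi _] fp init hjb fin.
have hjb' s (st : s \in `[t, T]) x : deriv_on t T (psi ^~ x) s
  (Phi s x - 2^-1 * dot (grad (psi s) x) (grad (psi s) x) - dot (K (q s) x) (grad (psi s) x)
   - D * lap (psi s) x).
  have H := hjb s st x; apply: (deriv_on_eq H).
  move: (Ftilde _ _ _ _ _) (dot _ _) (dot _ _) (lap _ _) => A B C L; ring.
have hphi s (st : s \in `[t, T]) x := @mfg2_hjb' R d D t T K Ks F G q0 q phi hsol s st x.
(* The equation of [psi] does not involve [p], so it is settled first; afterwards [p] and [q] solve
   one linear equation with the drift [K q + grad phi]. *)
have psiE s : s \in `[t, T] -> psi s = phi s.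
  move=> st; apply/funext => x; apply/eqP; rewrite eq_le; apply/andP; split.
    apply: (@hjb_compare R d D t T (fun s => K (q s)) Phi D0 (ltW tT) phi psi pphi Hphi ppsi Hpsi hphi hjb') => //.
    by move=> y; rewrite fin (mfg2_final hsol).
  apply: (@hjb_compare R d D t T (fun s => K (q s)) Phi D0 (ltW tT) psi phi ppsi Hpsi pphi Hphi hjb' hphi) => //.
  by move=> y; rewrite fin (mfg2_final hsol).
move=> s st x; split; last by rewrite psiE.
pose v s y := K (q s) y + grad (phi s) y.
have pv r : r \in `[t, T] -> periodic (v r).
  move=> rt y j; rewrite /v (pK rt); congr (_ + _); apply/rowP => i; rewrite !mxE.
  exact: (@partial_periodic R d i _ (pphi rt) y j).
have Hv i : CtCk t T 1 (fun r => comp i (v r)).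
  exact: CtCk_comp_add (HK i) (CtCk_grad i Hphi).
have fp' r (rt : r \in `[t, T]) y : deriv_on t T (p ^~ y) r
    (- div (fun z => p r z *: v r z) y + D * lap (p r) y).
  by have := fp r rt y; rewrite psiE.
have fq r (rt : r \in `[t, T]) y : deriv_on t T (q ^~ y) r
    (- div (fun z => q r z *: v r z) y + D * lap (q r) y).
  by have h := mfg2_fp hsol rt; exact: h.
apply/eqP; rewrite eq_le; apply/andP; split.
  apply: (@fp_unique R d D t T v D0 (ltW tT) pv Hv q p pq Hq pp Hp fq fp') => //.
  by move=> y; rewrite init (mfg2_init hsol).
apply: (@fp_unique R d D t T v D0 (ltW tT) pv Hv p q pp Hp pq Hq fp' fq) => //.
by move=> y; rewrite init (mfg2_init hsol).
Qed.

End MainParts.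
Theorem theorem8 (R : realType) (d : nat) (hd : (0 < d <= 2)%N)
  (D t T : R) (hD : 0 <= D) (htT : t < T)
  (K : ('rV[R]_d -> R) -> 'rV[R]_d -> 'rV[R]_d)
  (Ks : ('rV[R]_d -> 'rV[R]_d) -> 'rV[R]_d -> R)
  (hK : velocity_operator K Ks)
  (calF calG : ('rV[R]_d -> R) -> R)
  (F G : ('rV[R]_d -> R) -> 'rV[R]_d -> R)
  (q0 : 'rV[R]_d -> R) (q phi : R -> 'rV[R]_d -> R)
  (hF : forall s, s \in `[t, T] -> first_variation calF (q s) (F (q s)))
  (hG : first_variation calG (q T) (G (q T)))
  (hsol : mfg2_solution D K Ks F G t T q0 q phi) :
  let U := mfg1_value D K Ks F G T q phi in
  (* Hamilton-Jacobi equation, at positive densities p *)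
  (forall (p : 'rV[R]_d -> R) (s : R),
     scalar_field 2 p -> (forall x, 0 < p x) -> s \in `[t, T] ->
     has_inf (mfg1_costs D K Ks F G T q phi p s) /\
     exists (V : 'rV[R]_d -> R) (dU : R),
       [/\ scalar_field 2 V,
           first_variation (fun p' => U p' s) p V,
           deriv_on t T (U p) s dU &
           dU - 2^-1 * tint (fun x => dot (grad V x) (grad V x) * p x)
           + tint (fun x => F (q s) x * p x)
           + D * tint (fun x => p x * lap V x)
           + tint (fun x => p x * dot (K (q s) x) (grad V x)
                            + q s x * dot (K p x) (grad V x)) = 0])
  (* terminal condition *)
  /\ (forall p : 'rV[R]_d -> R,
        scalar_field 2 p -> (forall x, 0 < p x) ->
        U p T = tint (fun x => G (q T) x * p x))
  (* with the same initial condition, the optimal solution is (q, phi) *)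
  /\ (mfg1_solution D K Ks F G T q phi t q0 q phi /\
      forall p psi : R -> 'rV[R]_d -> R,
        mfg1_solution D K Ks F G T q phi t q0 p psi ->
        forall s, s \in `[t, T] -> forall x, p s x = q s x /\ psi s x = phi s x).
Proof.
move=> U; split; [|split; [|split]].
- move=> p s Hp p0 st; split; first exact: (value_formula hD htT hsol st Hp p0).1.
  have [dU [hdU HJ]] := value_hamilton_jacobi hD htT hK hF hsol Hp p0 st.
  exists (fun x => - phi s x), dU; split.
  + have [pphi Hphi _] := mfg2_phi hsol.
    split; first by move=> x i; rewrite (pphi s st).
    by apply: CkN; exact: (CtCk_slice Hphi st).
  + exact: (first_variation_value hD htT hsol Hp p0 st).
  + exact: hdU.
  + exact: HJ.
- move=> p Hp p0; have Tt : T \in `[t, T] by rewrite in_itv /= lexx ltW.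
  by rewrite /U (value_formula hD htT hsol Tt Hp p0).2 -(final_pairing htT hsol (Ck_cont Hp.2)).
- exact: mfg2_mfg1_solution hsol.
- by move=> p psi; exact: (mfg1_solution_unique hD htT hsol).
Qed.
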